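(* Let $A$ be a finite-dimensional $\mathbb{Z}$-graded algebra over a field $K$ with a triangular decomposition $(A^-,T,A^+)$. If $T$ is semisimple and $A$ is self-injective, then $\mathcal{G}(A)$ has tilting objects $T(\lambda)$ in the sense of Ringel. That is: for each $\lambda\in\operatorname{Irr}\mathcal{G}(T)$ there is an indecomposable tilting object $T(\lambda)$ of $\mathcal{G}(A)$, uniquely characterized (up to isomorphism) by the property that it has highest weight $\lambda$, an injection $\Delta(\lambda)\hookrightarrow T(\lambda)$, and a surjection $T(\lambda)\twoheadrightarrow\nabla(\lambda)$; moreover $\lambda\mapsto T(\lambda)$ is a bijection between $\operatorname{Irr}\mathcal{G}(T)$ and the isomorphism classes of indecomposable tilting objects of $\mathcal{G}(A)$.
   Context: **Triangular decomposition.** A triangular decomposition of $A$ is a triple $(A^-,T,A^+)$ of graded subalgebras such that: (a) multiplication $A^-\otimes_K T\otimes_K A^+\to A$ is an isomorphism of vector spaces; (b) $T$ is concentrated in degree $0$, $A^+$ is supported in degrees $\ge 0$ and $A^-$ in degrees $\le 0$; (c) $A^-_0=K=A^+_0$; (d) $A^+T=TA^+$ and $A^-T=TA^-$; (e) $T$ is split over $K$, i.e. $\operatorname{End}_T(\lambda)=K$ for every simple $T$-module $\lambda$. **Notation.** $\mathcal{G}(A)$ is the category of finitely generated graded left $A$-modules with degree-preserving morphisms; $\operatorname{Irr}$ is the set of isomorphism classes of simple objects. $B^{\pm}=A^{\pm}T$, a graded subalgebra; $T$-modules become $B^\pm$-modules via the quotient map $B^\pm\to T$ killing nonzero degrees.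 Each $\lambda\in\operatorname{Irr}\mathcal{G}(T)$ lies in a single degree $\deg\lambda$; put $\lambda<\mu$ iff $\deg\lambda<\deg\mu$. $A^{\mathrm{op}}$ is graded by $(A^{\mathrm{op}})_i=A_{-i}$; for $M\in\mathcal{G}(A)$, $M^*=\operatorname{Hom}_K(M,K)$ is a graded left $A^{\mathrm{op}}$-module with $(M^* )_i=(M_i)^*$. The standard and costandard objects (for $T$ semisimple) are $\Delta(\lambda)=A\otimes_{B^+}\lambda$ and $\nabla(\lambda)=\bigl(A^{\mathrm{op}}\otimes_{(B^-)^{\mathrm{op}}}\lambda^*\bigr)^*$. $\Delta(\lambda)$ has a simple head $L(\lambda)$, and $\lambda\mapsto L(\lambda)$ is a bijection $\operatorname{Irr}\mathcal{G}(T)\to\operatorname{Irr}\mathcal{G}(A)$. **Definitions.** $M\in\mathcal{G}(A)$ is tilting if it has both a finite filtration with subquotients of the form $\Delta(\mu)$ and a finite filtration with subquotients of the form $\nabla(\mu)$. $M$ has highest weight $\lambda$ if $[M:L(\lambda)]=1$ and $[M:L(\mu)]\ne 0$ implies $\mu\le\lambda$ (i.e. $\mu=\lambda$ or $\deg\mu<\deg\lambda$). $A$ is self-injective if the left module $A$ is injective. *)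

(* Defs.v *)
From HB Require Import structures.
From mathcomp Require Import all_boot all_order all_algebra.
From mathcomp Require Import falgebra.
From mathcomp Require Import boolp classical_sets.

Set Implicit Arguments.
Unset Strict Implicit.
Unset Printing Implicit Defensive.

Import GRing.Theory.
Local Open Scope classical_set_scope.
Local Open Scope ring_scope.

(* [A^c] is the library's converse ring; here it receives the K-algebra
   structure of [A^op], with the same scaling as [A].  Left [A^op]-modules are
   [lmodType A^c]. *)
HB.instance Definition _ (K : fieldType) (A : algType K) :=
  GRing.Lmodule.copy A^c A.

Lemma converse_scalerAl (K : fieldType) (A : algType K) (k : K) (x y : A^c) :
  k *: (x * y) = (k *: x : A^c) * y.
Proof. exact: (@scalerAr K A k y x). Qed.

HB.instance Definition _ (K : fieldType) (A : algType K) :=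
  GRing.Lmodule_isLalgebra.Build K A^c (@converse_scalerAl K A).

Lemma converse_scalerAr (K : fieldType) (A : algType K) (k : K) (x y : A^c) :
  k *: (x * y) = x * (k *: y : A^c).
Proof. exact: (@scalerAl K A k y x). Qed.

HB.instance Definition _ (K : fieldType) (A : algType K) :=
  GRing.Lalgebra_isAlgebra.Build K A^c (@converse_scalerAr K A).

Definition submodule (R : nzRingType) (V : lmodType R) (U : set V) : Prop :=
  U 0 /\ forall a u v, U u -> U v -> U (a *: u + v).

Definition internal_dsum (V : zmodType) (U W : set V) : Prop :=
  U `&` W = [set 0] /\
  forall x, exists u w, [/\ U u, W w & x = u + w].

Definition simple_module (R : nzRingType) (V : lmodType R) : Prop :=
  (exists x : V, x <> 0) /\
  forall U : set V, submodule U -> U = [set 0] \/ U = setT.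

Definition semisimple_module (R : nzRingType) (V : lmodType R) : Prop :=
  forall U : set V, submodule U ->
    exists W : set V, submodule W /\ internal_dsum U W.

Definition semisimple_ring (R : nzRingType) : Prop := semisimple_module R^o.

Definition injective_module (R : nzRingType) (I : lmodType R) : Prop :=
  forall (X Y : lmodType R) (i : {linear X -> Y}) (g : {linear X -> I}),
    injective i -> exists h : {linear Y -> I}, forall x, h (i x) = g x.

Definition self_injective (R : nzRingType) : Prop := injective_module R^o.

Definition split_algebra (K : fieldType) (S : algType K) : Prop :=
  forall V : lmodType S, simple_module V ->
    forall f : {linear V -> V}, exists k : K, forall v, f v = k%:A *: v.

Definition graded_sum (V : zmodType) (V_ : int -> set V) : set V :=
  [set x | exists (s : seq int) (f : int -> V),
             (forall i, V_ i (f i)) /\ x = \sum_(i <- s) f i].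

(* V is the internal direct sum of the subgroups V_i, i an integer. *)
Definition grading (V : zmodType) (V_ : int -> set V) : Prop :=
  [/\ forall i, V_ i 0,
      forall i x y, V_ i x -> V_ i y -> V_ i (x - y),
      forall x, graded_sum V_ x
    & forall (s : seq int) (f : int -> V), uniq s -> (forall i, V_ i (f i)) ->
        \sum_(i <- s) f i = 0 -> forall i, i \in s -> f i = 0].

(* A subset (in practice a subgroup U) is graded when every element of U is a
   sum of homogeneous elements of U. *)
Definition graded_subset (V : zmodType) (V_ : int -> set V) (U : set V) : Prop :=
  U `<=` graded_sum (fun i => U `&` V_ i).

Definition vs_set (K : fieldType) (V : vectType K) (U : {vspace V}) : set V :=
  [set v | v \in U].

Definition alg_grading (K : fieldType) (A : falgType K) (gr : int -> {vspace A})
  : int -> set A := fun i => vs_set (gr i).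

Definition graded_algebra (K : fieldType) (A : falgType K)
    (gr : int -> {vspace A}) : Prop :=
  [/\ grading (alg_grading gr),
      1 \in gr 0
    & forall i j a b, a \in gr i -> b \in gr j -> a * b \in gr (i + j)].

Definition sub_grading (K : fieldType) (A : falgType K) (gr : int -> {vspace A})
    (B : {aspace A}) : int -> set (subvs_of B) :=
  fun i => [set b | vsval b \in gr i].

Definition op_grading (K : fieldType) (A : algType K) (gr : int -> set A)
  : int -> set A^c := fun i => gr (- i).

(* An {aspace A} has an identity element, possibly different from 1;
   subalgebras are required here to contain 1. *)
Definition graded_subalgebra (K : fieldType) (A : falgType K)
    (gr : int -> {vspace A}) (B : {aspace A}) : Prop :=
  1 \in B /\ graded_subset (alg_grading gr) (vs_set B).

Definition trilinear (K : fieldType) (X Y Z V : lmodType K)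
    (beta : X -> Y -> Z -> V) : Prop :=
  [/\ forall y z, linear (fun x => beta x y z),
      forall x z, linear (fun y => beta x y z)
    & forall x y, linear (fun z => beta x y z)].

(* The multiplication X (x) Y (x) Z -> A is an isomorphism: A, with the map
   (x, y, z) |-> x * y * z, has the universal property of the tensor product
   over K. *)
Definition mult_tensor_iso (K : fieldType) (A : falgType K)
    (X Y Z : {vspace A}) : Prop :=
  forall (V : lmodType K) (beta : subvs_of X -> subvs_of Y -> subvs_of Z -> V),
    trilinear beta ->
    exists h : {linear A -> V},
      (forall x y z, h (vsval x * vsval y * vsval z) = beta x y z) /\
      (forall h' : {linear A -> V},
         (forall x y z, h' (vsval x * vsval y * vsval z) = beta x y z) ->
         h' =1 h).

Record triangular_decomposition (K : fieldType) (A : falgType K)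
    (gr : int -> {vspace A}) (Am T Ap : {aspace A}) : Prop :=
  TriangularDecomposition {
    tri_Am_graded : graded_subalgebra gr Am;
    tri_T_graded : graded_subalgebra gr T;
    tri_Ap_graded : graded_subalgebra gr Ap;
    tri_mult : mult_tensor_iso Am T Ap;
    tri_T_degree : (T <= gr 0%R)%VS;
    tri_Ap_degree : forall i : int, i < 0 -> (Ap :&: gr i)%VS = 0%VS;
    tri_Am_degree : forall i : int, 0 < i -> (Am :&: gr i)%VS = 0%VS;
    tri_Am0 : (Am :&: gr 0%R)%VS = 1%VS;
    tri_Ap0 : (Ap :&: gr 0%R)%VS = 1%VS;
    tri_ApT : (Ap * T)%VS = (T * Ap)%VS;
    tri_AmT : (Am * T)%VS = (T * Am)%VS;
    tri_split : split_algebra (subvs_of T)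
  }.

Record gmod (K : fieldType) (A : algType K) (gr : int -> set A) := GMod {
  gm_module :> lmodType A;
  gm_comp : int -> set gm_module;
  gm_grading : grading gm_comp;
  gm_act : forall i j a x, gr i a -> gm_comp j x -> gm_comp (i + j) (a *: x);
  gm_fingen : exists (n : nat) (e : 'I_n -> gm_module),
    forall x, exists c : 'I_n -> A, x = \sum_(i < n) c i *: e i
}.

Arguments gm_comp {K A gr} M i _ : rename.

Section GradedModules.
Variables (K : fieldType) (A : algType K) (gr : int -> set A).
Implicit Types (M N X L : gmod gr).

Definition degree_preserving M N (f : M -> N) : Prop :=
  forall i x, gm_comp M i x -> gm_comp N i (f x).

Definition giso M N : Prop :=
  exists (f : {linear M -> N}) (g : {linear N -> M}),
    [/\ degree_preserving f, degree_preserving g, cancel f g & cancel g f].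

Definition gembeds M N : Prop :=
  exists f : {linear M -> N}, degree_preserving f /\ injective f.

Definition gsurjects M N : Prop :=
  exists f : {linear M -> N},
    degree_preserving f /\ forall y, exists x, f x = y.

Definition graded_submodule M (U : set M) : Prop :=
  submodule U /\ graded_subset (gm_comp M) U.

Definition gsimple M : Prop :=
  (exists x : M, x <> 0) /\
  forall U : set M, graded_submodule U -> U = [set 0] \/ U = setT.

Definition gindecomposable M : Prop :=
  (exists x : M, x <> 0) /\
  forall U W : set M, graded_submodule U -> graded_submodule W ->
    internal_dsum U W -> U = [set 0] \/ W = [set 0].

Definition maximal_graded_submodule M (U : set M) : Prop :=
  [/\ graded_submodule U, U <> setT
    & forall W : set M, graded_submodule W -> U `<=` W -> W = U \/ W = setT].

Definition gradical M : set M :=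
  [set x | forall U : set M, maximal_graded_submodule U -> U x].

(* L is isomorphic to the head M / rad M. *)
Definition is_head M L : Prop :=
  exists f : {linear M -> L},
    [/\ degree_preserving f, forall y, exists x, f x = y
      & forall x, f x = 0 <-> gradical x].

(* For graded submodules U `<=` W of M, W / U is isomorphic to X. The
   isomorphism is given by a map W -> X with kernel U; the values of f outside
   W are irrelevant. *)
Definition subquotient_iso M (U W : set M) X : Prop :=
  exists f : M -> X,
    [/\ forall a u v, W u -> W v -> f (a *: u + v) = a *: f u + f v,
        forall i u, W u -> gm_comp M i u -> gm_comp X i (f u),
        forall y, exists2 u, W u & f u = y
      & forall u, W u -> (f u = 0 <-> U u)].

(* M has a filtration 0 = F_0 <= ... <= F_n = M whose successive subquotients
   are the n members of s; M is also the (unused) default value of nth. *)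
Definition has_filtration M (s : seq (gmod gr)) : Prop :=
  exists F : nat -> set M,
    [/\ F 0%N = [set 0], F (size s) = setT,
        forall i, (i <= size s)%N -> graded_submodule (F i)
      & forall i, (i < size s)%N ->
          F i `<=` F i.+1 /\ subquotient_iso (F i) (F i.+1) (nth M s i)].

Definition filtered_by (P : gmod gr -> Prop) M : Prop :=
  exists s, has_filtration M s /\
            forall i, (i < size s)%N -> P (nth M s i).

(* [M : L] = n *)
Definition composition_multiplicity M L (n : nat) : Prop :=
  exists s, [/\ has_filtration M s,
                forall i, (i < size s)%N -> gsimple (nth M s i)
              & count (fun X => `[< giso X L >]) s = n].

Definition has_degree M (d : int) : Prop := forall x, gm_comp M d x.

Definition degree_lt M N : Prop :=
  exists d e, [/\ has_degree M d, has_degree N e & d < e].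

End GradedModules.

Section Induced.
Variables (K : fieldType) (A : algType K) (gr : int -> set A).
Variables (S : algType K) (grS : int -> set S) (iota : S -> A) (B : set A).

Definition nonzero_degree_part : set A :=
  graded_sum (fun i => if i == 0 then [set 0] else gr i).

(* In the application S is (via iota) the degree zero part of the graded
   subalgebra B of A, and [nonzero_degree_part (b - iota t)] says that t is the
   image of b under the quotient map B -> S killing the nonzero degrees. So
   beta is B-balanced for the B-module obtained by inflating lam. *)
Definition balanced (lam : gmod grS) (Z : zmodType) (beta : A -> lam -> Z)
  : Prop :=
  [/\ forall a a' x, beta (a + a') x = beta a x + beta a' x,
      forall a x x', beta a (x + x') = beta a x + beta a x'
    & forall a b t x, B b -> nonzero_degree_part (b - iota t) ->
        beta (a * b) x = beta a (t *: x)].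

(* P is A (x)_B lam, with its A-action and total grading. The last condition
   determines the grading, as the tau a x generate P additively. *)
Definition is_induced (lam : gmod grS) (P : gmod gr) : Prop :=
  exists tau : A -> lam -> P,
    [/\ balanced tau,
        forall (Z : zmodType) (beta : A -> lam -> Z), balanced beta ->
          exists h : {additive P -> Z},
            (forall a x, h (tau a x) = beta a x) /\
            (forall h' : {additive P -> Z},
               (forall a x, h' (tau a x) = beta a x) -> h' =1 h),
        forall a b x, a *: tau b x = tau (a * b) x
      & forall i j a x, gr i a -> gm_comp lam j x ->
          gm_comp P (i + j) (tau a x)].

End Induced.

Definition klinear (K : fieldType) (A : algType K) (M : lmodType A)
    (phi : M -> K) : Prop :=
  forall (k : K) x y, phi (k%:A *: x + y) = k * phi x + phi y.

(* N is isomorphic, by the map ev, to M^* = Hom_K(M, K). The map op identifies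
   the algebra A' acting on N with the opposite of the algebra A acting on M. *)
Definition is_dual (K : fieldType) (A A' : algType K) (op : A' -> A)
    (gr : int -> set A) (gr' : int -> set A') (M : gmod gr) (N : gmod gr')
  : Prop :=
  exists ev : N -> M -> K,
    [/\ forall n, klinear (ev n),
        forall phi : M -> K, klinear phi -> exists n, ev n = phi,
        injective ev,
        forall a n n' x, ev (a *: n + n') x = ev n (op a *: x) + ev n' x
      & forall i n, gm_comp N i n <->
          forall j x, j <> i -> gm_comp M j x -> ev n x = 0].

Section Tilting.
Variables (K : fieldType) (A : falgType K) (gr : int -> {vspace A}).
Variables (Am T Ap : {aspace A}).

Definition GA := gmod (alg_grading gr).
Definition GT := gmod (@sub_grading K A gr T).
Definition GAop := gmod (op_grading (alg_grading gr)).
Definition GTop := gmod (op_grading (@sub_grading K A gr T)).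

(* Delta(lam) = A (x)_{B^+} lam with B^+ = A^+ T *)
Definition is_standard (lam : GT) (D : GA) : Prop :=
  is_induced (fun t : subvs_of T => vsval t) (vs_set (Ap * T)%VS) lam D.

(* nabla(lam) = (A^op (x)_{(B^-)^op} lam^* )^* with B^- = A^- T *)
Definition is_costandard (lam : GT) (N : GA) : Prop :=
  exists (lamd : GTop) (P : GAop),
    [/\ is_dual (fun t : (subvs_of T)^c => (t : subvs_of T)) lam lamd,
        is_induced (fun t : (subvs_of T)^c => (vsval (t : subvs_of T) : A^c))
                   (vs_set (Am * T)%VS : set A^c) lamd P
      & is_dual (fun a : A => (a : A^c)) P N].

Definition is_simple_of (lam : GT) (L : GA) : Prop :=
  exists2 D : GA, is_standard lam D & is_head D L.

Definition tilting (M : GA) : Prop :=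
  filtered_by (fun X => exists2 mu, gsimple mu & is_standard mu X) M /\
  filtered_by (fun X => exists2 mu, gsimple mu & is_costandard mu X) M.

Definition weight_le (mu lam : GT) : Prop := giso mu lam \/ degree_lt mu lam.

Definition highest_weight (M : GA) (lam : GT) : Prop :=
  (exists2 L, is_simple_of lam L & composition_multiplicity M L 1) /\
  (forall (mu : GT) (L : GA) (n : nat), gsimple mu -> is_simple_of mu L ->
     composition_multiplicity M L n -> n <> 0%N -> weight_le mu lam).

Definition indecomposable_tilting (M : GA) : Prop :=
  gindecomposable M /\ tilting M.

Definition tilting_of_weight (lam : GT) (M : GA) : Prop :=
  [/\ indecomposable_tilting M,
      highest_weight M lam,
      exists2 D, is_standard lam D & gembeds D M
    & exists2 N, is_costandard lam N & gsurjects M N].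

End Tilting.

(* Main.v *)
Require Import Defs.
From HB Require Import structures.
From mathcomp Require Import all_boot all_order all_algebra.
From mathcomp Require Import falgebra.
From mathcomp Require Import boolp classical_sets zify.

Set Implicit Arguments.
Unset Strict Implicit.
Unset Printing Implicit Defensive.

Import Order.TTheory GRing.Theory Num.Theory.
Local Open Scope classical_set_scope.
Local Open Scope ring_scope.

(** Write n = dim A^-, p = dim A^+, and let N^- and N^+ be the nilpotent
    augmentation ideals of A^- and A^+, spanned by the nonzero degrees.  The idea
    is that the indecomposable tilting objects are exactly the indecomposable
    direct summands of the shifts of the regular module: the indecomposable
    projectives, which are also injective since A is self-injective.

    A graded module M has a standard filtration iff it is free over A^-, and a
    costandard filtration iff it is cofree over A^+.  Both conditions are
    equalities of dimensions, [Nfree]: dim M = n dim (M / N^- M), and [Ncofree]: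
    dim M = p dim (soc of M over A^+).  The inequalities <= always hold
    ([head_ineq], [soc_ineq]), hence the equalities pass to extensions and to
    direct summands.  Conversely the top degree of such an M produces a standard
    submodule ([delta_embed]) or a costandard quotient ([nabla_surj]) after whose
    removal the equality persists ([Nfree_std_filtered], [Ncofree_costd_filtered]).

    A is free over A^- by the triangular decomposition ([Nfree_regular]).  It is
    cofree over A^+ because self-injectivity makes it a direct summand of
    Hom_K(A, A), which is visibly cofree ([Ncofree_regular]).  So every direct
    summand P of a shift of A is tilting, projective and injective ([projinj]).

    Let P be such a summand, indecomposable, with top degree d.  A T-linear map
    P_d -> P_d extends to P, as Delta(P_d) embeds in P and P is injective
    ([extend_top]); with Fitting's lemma this forces P_d to be simple
    ([indec_projinj_top]).  If M is any indecomposable tilting object and P_d is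
    isomorphic to a submodule of its top degree part, then projectivity of P gives
    P -> M ([lift_top]) and injectivity gives M -> P, with composite the identity
    on P_d; by Fitting's lemma M and P are isomorphic ([tilting_unique]).

    It remains to see that every simple T-module lam is the top of some P.  Send
    lam to the top of the projective cover of L(lam).  This is injective on
    isomorphism classes, since P is determined by its top and has only one simple
    quotient ([cover_top_inj]); it commutes with degree shifts, and there are
    finitely many classes in degree 0, so it is surjective ([cover_top_surj]).

    Finally a module whose top degree part is the simple lam has highest weight
    lam ([highest_weight_top]), which identifies the weights and gives the
    characterization of T(lam). *)

(** * Finite-dimensional spaces *)

Definition mklin (R : nzRingType) (U V : lmodType R) (f : U -> V)
    (hf : linear f) : {linear U -> V} :=
  HB.pack f (GRing.isLinear.Build R U V *:%R f hf).

(** The restriction of scalars of an A-module to K: an alias, so that the K-module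
    structure does not compete with the A-module structure on the same carrier. *)
Definition kmod (K : fieldType) (A : algType K) (M : lmodType A) : Type := M.

Section RestrictScalars.
Variables (K : fieldType) (A : algType K) (M : lmodType A).
HB.instance Definition _ := GRing.Zmodule.copy (kmod M) M.
Definition kmod_scale (k : K) (x : kmod M) : kmod M := k%:A *: (x : M).
Fact kmod_scalerA a b v : kmod_scale a (kmod_scale b v) = kmod_scale (a * b) v.
Proof. by rewrite /kmod_scale scalerA -scalerAl mul1r scalerA. Qed.
Fact kmod_scale1r : left_id 1 kmod_scale.
Proof. by move=> v; rewrite /kmod_scale !scale1r. Qed.
Fact kmod_scalerDr : right_distributive kmod_scale +%R.
Proof. by move=> a u v; rewrite /kmod_scale scalerDr. Qed.
Fact kmod_scalerDl v : {morph kmod_scale^~ v: a b / a + b}.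
Proof. by move=> a b; rewrite /kmod_scale !scalerDl. Qed.
HB.instance Definition _ := GRing.Zmodule_isLmodule.Build K (kmod M)
  kmod_scalerA kmod_scale1r kmod_scalerDr kmod_scalerDl.
End RestrictScalars.

(** Finite dimension is an equality of modules so that destructing it replaces V by
    a [vectType] in every statement about V. *)
Definition fd (K : fieldType) (V : lmodType K) : Prop :=
  exists vT : vectType K, (vT : lmodType K) = V.

Definition setadd (V : zmodType) (U W : set V) : set V :=
  [set x | exists u w, [/\ U u, W w & x = u + w]].

Definition lin_on (K : nzRingType) (V W : lmodType K) (U : set V) (f : V -> W) :=
  forall a u v, U u -> U v -> f (a *: u + v) = a *: f u + f v.

Definition is_kbasis (K : fieldType) (V : lmodType K) (U : set V) n
    (b : 'I_n -> V) : Prop :=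
  (forall x, U x <-> exists c : 'I_n -> K, x = \sum_i c i *: b i) /\
  (forall c : 'I_n -> K, \sum_i c i *: b i = 0 -> forall i, c i = 0).

(** A dimension for subsets of a module that has no chosen basis; 0 for a set that
    is not a finite-dimensional subspace. *)
Definition dimS (K : fieldType) (V : lmodType K) (U : set V) : nat :=
  xget 0%N [set n | exists b : 'I_n -> V, is_kbasis U b].

Section SubmodTheory.
Variables (R : nzRingType) (V : lmodType R) (U : set V).
Hypothesis hU : submodule U.
Lemma sub_0 : U 0. Proof. by case: hU. Qed.
Lemma sub_D x y : U x -> U y -> U (x + y).
Proof. by case: hU => _ h /(h 1 x y) h1 /h1; rewrite scale1r. Qed.
Lemma sub_Z a x : U x -> U (a *: x).
Proof. by case: hU => h0 h /(h a x 0) h1; rewrite -[_ *: _]addr0; apply: h1. Qed.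
Lemma sub_N x : U x -> U (- x).
Proof. by rewrite -scaleN1r; apply: sub_Z. Qed.
Lemma sub_B x y : U x -> U y -> U (x - y).
Proof. by move=> ? ?; apply: sub_D => //; apply: sub_N. Qed.
Lemma sub_sum (I : Type) (r : seq I) (P : pred I) (F : I -> V) :
  (forall i, P i -> U (F i)) -> U (\sum_(i <- r | P i) F i).
Proof. by move=> h; elim/big_ind: _ => //; [exact: sub_0 | exact: sub_D]. Qed.
End SubmodTheory.

Lemma submoduleI (R : nzRingType) (V : lmodType R) (U W : set V) :
  submodule U -> submodule W -> submodule (U `&` W).
Proof.
move=> hU hW; split; first by split; exact: sub_0.
by case: hU => _ hU; case: hW => _ hW a u v [? ?] [? ?]; split; auto.
Qed.

Lemma submodule_add (R : nzRingType) (V : lmodType R) (U W : set V) :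
  submodule U -> submodule W -> submodule (setadd U W).
Proof.
move=> hU hW; split.
  by exists 0, 0; split; rewrite ?addr0 //; exact: sub_0.
move=> a _ _ [u [w [Uu Ww ->]]] [u' [w' [Uu' Ww' ->]]].
exists (a *: u + u'), (a *: w + w'); split.
- by case: hU => _; apply.
- by case: hW => _; apply.
- by rewrite scalerDr addrACA.
Qed.

Lemma submodule_T (R : nzRingType) (V : lmodType R) : submodule [set: V].
Proof. by []. Qed.

Lemma submodule_0 (R : nzRingType) (V : lmodType R) : submodule [set (0 : V)].
Proof. by split => // a u v /= -> ->; rewrite scaler0 addr0. Qed.

Lemma lin_on_0 (R : nzRingType) (V W : lmodType R) (U : set V) (f : V -> W) :
  submodule U -> lin_on U f -> f 0 = 0.
Proof.
move=> hU hf; have := hf (-1) 0 0 (sub_0 hU) (sub_0 hU).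
by rewrite scaler0 addr0 scaleN1r addNr.
Qed.

Lemma submodule_img (R : nzRingType) (V W : lmodType R) (U : set V) (f : V -> W) :
  submodule U -> lin_on U f -> submodule (f @` U).
Proof.
move=> hU hf; split.
  by exists 0; [exact: sub_0 | exact: lin_on_0 hf].
move=> a _ _ [u Uu <-] [v Uv <-]; exists (a *: u + v); last exact: hf.
by case: hU => _; apply.
Qed.

Lemma submodule_ker (R : nzRingType) (V W : lmodType R) (U : set V) (f : V -> W) :
  submodule U -> lin_on U f -> submodule (U `&` [set x | f x = 0]).
Proof.
move=> hU hf; split.
  by split; [exact: sub_0 | exact: lin_on_0 hf].
move=> a u v [Uu /= fu] [Uv /= fv]; split; first by case: hU => _; apply.
by rewrite /= hf // fu fv scaler0 addr0.
Qed.

Lemma lin_on_lin (R : nzRingType) (V W : lmodType R) (U : set V) (f : {linear V -> W}) :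
  lin_on U f.
Proof. by move=> a u v _ _; rewrite linearP. Qed.

Lemma submodule_kmod (K : fieldType) (A : algType K) (M : lmodType A) (U : set M) :
  submodule U -> submodule (U : set (kmod M)).
Proof. by case=> h0 h; split=> // a u v ? ?; apply: h. Qed.

Lemma lin_on_kmod (K : fieldType) (A : algType K) (M N : lmodType A)
    (U : set M) (f : M -> N) :
  lin_on U f -> lin_on (U : set (kmod M)) (f : kmod M -> kmod N).
Proof. by move=> h a u v ? ?; apply: h. Qed.

Section VectSets.
Variables (K : fieldType) (vT : vectType K).
Implicit Types (W : {vspace vT}) (U : set vT).

Lemma submodule_vs W : submodule (vs_set W).
Proof.
split=> [|a u v]; rewrite /vs_set /=; first exact: mem0v.
by move=> hu hv; rewrite memvD // memvZ.
Qed.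

(** A subspace of largest dimension contained in U is all of U. *)
Lemma submodule_vsP U : submodule U -> exists W, U = vs_set W.
Proof.
move=> hU; pose P n := `[< exists2 W : {vspace vT}, vs_set W `<=` U & \dim W = n >].
have P0 : exists n, P n.
  exists 0%N; apply/asboolP; exists 0%VS; last exact: dimv0.
  by move=> x; rewrite /vs_set /= memv0 => /eqP ->; exact: sub_0.
have Pb n : P n -> (n <= \dim {:vT})%N.
  by move=> /asboolP[W _ <-]; apply: dimvS; exact: subvf.
case: (ex_maxnP P0 Pb) => n /asboolP[W WU dW] hmax.
exists W; apply/seteqP; split=> // x Ux; rewrite /vs_set /=.
have : P (\dim (<[x]> + W))%VS.
  apply/asboolP; exists (<[x]> + W)%VS => // y; rewrite /vs_set /=.
  case/memv_addP=> _ /vlineP[k ->] [w hw ->].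
  by apply: (sub_D hU); [exact: sub_Z | exact: WU].
move/hmax; rewrite -dW => hle.
have /eqP -> : W == (<[x]> + W)%VS by rewrite eqEdim addvSr.
by apply: (subvP (addvSl _ _)); exact: memv_line.
Qed.

Lemma is_kbasis_dim W n (b : 'I_n -> vT) : is_kbasis (vs_set W) b -> n = \dim W.
Proof.
move=> [hs hf]; pose X := [tuple b i | i < n].
have Xi (i : 'I_n) : X`_i = b i by rewrite -tnth_nth tnth_mktuple.
suff bW : basis_of W X by rewrite (size_basis bW).
apply/andP; split.
  apply/eqP/vspaceP => x; apply/idP/idP.
    move/coord_span => ->; apply/(hs _).2; exists (fun i => coord X i x).
    by apply: eq_bigr => i _; rewrite Xi.
  move/(hs x).1 => [c ->]; apply: memv_suml => i _; rewrite memvZ //.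
  by apply: memv_span; apply/tnthP; exists i; rewrite tnth_mktuple.
apply/freeP => k hk; apply: hf; rewrite -[RHS]hk.
by apply: eq_bigr => i _; rewrite Xi.
Qed.

Lemma is_kbasis_vbasis W : is_kbasis (vs_set W) (fun i : 'I_(\dim W) => (vbasis W)`_i).
Proof.
split=> [x|c hc].
  split=> [hx|[c ->]]; first by eexists; exact: coord_vbasis hx.
  rewrite /vs_set /=; apply: memv_suml => i _; rewrite memvZ // vbasis_mem //.
  by rewrite mem_nth ?size_tuple.
by apply/freeP: (basis_free (vbasisP W)) c hc.
Qed.

Lemma dimS_vs W : dimS (vs_set W) = \dim W.
Proof.
rewrite /dimS; case: xgetP => [n _ [b hb]|/(_ (\dim W)) []].
  exact: is_kbasis_dim hb.
by exists (fun i : 'I_(\dim W) => (vbasis W)`_i); exact: is_kbasis_vbasis.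
Qed.

End VectSets.

Lemma lfun_on (K : fieldType) (vT wT : vectType K) (W : {vspace vT}) (f : vT -> wT) :
  lin_on (vs_set W) f -> exists g : 'Hom(vT, wT), {in W, f =1 g}.
Proof.
move=> hf; have hl : linear (fun x => f (projv W x)).
  by move=> a u v; rewrite linearP hf //; exact: memv_proj.
exists (linfun (mklin hl)) => x xW; rewrite lfunE /=.
by rewrite projv_id.
Qed.

(** The equality holds by reflexivity once the structure of V is destructed, because
    packing a dimension on top of V does not touch its module structure. *)
Lemma fd_axiom (K : fieldType) (V : lmodType K) m : Vector.axiom m V -> fd V.
Proof.
move=> ax.
pose vT : vectType K :=
  HB.pack (GRing.Lmodule.sort V) (Lmodule_hasFinDim.Build K V ax).
by exists vT; rewrite /vT; case: V {vT} ax => T [] *; reflexivity.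
Qed.

Section FinDim.
Variables (K : fieldType).

(** A spanning family of least size is a basis, and a basis gives coordinates. *)
Lemma fd_span (V : lmodType K) n (e : 'I_n -> V) :
  (forall x, exists c : 'I_n -> K, x = \sum_i c i *: e i) -> fd V.
Proof.
move=> he.
pose P n := `[< exists e : 'I_n -> V,
  forall x, exists c : 'I_n -> K, x = \sum_i c i *: e i >].
have hP : exists n, P n by exists n; apply/asboolP; exists e.
case: (ex_minnP hP) => m /asboolP[b hb] hmin {hP e he n}.
have ind (c : 'I_m -> K) : \sum_i c i *: b i = 0 -> forall i, c i = 0.
  move=> hc j; apply/eqP/negP => /negP cj.
  case: m b hb hmin c hc j cj => [|m] b hb hmin c hc j cj; first by case: j cj.
  have : P m; last by move/hmin; rewrite ltnn.
  apply/asboolP; exists (fun i => b (lift j i)) => x.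
  have [d ->] := hb x.
  have bj : b j = - \sum_i ((c j)^-1 * c (lift j i)) *: b (lift j i).
    apply: (scalerI cj); rewrite scalerN scaler_sumr; apply/eqP.
    rewrite -addr_eq0; move/eqP: hc; rewrite (bigD1_ord j) //=.
    congr (_ + _ == 0); apply: eq_bigr => i _.
    by rewrite scalerA mulrA mulfV // mul1r.
  rewrite (bigD1_ord j) //= bj.
  exists (fun i => d (lift j i) - d j * ((c j)^-1 * c (lift j i))).
  rewrite scalerN scaler_sumr addrC -sumrB; apply: eq_bigr => i _.
  by rewrite scalerA scalerBl.
have uniq (c d : 'I_m -> K) : \sum_i c i *: b i = \sum_i d i *: b i -> c = d.
  move=> h; apply/funext => i; apply/eqP; rewrite -subr_eq0; apply/eqP.
  apply: (ind (fun i => c i - d i)).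
  by rewrite (eq_bigr (fun i => c i *: b i - d i *: b i)) ?sumrB ?h ?subrr // => j _;
     rewrite scalerBl.
have [c hc] := choice hb.
pose u x : 'rV[K]_m := \row_i c x i.
have hu : linear u.
  move=> a x y; apply/rowP => i; rewrite !mxE.
  rewrite (uniq (c (a *: x + y)) (fun i => a * c x i + c y i)) //.
  rewrite -hc {1}(hc x) {1}(hc y) scaler_sumr -big_split /=.
  by apply: eq_bigr => j _; rewrite scalerDl scalerA.
have bu : bijective u.
  exists (fun r : 'rV[K]_m => \sum_i r 0 i *: b i) => [x|r].
    by rewrite [RHS]hc; apply: eq_bigr => i _; rewrite mxE.
  apply/rowP => i; rewrite mxE.
  by rewrite (uniq (c (\sum_i r 0 i *: b i)) (fun i => r 0 i)) // -hc.
have ax : Vector.axiom m V by exists u.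
exact: fd_axiom ax.
Qed.

Lemma fdP (V : lmodType K) : fd V ->
  exists n (e : 'I_n -> V), is_kbasis setT e.
Proof.
case=> vT <-; exists (\dim {:vT}), (fun i : 'I_(\dim {:vT}) => (vbasis {:vT})`_i).
have <- : vs_set {:vT} = setT.
  by apply/seteqP; split=> // x _; rewrite /vs_set /= memvf.
exact: is_kbasis_vbasis.
Qed.

Lemma fd_surj (V V' : lmodType K) (f : {linear V -> V'}) :
  fd V -> (forall y, exists x, f x = y) -> fd V'.
Proof.
case/fdP=> n [e [he _]] hf; apply: (@fd_span _ n (fun i => f (e i))) => y.
have [x <-] := hf y; have [c ->] := (he x).1 I.
by exists c; rewrite linear_sum; apply: eq_bigr => i _; rewrite linearZ.
Qed.

Lemma fd_inj (V V' : lmodType K) (f : {linear V -> V'}) :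
  fd V' -> injective f -> fd V.
Proof.
case=> vT eT; case: _ / eT f => f finj.
have [W hW] : exists W, f @` setT = vs_set W.
  apply: submodule_vsP; apply: submodule_img; [exact: submodule_T|].
  exact: lin_on_lin.
have hb (i : 'I_(\dim W)) : exists x, f x = (vbasis W)`_i.
  have : vs_set W (vbasis W)`_i.
    by rewrite /vs_set /= vbasis_mem // mem_nth ?size_tuple.
  by rewrite -hW => -[x _ <-]; exists x.
have [b hb'] := choice hb.
apply: (@fd_span _ (\dim W) b) => x.
have : vs_set W (f x) by rewrite -hW; exists x.
move/coord_vbasis => hx; exists (fun i => coord (vbasis W) i (f x)).
apply: finj; rewrite hx linear_sum; apply: eq_bigr => i _.
by rewrite linearZ /= hb' -hx.
Qed.

Variable (V : lmodType K) (hV : fd V).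
Implicit Types (U W : set V).

Lemma dim0 : dimS [set (0 : V)] = 0%N.
Proof.
case: hV => vT eT; case: _ / eT.
have -> : [set (0 : vT)] = vs_set 0%VS.
  by apply/seteqP; split=> x; rewrite /vs_set /= memv0 => /eqP.
by rewrite dimS_vs dimv0.
Qed.

Lemma dim_eq0 U : submodule U -> dimS U = 0%N -> U = [set 0].
Proof.
case: hV => vT eT; case: _ / eT U => U /submodule_vsP[W ->].
rewrite dimS_vs => /eqP; rewrite dimv_eq0 => /eqP ->.
by apply/seteqP; split=> x; rewrite /vs_set /= memv0 => /eqP.
Qed.

Lemma dim_le U W : submodule U -> submodule W -> U `<=` W -> (dimS U <= dimS W)%N.
Proof.
case: hV => vT eT; case: _ / eT U W => U W /submodule_vsP[X ->] /submodule_vsP[Y ->].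
by move=> h; rewrite !dimS_vs; apply/dimvS/subvP => x; apply: h.
Qed.

Lemma dim_eq U W : submodule U -> submodule W -> U `<=` W ->
  (dimS W <= dimS U)%N -> U = W.
Proof.
case: hV => vT eT; case: _ / eT U W => U W /submodule_vsP[X ->] /submodule_vsP[Y ->].
move=> h; rewrite !dimS_vs => hd; congr vs_set; apply/eqP.
by rewrite eqEdim hd andbT; apply/subvP => x; apply: h.
Qed.

Lemma dim_addI U W : submodule U -> submodule W ->
  (dimS (setadd U W) + dimS (U `&` W) = dimS U + dimS W)%N.
Proof.
case: hV => vT eT; case: _ / eT U W => U W /submodule_vsP[X ->] /submodule_vsP[Y ->].
have -> : setadd (vs_set X) (vs_set Y) = vs_set (X + Y)%VS.
  apply/seteqP; split=> x.
    by case=> u [w [hu hw ->]]; rewrite /vs_set /= memv_add.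
  by rewrite /vs_set /= => /memv_addP[u hu [w hw ->]]; exists u, w.
have -> : vs_set X `&` vs_set Y = vs_set (X :&: Y)%VS.
  by apply/seteqP; split=> x; rewrite /vs_set /= memv_cap => /andP.
by rewrite !dimS_vs dimv_sum_cap.
Qed.

Lemma subspace_compl U : submodule U -> exists W,
  [/\ submodule W, U `&` W = [set 0] & setadd U W = setT].
Proof.
case: hV => vT eT; case: _ / eT U => U /submodule_vsP[X ->].
exists (vs_set X^C%VS); split; first exact: submodule_vs.
  apply/seteqP; split=> x.
    case; rewrite /vs_set /= => h1 h2; apply/eqP.
    by rewrite -memv0 -(capv_compl X) memv_cap h1.
  by move=> /= ->; split; exact: sub_0 (submodule_vs _).
apply/seteqP; split=> // x _.
have := memvf x; rewrite -(addv_complf X) => /memv_addP[u hu [w hw ->]].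
by exists u, w.
Qed.

End FinDim.

Section FinDimMaps.
Variables (K : fieldType) (V V' : lmodType K) (hV : fd V) (hV' : fd V').

Lemma dim_rank U (f : V -> V') : submodule U -> lin_on U f ->
  dimS U = (dimS (f @` U) + dimS (U `&` [set x | f x = 0%R]))%N.
Proof.
case: hV hV' => vT eT [wT eT']; case: _ / eT U f => U; case: _ / eT' => f.
move=> /submodule_vsP[X ->] /lfun_on[g fg].
have -> : f @` vs_set X = vs_set (g @: X)%VS.
  apply/seteqP; split=> x.
    by case=> y yX <-; rewrite fg // /vs_set /= memv_img.
  by rewrite /vs_set /= => /memv_imgP[y yX ->]; exists y => //; rewrite fg.
have -> : vs_set X `&` [set x | f x = 0] = vs_set (X :&: lker g)%VS.
  apply/seteqP; split=> x; rewrite /vs_set /= memv_cap memv_ker.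
    by case=> xX; rewrite xX fg // => ->; rewrite eqxx.
  by case/andP => xX /eqP h; split=> //; rewrite fg.
by rewrite !dimS_vs addnC limg_ker_dim.
Qed.

(** U is a quotient of a subspace of W^n. *)
Lemma dim_cover n (f : 'I_n -> V -> V') W (U : set V') :
  submodule W -> submodule U -> (forall i, lin_on W (f i)) ->
  (forall y, U y -> exists x : 'I_n -> V, (forall i, W (x i)) /\ y = \sum_i f i (x i)) ->
  (dimS U <= n * dimS W)%N.
Proof.
case: hV hV' => vT eT [wT eT']; case: _ / eT f W => f W; case: _ / eT' f U => f U.
move=> /submodule_vsP[X ->] /submodule_vsP[Y ->] hf hc.
have [g hg] := choice (fun i => lfun_on (hf i)).
rewrite !dimS_vs; apply: (@leq_trans (\dim (\sum_i (g i @: X))%VS)).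
  apply/dimvS/subvP => y /hc[x [xX ->]].
  by apply: memv_sumr => i _; rewrite hg ?memv_img //; exact: xX.
apply: (leq_trans (dimv_leq_sum _ _ _)).
rewrite -[n in (n * _)%N]card_ord -sum_nat_const; apply: leq_sum => i _.
by rewrite -(limg_ker_dim (g i) X) leq_addl.
Qed.

(** U embeds in W^n. *)
Lemma dim_detect n (f : 'I_n -> V -> V') U (W : set V') :
  submodule U -> submodule W -> (forall i, lin_on U (f i)) ->
  (forall i x, U x -> W (f i x)) ->
  (forall x, U x -> (forall i, f i x = 0) -> x = 0) ->
  (dimS U <= n * dimS W)%N.
Proof.
elim: n f U => [|n IH] f U hU hW hf hm h0.
  have -> : U = [set 0].
    by apply/seteqP; split=> x; [move=> /h0 ->//; case | move=> ->; exact: sub_0].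
  by rewrite (dim0 hV).
rewrite (dim_rank hU (hf ord0)) mulSn leq_add //.
  apply: (dim_le hV') => //; first by apply: submodule_img.
  by move=> _ [x Ux <-]; apply: hm.
apply: (IH (fun i => f (lift ord0 i))) => //; first exact: submodule_ker.
- by move=> i a u v [Uu _] [Uv _]; apply: hf.
- by move=> i x [Ux _]; apply: hm.
move=> x [Ux /= fx0] h; apply: h0 => // i.
by case: (unliftP ord0 i) => [j ->|->].
Qed.

Lemma dim_inj_eq U (f : V -> V') : submodule U -> lin_on U f ->
  (forall x, U x -> f x = 0 -> x = 0) -> dimS (f @` U) = dimS U.
Proof.
move=> hU hf h0; rewrite (dim_rank hU hf).
have -> : U `&` [set x | f x = 0] = [set 0].
  apply/seteqP; split=> x; first by case=> Ux; apply: h0.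
  by move=> ->; split; [exact: sub_0 | exact: lin_on_0 hf].
by rewrite (dim0 hV) addn0.
Qed.

End FinDimMaps.

(** * Submodules, quotients and gradings *)
Section SubQuotient.
Variables (R : nzRingType) (V : lmodType R) (U : set V) (hU : submodule U).

Definition sub_pred : {pred V} := fun x => `[< U x >].

Fact sub_pred_closed : GRing.submod_closed sub_pred.
Proof.
case: hU => h0 h; split; first exact/asboolP.
by move=> a u v /asboolP ? /asboolP ?; apply/asboolP; apply: h.
Qed.

Lemma submod_exists : exists (S : lmodType R) (i : {linear S -> V}),
  injective i /\ forall x, U x <-> exists y, i y = x.
Proof.
pose P : submodClosed V := HB.pack sub_pred
  (GRing.isSubmodClosed.Build R V sub_pred sub_pred_closed).
pose S0 : subChoiceType (mem P) := {x : V | x \in P}.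
pose S : subLmodType (mem P) :=
  HB.pack (sub_type S0) (GRing.SubChoice_isSubLmodule.Build R V (mem P) S0
    (GRing.subsemimodClosedP P)).
exists S, (val : {linear S -> V}); split; first exact: val_inj.
move=> x; split=> [Ux|[y <-]]; last by have /asboolP := valP y.
have Px : x \in P by apply/asboolP.
by exists (Sub x Px : S0).
Qed.

Lemma quot_exists : exists (Q : lmodType R) (p : {linear V -> Q}),
  (forall y, exists x, p x = y) /\ forall x, p x = 0 <-> U x.
Proof.
pose P : zmodClosed V := HB.pack sub_pred
  (GRing.isZmodClosed.Build V sub_pred (GRing.submod_closedB sub_pred_closed)).
have PE x : x \in P <-> U x by split=> [/asboolP|?] //; apply/asboolP.
pose Q0 : zmodType := Quotient.quot P.
pose pi : V -> Q0 := \pi_(Quotient.quot P)%qT.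
have piE x y : pi x = pi y <-> U (x - y).
  rewrite -PE; split=> [/eqP|h]; first by rewrite -Quotient.idealrBE.
  by apply/eqP; rewrite -Quotient.idealrBE.
have piK q : pi (repr q) = q by exact: reprK.
have piD x y : pi (x + y) = pi x + pi y by exact: Quotient.pi_add.
pose sc (a : R) (q : Q0) : Q0 := pi (a *: repr q).
have scE a x : sc a (pi x) = pi (a *: x).
  by apply/piE; rewrite -scalerBr; apply: (sub_Z hU); apply/piE; rewrite piK.
have scA a b q : sc a (sc b q) = sc (a * b) q.
  by rewrite -[q]piK !scE scalerA.
have sc1 : left_id 1 sc by move=> q; rewrite -[q]piK scE scale1r.
have scDr : right_distributive sc +%R.
  by move=> a q r; rewrite -[q]piK -[r]piK -piD !scE scalerDr piD.
have scDl q : {morph sc^~ q : a b / a + b}.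
  by move=> a b; rewrite -[q]piK !scE scalerDl piD.
pose Q : lmodType R := HB.pack (GRing.Zmodule.sort Q0)
  (GRing.Zmodule_isLmodule.Build R Q0 scA sc1 scDr scDl).
have pl : linear (pi : V -> Q) by move=> a x y; rewrite piD -scE.
exists Q, (mklin pl); split=> [y|x]; first by exists (repr (y : Q0)); exact: piK.
rewrite /= -[0 in RHS](_ : pi 0 = 0) ?piE ?subr0 //.
by apply: (addIr (pi 0)); rewrite -piD !add0r.
Qed.

End SubQuotient.

Lemma factor_linear (R : nzRingType) (V Q W : lmodType R) (p : {linear V -> Q})
    (f : {linear V -> W}) :
  (forall y, exists x, p x = y) -> (forall x, p x = 0 -> f x = 0) ->
  exists g : {linear Q -> W}, forall x, g (p x) = f x.
Proof.
move=> ps pf; have [s sK] := choice ps.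
have fE x y : p x = p y -> f x = f y.
  move=> e; apply/eqP; rewrite -subr_eq0 -linearB; apply/eqP/pf.
  by rewrite linearB e subrr.
have gl : linear (fun q => f (s q)).
  by move=> a x y; rewrite -linearP; apply: fE; rewrite linearP !sK.
by exists (mklin gl) => x /=; apply: fE.
Qed.

Section GradingTheory.
Variables (V : zmodType) (V_ : int -> set V).

Definition isdec (x : V) (f : int -> V) : Prop :=
  (forall i, V_ i (f i)) /\
  exists s, [/\ uniq s, forall i, i \notin s -> f i = 0 & x = \sum_(i <- s) f i].

(** The homogeneous component of degree i, as a total function. *)
Definition gpr (i : int) (x : V) : V :=
  xget 0 [set y | exists2 f, isdec x f & f i = y].

Hypothesis hV : grading V_.

Lemma gr0 i : V_ i 0. Proof. by case: hV. Qed.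
Lemma grB i x y : V_ i x -> V_ i y -> V_ i (x - y). Proof. by case: hV => _ h _ _; apply: h. Qed.
Lemma grN i x : V_ i x -> V_ i (- x). Proof. by rewrite -sub0r; apply: grB; exact: gr0. Qed.
Lemma grD i x y : V_ i x -> V_ i y -> V_ i (x + y).
Proof. by move=> hx hy; rewrite -[y]opprK; apply: grB => //; apply: grN. Qed.
Lemma gr_sum i (I : Type) (r : seq I) (P : pred I) (F : I -> V) :
  (forall j, P j -> V_ i (F j)) -> V_ i (\sum_(j <- r | P j) F j).
Proof. by move=> h; elim/big_ind: _ => //; [exact: gr0 | exact: grD]. Qed.

Lemma sum_extend (f : int -> V) (s t : seq int) : uniq s -> uniq t ->
  {subset s <= t} -> (forall i, i \notin s -> f i = 0) ->
  \sum_(i <- s) f i = \sum_(i <- t) f i.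
Proof.
move=> us ut st f0; rewrite [RHS](bigID (mem s)) /= [X in _ + X]big1 // addr0.
rewrite -[RHS]big_filter; apply: perm_big; apply: uniq_perm => //.
  exact: filter_uniq.
by move=> i; rewrite mem_filter; case: (boolP (i \in s)) => //= /st ->.
Qed.

Lemma isdec_common x y f g : isdec x f -> isdec y g ->
  exists s, [/\ uniq s, forall i, i \notin s -> f i = 0,
    forall i, i \notin s -> g i = 0, x = \sum_(i <- s) f i & y = \sum_(i <- s) g i].
Proof.
move=> [_ [s [us f0 ->]]] [_ [t [ut g0 ->]]]; exists (undup (s ++ t)).
have u := undup_uniq (s ++ t).
split=> // [i|i||].
- by rewrite mem_undup mem_cat negb_or => /andP[/f0].
- by rewrite mem_undup mem_cat negb_or => /andP[_ /g0].
- by apply: sum_extend => // i; rewrite mem_undup mem_cat => ->.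
- by apply: sum_extend => // i; rewrite mem_undup mem_cat orbC => ->.
Qed.

Lemma isdec_uniq x f g : isdec x f -> isdec x g -> f = g.
Proof.
move=> hf hg; have [s [us f0 g0 e1 e2]] := isdec_common hf hg.
apply/funext => i; case: (boolP (i \in s)) => [si|/[dup]/f0 -> /g0 -> //].
apply/eqP; rewrite -subr_eq0; apply/eqP.
case: hV => _ _ _ /(_ s (fun i => f i - g i)); apply=> //.
  by move=> j; apply: grB; [case: hf | case: hg].
by rewrite sumrB -e1 -e2 subrr.
Qed.

Lemma isdecB x y f g : isdec x f -> isdec y g -> isdec (x - y) (fun i => f i - g i).
Proof.
move=> hf hg; have [s [us f0 g0 e1 e2]] := isdec_common hf hg.
split; first by move=> j; apply: grB; [case: hf | case: hg].
exists s; split=> // [i si|]; first by rewrite f0 // g0 // subrr.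
by rewrite e1 e2 sumrB.
Qed.

Lemma isdec_hom i x : V_ i x -> isdec x (fun j => if j == i then x else 0).
Proof.
move=> hx; split; first by move=> j; case: eqP => [->|_] //; exact: gr0.
exists [:: i]; split=> // [j|]; first by rewrite inE; case: eqP.
by rewrite big_seq1 eqxx.
Qed.

Lemma isdec0 : isdec 0 (fun=> 0).
Proof. by have := isdecB (isdec_hom (gr0 0)) (isdec_hom (gr0 0));
  rewrite subrr; congr isdec; apply/funext => i; rewrite subrr. Qed.

Lemma isdec_ex x : exists f, isdec x f.
Proof.
case: hV => _ _ /(_ x) [s [f [hf ->]]] _.
elim: s => [|i s [g hg]]; first by rewrite big_nil; exists (fun=> 0); exact: isdec0.
rewrite big_cons addrC -[f i]opprK; eexists.
by apply: isdecB hg _; apply: isdec_hom (grN (hf i)).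
Qed.

Lemma gprE x f : isdec x f -> gpr^~ x = f.
Proof.
move=> hf; apply/funext => i; rewrite /gpr; case: xgetP => [y _ [g hg <-]|].
  by rewrite (isdec_uniq hf hg).
by move=> /(_ (f i)) []; exists f.
Qed.

Lemma gprP x : isdec x (gpr^~ x).
Proof. by have [f hf] := isdec_ex x; rewrite (gprE hf). Qed.

Lemma gpr_in i x : V_ i (gpr i x).
Proof. by have [] := gprP x. Qed.

Lemma gprB i x y : gpr i (x - y) = gpr i x - gpr i y.
Proof. by rewrite -[LHS]/((gpr^~ (x - y)) i) (gprE (isdecB (gprP x) (gprP y))). Qed.

Lemma gpr_hom i x : V_ i x -> forall j, gpr j x = if j == i then x else 0.
Proof. by move=> h j; rewrite -[LHS]/((gpr^~ x) j) (gprE (isdec_hom h)). Qed.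

Lemma gpr_id i x : V_ i x -> gpr i x = x.
Proof. by move=> /gpr_hom ->; rewrite eqxx. Qed.

Lemma gpr_neq i j x : V_ i x -> j != i -> gpr j x = 0.
Proof. by move=> /gpr_hom -> /negPf ->. Qed.

Lemma gpr0 i : gpr i 0 = 0. Proof. exact: gpr_id (gr0 i). Qed.

Lemma gprN i x : gpr i (- x) = - gpr i x.
Proof. by rewrite -sub0r gprB gpr0 sub0r. Qed.

Lemma gprD i x y : gpr i (x + y) = gpr i x + gpr i y.
Proof. by rewrite -[y in LHS]opprK gprB gprN opprK. Qed.

Lemma gpr_sum i (I : Type) (r : seq I) (P : pred I) (F : I -> V) :
  gpr i (\sum_(j <- r | P j) F j) = \sum_(j <- r | P j) gpr i (F j).
Proof.
elim: r => [|j r IH]; first by rewrite !big_nil gpr0.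
by rewrite !big_cons; case: (P j); rewrite ?gprD IH.
Qed.

Lemma gpr_sumE x s : uniq s -> (forall i, i \notin s -> gpr i x = 0) ->
  x = \sum_(i <- s) gpr i x.
Proof.
move=> us h; have [_ [t [ut t0 e]]] := gprP x.
have u := undup_uniq (s ++ t).
rewrite {1}e (@sum_extend _ t (undup (s ++ t))) // => [|i]; last first.
  by rewrite mem_undup mem_cat orbC => ->.
by apply/esym/sum_extend => // i; rewrite mem_undup mem_cat => ->.
Qed.

Lemma gpr_supp x : exists s, [/\ uniq s, forall i, i \notin s -> gpr i x = 0
  & x = \sum_(i <- s) gpr i x].
Proof. by have [_ h] := gprP x. Qed.

Lemma gpr_eq0 x : (forall i, gpr i x = 0) -> x = 0.
Proof. by move=> h; rewrite (@gpr_sumE x [::]) ?big_nil. Qed.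

Lemma gr_disj i j x : V_ i x -> V_ j x -> i != j -> x = 0.
Proof. by move=> h1 h2 ij; rewrite -(gpr_id h1) (gpr_neq h2 ij). Qed.

End GradingTheory.

Lemma gpr_morph (V W : zmodType) (V_ : int -> set V) (W_ : int -> set W)
    (hV : grading V_) (hW : grading W_) (f : {additive V -> W}) (k : int) :
  (forall i x, V_ i x -> W_ (i + k) (f x)) ->
  forall i x, gpr W_ (i + k) (f x) = f (gpr V_ i x).
Proof.
move=> hf i x; have [s [us s0 {1}->]] := gpr_supp hV x.
rewrite raddf_sum gpr_sum //.
have E j : gpr W_ (i + k) (f (gpr V_ j x)) = if j == i then f (gpr V_ j x) else 0.
  have h := hf _ _ (gpr_in hV j x).
  by rewrite (gpr_hom hW h) (inj_eq (addIr k)) eq_sym.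
under eq_bigr do rewrite E.
case: (boolP (i \in s)) => si.
  by rewrite (bigD1_seq i) //= eqxx big1 ?addr0 // => j /negPf ->.
rewrite s0 // raddf0 big_seq big1 // => j js; case: eqP => // e.
by rewrite -e js in si.
Qed.

(** The description of graded subsets by components is the usable one: it makes
    images, kernels and preimages graded without choosing decompositions. *)
Lemma graded_subsetP (V : zmodType) (V_ : int -> set V) (hV : grading V_)
    (U : set V) : U 0 -> (forall x y, U x -> U y -> U (x + y)) ->
  (graded_subset V_ U <-> forall x i, U x -> U (gpr V_ i x)).
Proof.
move=> U0 UD; have UM n x : U x -> U (x *+ n).
  by move=> Ux; elim: n => [|n IH]; rewrite ?mulr0n // mulrS; apply: UD.
split=> [h x i /h[s [f [hf ->]]]|h x Ux].
  rewrite gpr_sum //; elim/big_ind: _ => // j _.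
  have [Uf Vf] := hf j; rewrite (gpr_hom hV Vf).
  by case: ifP.
have [s [us s0 e]] := gpr_supp hV x.
by exists s, (gpr V_ ^~ x); split=> // i; split; [exact: h | exact: gpr_in].
Qed.

(** What is common to A, T and their opposites, so that the theory of graded modules
    is developed once for the four of them. *)
Record galgebra (K : fieldType) (A : algType K) (gr : int -> set A) : Prop := {
  galg_fd : fd (A : lmodType K);
  galg_grading : grading gr;
  galg_1 : gr 0 1;
  galg_Z : forall i k a, gr i a -> gr i (k *: a);
  galg_M : forall i j a b, gr i a -> gr j b -> gr (i + j) (a * b)
}.

(** * Graded modules *)
Notation pr M i x := (gpr (gm_comp M) i x).

Lemma fd_ffun (K : fieldType) (V : lmodType K) (I : finType) :
  fd V -> fd ({ffun I -> V} : lmodType K).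
Proof. by case=> vT <-; exists ({ffun I -> vT} : vectType K). Qed.

Lemma comp_linear (R : nzRingType) (M N L : lmodType R) (g : {linear N -> L})
    (f : {linear M -> N}) : linear (fun x => g (f x)).
Proof. by move=> a x y; rewrite !linearP. Qed.

Section GMod.
Variables (K : fieldType) (A : algType K) (gr : int -> set A).
Hypothesis hA : galgebra gr.
Implicit Types M N L : gmod gr.

Lemma galg_K k : gr 0 (k%:A).
Proof. by apply: (galg_Z hA); exact: (galg_1 hA). Qed.

(** Finitely generated means finite-dimensional, as A is finite-dimensional. *)
Lemma kfd_fingen (V : lmodType A) n (e : 'I_n -> V) :
  (forall x, exists c : 'I_n -> A, x = \sum_(i < n) c i *: e i) -> fd (kmod V).
Proof.
move=> he; pose f (c : {ffun 'I_n -> A}) : kmod V := \sum_i c i *: e i.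
have fl : linear f.
  move=> k c d; rewrite /f scaler_sumr -big_split /=; apply: eq_bigr => i _.
  by rewrite !ffunE scalerDl /= [in RHS]/GRing.scale /= /kmod_scale scalerA
    -scalerAl mul1r.
apply: (@fd_surj _ _ _ (mklin fl)); first exact: fd_ffun (galg_fd hA).
move=> y; have [c hc] := he y; exists [ffun i => c i]; rewrite /= /f [RHS]hc.
by apply: eq_bigr => i _; rewrite ffunE.
Qed.

Lemma gm_fd M : fd (kmod M).
Proof. by have [n [e he]] := gm_fingen M; exact: kfd_fingen he. Qed.

Lemma fingen_kfd (V : lmodType A) : fd (kmod V) ->
  exists (n : nat) (e : 'I_n -> V),
    forall x, exists c : 'I_n -> A, x = \sum_(i < n) c i *: e i.
Proof.
move=> /fdP[n [e [he _]]]; exists n, e => x; have [c hc] := (he x).1 I.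
by exists (fun i => (c i)%:A); rewrite hc.
Qed.

Definition mkgmod (V : lmodType A) (comp : int -> set V) (h1 : grading comp)
    (h2 : forall i j a x, gr i a -> comp j x -> comp (i + j) (a *: x))
    (h3 : fd (kmod V)) : gmod gr :=
  @GMod K A gr V comp h1 h2 (fingen_kfd h3).

Section Comp.
Variable M : gmod gr.

Lemma pr_act i j a (x : M) : gr i a -> pr M (i + j) (a *: x) = a *: pr M j x.
Proof.
move=> ha; rewrite addrC.
rewrite (gpr_morph (gm_grading M) (gm_grading M) (f := GRing.scale a)) //.
by move=> k y hy; rewrite addrC; apply: gm_act.
Qed.

Lemma pr_K i k (x : M) : pr M i (k%:A *: x) = k%:A *: pr M i x.
Proof. by rewrite -[i in LHS]add0r pr_act //; exact: galg_K. Qed.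

Lemma pr_in i (x : M) : gm_comp M i (pr M i x).
Proof. exact: gpr_in (gm_grading M) i x. Qed.

Lemma pr_id i (x : M) : gm_comp M i x -> pr M i x = x.
Proof. exact: gpr_id (gm_grading M) i x. Qed.

(** A basis involves finitely many degrees. *)
Lemma gm_supp : exists s : seq int, [/\ uniq s,
  forall i (x : M), i \notin s -> pr M i x = 0 &
  forall x : M, x = \sum_(i <- s) pr M i x].
Proof.
have [n [e [he _]]] := fdP (gm_fd M).
have [S hS] := choice (fun i => gpr_supp (gm_grading M) (e i)).
pose s := undup (flatten [seq S i | i <- enum 'I_n]).
have s0 i (x : M) : i \notin s -> pr M i x = 0.
  rewrite mem_undup => /flattenP si; have [c ->] := (he x).1 I.
  rewrite gpr_sum; last exact: gm_grading.
  rewrite big1 // => j _; rewrite pr_K.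
  have [_ -> //] := hS j; first by rewrite scaler0.
  by apply/negP => ij; apply: si; exists (S j) => //; apply/map_f/mem_enum.
exists s; split=> //; first exact: undup_uniq.
move=> x; apply: (gpr_sumE (gm_grading M)); first exact: undup_uniq.
by move=> i; apply: s0.
Qed.

Lemma graded_submoduleP (U : set M) : submodule U ->
  (graded_subset (gm_comp M) U <-> forall x i, U x -> U (pr M i x)).
Proof.
move=> hU; apply: graded_subsetP; [exact: gm_grading| exact: sub_0|].
by move=> *; exact: sub_D.
Qed.

Lemma gsubm_sub (U : set M) : graded_submodule U -> submodule U.
Proof. by case. Qed.

Lemma gsubm_pr (U : set M) x i : graded_submodule U -> U x -> U (pr M i x).
Proof. by case=> hU /graded_submoduleP h; apply: h. Qed.

Lemma gsubm_intro (U : set M) : submodule U -> (forall x i, U x -> U (pr M i x)) ->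
  graded_submodule U.
Proof. by move=> hU h; split=> //; apply/graded_submoduleP. Qed.

Lemma gsubm_T : graded_submodule [set: M].
Proof. exact: gsubm_intro. Qed.

Lemma gsubm_0 : graded_submodule [set (0 : M)].
Proof.
apply: gsubm_intro; first exact: submodule_0.
by move=> x i ->; exact: gpr0 (gm_grading M) i.
Qed.

End Comp.

Lemma pr_map M N (f : {linear M -> N}) : degree_preserving f ->
  forall i x, pr N i (f x) = f (pr M i x).
Proof.
move=> hf i x; have := @gpr_morph _ _ _ _ (gm_grading M) (gm_grading N) f 0.
by rewrite -[i in LHS]addr0; apply=> j y hy; rewrite addr0; apply: hf.
Qed.

Lemma gsubm_img M N (f : {linear M -> N}) (U : set M) : degree_preserving f ->
  graded_submodule U -> graded_submodule (f @` U).
Proof.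
move=> hf hU; apply: gsubm_intro.
  by apply: submodule_img; [exact: gsubm_sub | exact: lin_on_lin].
move=> _ i [x Ux <-]; exists (pr M i x); first exact: gsubm_pr.
by rewrite pr_map.
Qed.

Lemma gsubm_preim M N (f : {linear M -> N}) (U : set N) : degree_preserving f ->
  graded_submodule U -> graded_submodule (f @^-1` U).
Proof.
move=> hf hU; apply: gsubm_intro.
  split; rewrite /= ?linear0; first exact: sub_0 (gsubm_sub hU).
  by move=> a u v hu hv /=; rewrite linearP; case: (gsubm_sub hU) => _; apply.
by move=> x i hx /=; rewrite -pr_map //; apply: gsubm_pr.
Qed.

Lemma gsubm_ker M N (f : {linear M -> N}) : degree_preserving f ->
  graded_submodule [set x | f x = 0].
Proof. by move=> hf; apply: (gsubm_preim hf (gsubm_0 N)). Qed.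

Lemma gsub_exists M (U : set M) : graded_submodule U ->
  exists (S : gmod gr) (i : {linear S -> M}), [/\ injective i,
    (forall x, U x <-> exists y, i y = x) &
    (forall j y, gm_comp S j y <-> gm_comp M j (i y))].
Proof.
move=> hU; have [S0 [i [inj hi]]] := submod_exists (gsubm_sub hU).
pose comp j : set S0 := i @^-1` (gm_comp M j).
have h1 : grading comp.
  split=> [j|j x y|x|s f us hf e].
  - by rewrite /comp /= linear0; exact: gr0 (gm_grading M) j.
  - by rewrite /comp /= linearB; exact: grB (gm_grading M) _ _ _.
  - have [s [us s0 e]] := gpr_supp (gm_grading M) (i x).
    have hp j : exists y, i y = pr M j (i x).
      by apply/hi; apply: gsubm_pr => //; apply/hi; exists x.
    have [f fE] := choice hp; exists s, f; split=> [j|].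
      by rewrite /comp /= fE; exact: pr_in.
    by apply: inj; rewrite linear_sum {1}e; apply: eq_bigr => j _; rewrite fE.
  move=> j js; apply: inj; rewrite linear0; have [_ _ _ h] := gm_grading M.
  apply: (h s (fun j => i (f j))) => //.
  by rewrite -linear_sum e linear0.
have h2 k j a x : gr k a -> comp j x -> comp (k + j) (a *: x).
  by move=> ha hx; rewrite /comp /= linearZ; apply: gm_act.
have h3 : fd (kmod S0).
  have il : linear (i : kmod S0 -> kmod M) by move=> a u v; exact: linearP.
  exact: (@fd_inj _ _ _ (mklin il) (gm_fd M)).
by exists (mkgmod h1 h2 h3), i.
Qed.

Lemma gquot_exists M (U : set M) : graded_submodule U ->
  exists (Q : gmod gr) (p : {linear M -> Q}), [/\ degree_preserving p,
    forall y, exists x, p x = y, (forall x, p x = 0 <-> U x) &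
    (forall j y, gm_comp Q j y <-> exists2 x, gm_comp M j x & p x = y)].
Proof.
move=> hU; have [Q0 [p [ps hp]]] := quot_exists (gsubm_sub hU).
pose comp j : set Q0 := p @` (gm_comp M j).
have h1 : grading comp.
  split=> [j|j _ _ [x hx <-] [y hy <-]|x|s f us hf e].
  - by exists 0; [exact: gr0 (gm_grading M) j | exact: linear0].
  - exists (x - y); last by rewrite linearB.
    exact: grB (gm_grading M) _ _ _ hx hy.
  - have [z <-] := ps x; have [s [us s0 e]] := gpr_supp (gm_grading M) z.
    exists s, (fun j => p (pr M j z)); split=> [j|].
      by exists (pr M j z) => //; exact: pr_in.
    by rewrite {1}e linear_sum.
  have hg' j : exists x, gm_comp M j x /\ p x = f j.
    by have [y ? ?] := hf j; exists y.
  have [g hg] := choice hg'; move=> j js; have [gj <-] := hg j; apply/hp.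
  have -> : g j = pr M j (\sum_(k <- s) g k).
    rewrite gpr_sum; last exact: gm_grading.
    rewrite (bigD1_seq j) //= pr_id // big1 ?addr0 // => k kj.
    by rewrite (gpr_neq (gm_grading M) (hg k).1) // eq_sym.
  apply: gsubm_pr => //; apply/hp; rewrite linear_sum -[RHS]e.
  by apply: eq_bigr => k _; case: (hg k).
have h2 k j a x : gr k a -> comp j x -> comp (k + j) (a *: x).
  move=> ha [y hy <-]; exists (a *: y); last by rewrite linearZ.
  exact: gm_act.
have h3 : fd (kmod Q0).
  have pl : linear (p : kmod M -> kmod Q0) by move=> a u v; exact: linearP.
  exact: (@fd_surj _ _ _ (mklin pl) (gm_fd M)).
by exists (mkgmod h1 h2 h3), p; split=> // j x hx; exists x.
Qed.

(** Each graded piece of a module map is a module map.  Taking the piece of degree 0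
    turns the liftings and extensions given by ungraded hypotheses, such as
    self-injectivity, into graded ones. *)
Lemma graded_part M N (h : {linear M -> N}) : exists h0 : {linear M -> N},
  degree_preserving h0 /\
  forall i x, gm_comp M i x -> gm_comp N i (h x) -> h0 x = h x.
Proof.
have [s [us s0 sE]] := gm_supp M.
pose h0 x := \sum_(i <- s) pr N i (h (pr M i x)).
have h0D x y : h0 (x + y) = h0 x + h0 y.
  rewrite /h0 -big_split /=; apply: eq_bigr => i _.
  by rewrite gprD ?linearD ?gprD //; exact: gm_grading.
have h0_hom i x : gm_comp M i x -> h0 x = pr N i (h x).
  move=> hx; rewrite /h0; case: (boolP (i \in s)) => si; last first.
    have -> : x = 0 by rewrite -(pr_id hx) s0.
    rewrite linear0 gpr0; last exact: gm_grading.
    rewrite big1 // => j _; rewrite gpr0; last exact: gm_grading.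
    by rewrite linear0 gpr0 //; exact: gm_grading.
  rewrite (bigD1_seq i) //= (pr_id hx) big1 ?addr0 // => j ji.
  rewrite (gpr_neq (gm_grading M) hx) // linear0 gpr0 //; exact: gm_grading.
have h00 : h0 0 = 0 by apply: (addrI (h0 0)); rewrite -h0D !addr0.
have h0s (I : Type) (r : seq I) (F : I -> M) :
    h0 (\sum_(k <- r) F k) = \sum_(k <- r) h0 (F k).
  by elim: r => [|k r IH]; rewrite ?big_nil // !big_cons h0D IH.
have h0a i j a x : gr i a -> gm_comp M j x -> h0 (a *: x) = a *: h0 x.
  move=> ha hx; rewrite (h0_hom (i + j)) ?(h0_hom j) //; last exact: gm_act.
  by rewrite linearZ pr_act.
have h0Z a x : h0 (a *: x) = a *: h0 x.
  have [t [_ _ ta]] := gpr_supp (galg_grading hA) a.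
  rewrite ta !scaler_suml h0s; apply: eq_bigr => i _.
  rewrite (sE x) scaler_sumr !h0s scaler_sumr; apply: eq_bigr => j _.
  apply: h0a; first exact: gpr_in (galg_grading hA) _ _.
  exact: pr_in.
have hl : linear h0 by move=> a x y; rewrite h0D h0Z.
exists (mklin hl); split=> i x hx /=; rewrite (h0_hom i) //; first exact: pr_in.
exact: pr_id.
Qed.

Lemma giso_bij M N (f : {linear M -> N}) : degree_preserving f -> injective f ->
  (forall y, exists x, f x = y) -> giso M N.
Proof.
move=> hf inj sur; have [g gK] := choice sur.
have gl : linear g by move=> a x y; apply: inj; rewrite linearP !gK.
exists f, (mklin gl); split=> // [i y hy|x] /=; last exact: inj.
have -> : g y = pr M i (g y); last exact: pr_in.
by apply: inj; rewrite -pr_map // !gK pr_id.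
Qed.

Lemma giso_sym M N : giso M N -> giso N M.
Proof. by case=> f [g [? ? ? ?]]; exists g, f. Qed.

Lemma giso_trans M N L : giso M N -> giso N L -> giso M L.
Proof.
case=> f [g [df dg fg gf]] [f' [g' [df' dg' fg' gf']]].
exists (mklin (comp_linear f' f)), (mklin (comp_linear g g')).
split=> [i x /df/df' //|i x /dg'/dg //|x|x] /=; first by rewrite fg' fg.
by rewrite gf gf'.
Qed.

Definition top_degree M (d : int) : Prop :=
  (exists2 x, gm_comp M d x & x <> 0) /\
  (forall i x, d < i -> gm_comp M i x -> x = 0).

Lemma top_degree_ex M : (exists x : M, x <> 0) -> exists d, top_degree M d.
Proof.
move=> [x x0]; have [s [us s0 sE]] := gm_supp M.
pose P d := `[< exists2 x, gm_comp M d x & x <> 0 >].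
have Ps d : P d -> d \in s.
  move=> /asboolP[y hy y0]; apply/negP => /negP ds; apply: y0.
  by rewrite -(pr_id hy) s0.
have hP : has P s.
  apply/negP => /negP /hasPn h; apply: x0; rewrite (sE x) big_seq big1 // => i si.
  apply/eqP/negP => /negP h'; have := h i si; move/negP; apply; apply/asboolP.
  by exists (pr M i x); [exact: pr_in | exact/eqP].
have [d Pd dmax] : exists2 d, P d & forall i, P i -> (i <= d)%R.
  have : exists2 d, P d & forall i, i \in s -> P i -> (i <= d)%R.
    elim: s hP {us s0 sE Ps} => //= i s IH.
    case: (boolP (has P s)) => [/IH[d Pd hd] _|hs].
      case: (boolP (P i)) => Pi; last first.
        exists d => // j; rewrite inE => /orP[/eqP ->|]; last exact: hd.
        by rewrite (negPf Pi).
      case: (leP i d) => hid.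
        by exists d => // j; rewrite inE => /orP[/eqP -> //|]; exact: hd.
      exists i => // j; rewrite inE => /orP[/eqP -> //|js Pj].
      by apply: le_trans (ltW hid); exact: hd.
    rewrite orbF => Pi; exists i => // j.
    rewrite inE => /orP[/eqP -> //|js Pj].
    by move/hasPn: hs => /(_ j js); rewrite Pj.
  by case=> d Pd hd; exists d => // i Pi; apply: hd => //; exact: Ps.
exists d; split; first exact/asboolP.
move=> i y di hy; apply/eqP/negP => /negP y0.
have : (i <= d)%R by apply: dmax; apply/asboolP; exists y => //; exact/eqP.
by rewrite leNgt di.
Qed.

End GMod.

(** * Dimension counting and filtrations *)
Definition kdim (K : fieldType) (A : algType K) (M : lmodType A) (U : set M) : nat :=
  dimS (U : set (kmod M)).

Lemma kdim_min (K : fieldType) (A : algType K) (M : lmodType A) (P : set M -> Prop) :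
  (exists U, P U) -> exists2 U, P U & forall W, P W -> (kdim U <= kdim W)%N.
Proof.
move=> hP; pose Q n := `[< exists2 U, P U & kdim U = n >].
have hQ : exists n, Q n by case: hP => U PU; exists (kdim U); apply/asboolP; exists U.
case: (ex_minnP hQ) => n /asboolP[U PU dU] hmin; exists U => // W PW.
by rewrite dU; apply: hmin; apply/asboolP; exists W.
Qed.

Definition ksub (K : fieldType) (A : algType K) (M : lmodType A) (U : set M) :=
  submodule (U : set (kmod M)).

Definition klin (K : fieldType) (A B : algType K) (M : lmodType A) (N : lmodType B)
  (U : set M) (f : M -> N) := lin_on (U : set (kmod M)) (f : kmod M -> kmod N).

Section KDim.
Variables (K : fieldType) (A B : algType K) (M : lmodType A) (N : lmodType B).
Hypotheses (hM : fd (kmod M)) (hN : fd (kmod N)).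
Implicit Types (U W : set M).

Lemma ksub_submodule U : submodule U -> ksub U.
Proof. exact: submodule_kmod. Qed.
Lemma ksubI U W : ksub U -> ksub W -> ksub (U `&` W).
Proof. exact: (@submoduleI _ (kmod M)). Qed.
Lemma ksubD U W : ksub U -> ksub W -> ksub (setadd U W).
Proof. exact: (@submodule_add _ (kmod M)). Qed.
Lemma ksub_img U (f : M -> N) : ksub U -> klin U f -> ksub (f @` U).
Proof. exact: (@submodule_img _ (kmod M) (kmod N)). Qed.
Lemma ksub_ker U (f : M -> N) : ksub U -> klin U f -> ksub (U `&` [set x | f x = 0]).
Proof. exact: (@submodule_ker _ (kmod M) (kmod N)). Qed.
Lemma ksubT : ksub [set: M].
Proof. exact: submodule_T. Qed.
Lemma ksub0 : ksub [set (0 : M)].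
Proof. exact: (@submodule_0 _ (kmod M)). Qed.
Lemma ksub_intro U : U 0 -> (forall x y, U x -> U y -> U (x + y)) ->
  (forall k x, U x -> U (k%:A *: x)) -> ksub U.
Proof. by move=> h0 hD hZ; split=> // k u v hu hv; apply: hD => //; apply: hZ. Qed.
Lemma ksub_0 U : ksub U -> U 0. Proof. by case. Qed.
Lemma ksub_D U x y : ksub U -> U x -> U y -> U (x + y).
Proof. by move=> h; exact: (@sub_D _ (kmod M) U h). Qed.
Lemma ksub_B U x y : ksub U -> U x -> U y -> U (x - y).
Proof. by move=> h; exact: (@sub_B _ (kmod M) U h). Qed.
Lemma ksub_Z U k x : ksub U -> U x -> U (k%:A *: x).
Proof. by move=> h; exact: (@sub_Z _ (kmod M) U h). Qed.
Lemma ksub_sum U (I : Type) (r : seq I) (P : pred I) (F : I -> M) : ksub U ->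
  (forall i, P i -> U (F i)) -> U (\sum_(i <- r | P i) F i).
Proof. by move=> h; exact: (@sub_sum _ (kmod M) U h). Qed.

Lemma kdim0 : kdim [set (0 : M)] = 0%N.
Proof. exact: dim0 hM. Qed.
Lemma kdim_eq0 U : ksub U -> kdim U = 0%N -> U = [set 0].
Proof. exact: (@dim_eq0 K (kmod M) hM U). Qed.
Lemma kdim_le U W : ksub U -> ksub W -> U `<=` W -> (kdim U <= kdim W)%N.
Proof. exact: (@dim_le K (kmod M) hM U W). Qed.
Lemma kdim_eq U W : ksub U -> ksub W -> U `<=` W -> (kdim W <= kdim U)%N -> U = W.
Proof. exact: (@dim_eq K (kmod M) hM U W). Qed.
Lemma kdim_addI U W : ksub U -> ksub W ->
  (kdim (setadd U W) + kdim (U `&` W) = kdim U + kdim W)%N.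
Proof. exact: (@dim_addI K (kmod M) hM U W). Qed.
Lemma kdim_rank U (f : M -> N) : ksub U -> klin U f ->
  kdim U = (kdim (f @` U) + kdim (U `&` [set x | f x = 0%R]))%N.
Proof. exact: (@dim_rank K (kmod M) (kmod N) hM hN U f). Qed.
Lemma kdim_inj U (f : M -> N) : ksub U -> klin U f ->
  (forall x, U x -> f x = 0 -> x = 0) -> kdim (f @` U) = kdim U.
Proof. exact: (@dim_inj_eq _ (kmod M) (kmod N) hM hN U f). Qed.
Lemma kcompl U : ksub U -> exists W,
  [/\ ksub W, U `&` W = [set 0] & setadd U W = setT].
Proof. exact: (@subspace_compl K (kmod M) hM U). Qed.
Lemma kdim_cover n (f : 'I_n -> M -> N) W (U : set N) :
  ksub W -> submodule (U : set (kmod N)) -> (forall i, klin W (f i)) ->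
  (forall y, U y -> exists x : 'I_n -> M, (forall i, W (x i)) /\ y = \sum_i f i (x i)) ->
  (kdim U <= n * kdim W)%N.
Proof. exact: (@dim_cover _ (kmod M) (kmod N) hM hN n f W U). Qed.
Lemma kdim_detect n (f : 'I_n -> M -> N) U (W : set N) :
  ksub U -> submodule (W : set (kmod N)) -> (forall i, klin U (f i)) ->
  (forall i x, U x -> W (f i x)) ->
  (forall x, U x -> (forall i, f i x = 0) -> x = 0) ->
  (kdim U <= n * kdim W)%N.
Proof. exact: (@dim_detect _ (kmod M) (kmod N) hM hN n f U W). Qed.

End KDim.

Lemma klin_lin (K : fieldType) (A : algType K) (M N : lmodType A) (U : set M)
  (f : {linear M -> N}) : klin U f.
Proof. by apply: lin_on_kmod; exact: lin_on_lin. Qed.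

Section Filtrations.
Variables (K : fieldType) (A : algType K) (gr : int -> set A).
Hypothesis hA : galgebra gr.
Implicit Types M N X Q S : gmod gr.

Lemma filtration_nil M : (forall x : M, x = 0) -> has_filtration M [::].
Proof.
move=> h; have e : [set (0 : M)] = setT by apply/seteqP; split=> // x _; exact: h.
by exists (fun=> [set 0]); split=> // i _; exact: gsubm_0.
Qed.

Lemma subquotient_embed X M (g : {linear X -> M}) : degree_preserving g ->
  injective g -> subquotient_iso [set 0] (g @` setT) X.
Proof.
move=> dg inj; have h (m : M) : exists x, (g @` setT) m -> g x = m.
  have [[x _ <-]|n] := pselect ((g @` setT) m); first by exists x.
    by exists 0 => /n.
have [f fK] := choice h; exists f.
have fE x : f (g x) = x by apply: inj; apply: fK; exists x.
split=> [a _ _ [x _ <-] [y _ <-]|i _ [x _ <-] hx|y|_ [x _ <-]].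
- by rewrite -linearP !fE.
- rewrite fE; have -> : x = pr X i x; last exact: pr_in.
  by apply: inj; rewrite -pr_map // pr_id.
- by exists (g y).
- by rewrite fE; split=> [->|e]; [exact: linear0 | apply: inj; rewrite e linear0].
Qed.

(** Prepending a submodule: the filtration of the quotient is pulled back. *)
Lemma filtration_cons M Q X (U : set M) (p : {linear M -> Q}) s :
  degree_preserving p -> (forall y, exists x, p x = y) -> (forall x, p x = 0 <-> U x) ->
  subquotient_iso [set 0] U X -> has_filtration Q s -> has_filtration M (X :: s).
Proof.
move=> dp sp kp hX [F [F0 FT Fg Fs]].
have p0 : p @^-1` [set 0] = U by apply/seteqP; split=> x /=; rewrite kp.
exists (fun i => if i is j.+1 then p @^-1` F j else [set 0]); split=> //.
- by rewrite /= FT.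
- by case=> [_|i hi]; [exact: gsubm_0 | apply: gsubm_preim; [|exact: Fg]].
case=> [_|i hi] /=.
  by rewrite F0 p0; split=> // x /= ->; rewrite -kp linear0.
have [Fi [f [f1 f2 f3 f4]]] := Fs i hi; split; first by move=> x; apply: Fi.
rewrite (set_nth_default Q) //; exists (fun x => f (p x)); split.
- by move=> a u v hu hv; rewrite linearP f1.
- by move=> j u hu hj; apply: f2 => //; exact: dp.
- by move=> y; have [q hq <-] := f3 y; have [u qE] := sp q; exists u; rewrite /= ?qE.
- by move=> u hu; apply: f4.
Qed.

(** Appending a quotient: the filtration of the kernel is pushed forward. *)
Lemma filtration_rcons M S X (U : set M) (i : {linear S -> M}) (p : {linear M -> X}) s :
  injective i -> (forall x, U x <-> exists y, i y = x) ->
  (forall j y, gm_comp S j y <-> gm_comp M j (i y)) ->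
  degree_preserving p -> (forall y, exists x, p x = y) -> (forall x, p x = 0 <-> U x) ->
  has_filtration S s -> has_filtration M (rcons s X).
Proof.
move=> inj iU icomp dp sp kp [F [F0 FT Fg Fs]].
have di : degree_preserving i by move=> j x /icomp.
have iT : i @` setT = U.
  apply/seteqP; split=> x; first by case=> y _ <-; apply/iU; exists y.
  by case/iU => y <-; exists y.
have h (m : M) : exists x, U m -> i x = m.
  have [/iU[x <-]|n] := pselect (U m); first by exists x.
    by exists 0 => /n.
have [r rK] := choice h; have rE x : r (i x) = x.
  by apply: inj; apply: rK; apply/iU; exists x.
exists (fun k => if (k <= size s)%N then i @` F k else setT); split.
- rewrite /= F0; apply/seteqP; split=> x; first by case=> _ -> <-; rewrite /= linear0.
  by move=> ->; exists 0; rewrite ?linear0.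
- by rewrite size_rcons ltnn.
- move=> k _; case: ifP => hk; last exact: gsubm_T.
  by apply: gsubm_img => //; exact: Fg.
move=> k; rewrite size_rcons ltnS => hk; rewrite hk nth_rcons.
move: hk; rewrite leq_eqVlt => /orP[/eqP ->|hk].
  rewrite ltnn eqxx FT iT; split=> //; exists p; split=> //.
  - by move=> a u v _ _; rewrite linearP.
  - by move=> j u _; apply: dp.
  - by move=> y; have [x xE] := sp y; exists x.
rewrite hk; have [Fi [f [f1 f2 f3 f4]]] := Fs k hk; split; first exact: image_subset.
rewrite (set_nth_default S) //; exists (fun x => f (r x)); split.
- by move=> a _ _ [u hu <-] [v hv <-]; rewrite -linearP !rE f1.
- by move=> j _ [u hu <-] hj; rewrite rE; apply: f2 => //; apply/icomp.
- move=> y; have [q hq <-] := f3 y; exists (i q); first by exists q.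
  by rewrite rE.
- move=> _ [u hu <-]; rewrite rE f4 //; split=> [hu'|[v hv /inj <-] //].
  by exists u.
Qed.

Lemma filtration_ind M (P : gmod gr -> Prop) (R : set M -> Prop) :
  R [set 0] ->
  (forall U W X, graded_submodule U -> graded_submodule W -> U `<=` W ->
     subquotient_iso U W X -> P X -> R U -> R W) ->
  filtered_by P M -> R setT.
Proof.
move=> R0 RS [s [[F [F0 FT Fg Fs]] hs]].
have : forall i, (i <= size s)%N -> R (F i).
  elim=> [|i IH] hi; first by rewrite F0.
  have [Fi fq] := Fs i hi.
  apply: (RS _ _ _ (Fg i (ltnW hi)) (Fg _ hi) Fi fq (hs i hi)).
  exact: IH (ltnW hi).
by move=> /(_ _ (leqnn _)); rewrite FT.
Qed.

Lemma filtered_cons M Q X (U : set M) (p : {linear M -> Q}) P :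
  degree_preserving p -> (forall y, exists x, p x = y) -> (forall x, p x = 0 <-> U x) ->
  subquotient_iso [set 0] U X -> P X -> filtered_by P Q -> filtered_by P M.
Proof.
move=> dp sp kp hX PX [s [hs Ps]]; exists (X :: s); split.
  exact: filtration_cons dp sp kp hX hs.
by case=> [|i] //= hi; rewrite (set_nth_default Q) //; exact: Ps.
Qed.

Lemma filtered_rcons M S X (U : set M) (i : {linear S -> M}) (p : {linear M -> X}) P :
  injective i -> (forall x, U x <-> exists y, i y = x) ->
  (forall j y, gm_comp S j y <-> gm_comp M j (i y)) ->
  degree_preserving p -> (forall y, exists x, p x = y) -> (forall x, p x = 0 <-> U x) ->
  P X -> filtered_by P S -> filtered_by P M.
Proof.
move=> inj iU icomp dp sp kp PX [s [hs Ps]]; exists (rcons s X); split.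
  exact: filtration_rcons inj iU icomp dp sp kp hs.
move=> k; rewrite size_rcons ltnS nth_rcons leq_eqVlt => /orP[/eqP ->|hk].
  by rewrite ltnn eqxx.
by rewrite hk (set_nth_default S) //; exact: Ps.
Qed.

Lemma filtered_nil M P : (forall x : M, x = 0) -> filtered_by P M.
Proof. by move=> h; exists [::]; split=> //; exact: filtration_nil. Qed.

Lemma composition_cons M Q X L n (U : set M) (p : {linear M -> Q}) :
  degree_preserving p -> (forall y, exists x, p x = y) -> (forall x, p x = 0 <-> U x) ->
  subquotient_iso [set 0] U X -> gsimple X -> composition_multiplicity Q L n ->
  composition_multiplicity M L (`[< giso X L >] + n).
Proof.
move=> dp sp kp hX sX [s [hs Ps <-]]; exists (X :: s); split=> //.
  exact: filtration_cons dp sp kp hX hs.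
by case=> [|i] //= hi; rewrite (set_nth_default Q) //; exact: Ps.
Qed.

Lemma minimal_graded_submodule M : (exists x : M, x <> 0) ->
  exists U : set M, [/\ graded_submodule U, U <> [set 0] &
    forall W, graded_submodule W -> W `<=` U -> W = [set 0] \/ W = U].
Proof.
move=> [x x0].
have [|U [gU U0] hmin] := @kdim_min _ _ M
    (fun U : set M => graded_submodule U /\ U <> [set 0]).
  exists setT; split; first exact: gsubm_T.
  by move=> e; apply: x0; have : [set: M] x by []; rewrite e.
exists U; split=> // W gW WU.
have [->|W0] := pselect (W = [set 0]); [by left|right].
apply: kdim_eq => //; first exact: gm_fd.
- exact: ksub_submodule (gsubm_sub gW).
- exact: ksub_submodule (gsubm_sub gU).
- by apply: hmin.
Qed.

Lemma sub_gsimple M (U : set M) (S : gmod gr) (i : {linear S -> M}) :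
  U <> [set 0] ->
  (forall W, graded_submodule W -> W `<=` U -> W = [set 0] \/ W = U) ->
  injective i -> (forall x, U x <-> exists y, i y = x) -> degree_preserving i ->
  gsimple S.
Proof.
move=> U0 hU inj iU di; split.
  apply: contrapT => h; apply: U0; apply/seteqP; split=> x; last first.
    by move=> ->; apply/iU; exists 0; exact: linear0.
  case/iU => y <-; apply: contrapT => y0; apply: h; exists y => e.
  by apply: y0; rewrite /= e linear0.
move=> W gW; have [||e|e] := hU (i @` W); first exact: gsubm_img.
- by move=> _ [y _ <-]; apply/iU; exists y.
- left; apply/seteqP; split=> x; last by move=> ->; exact: sub_0 (gsubm_sub gW).
  move=> Wx; apply: inj; rewrite linear0.
  by have : (i @` W) (i x) by [exists x]; rewrite e.
- right; apply/seteqP; split=> // x _.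
  have : U (i x) by apply/iU; exists x.
  by rewrite -e => -[y Wy /inj <-].
Qed.

Lemma kdim_quotient M Q (U : set M) (p : {linear M -> Q}) :
  (forall y, exists x, p x = y) -> (forall x, p x = 0 <-> U x) ->
  kdim [set: M] = (kdim [set: Q] + kdim U)%N.
Proof.
move=> ps kp.
have pT : p @` setT = [set: GRing.Lmodule.sort Q].
  by apply/seteqP; split=> // y _; have [x <-] := ps y; exists x.
have kerp : [set x | p x = 0] = U by apply/seteqP; split=> x /=; rewrite kp.
have := kdim_rank (gm_fd hA M) (gm_fd hA Q) (ksubT M) (klin_lin p).
by rewrite setTI pT kerp.
Qed.

Lemma kdim_quotient_lt M Q (U : set M) (p : {linear M -> Q}) :
  (forall y, exists x, p x = y) -> (forall x, p x = 0 <-> U x) ->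
  submodule U -> U <> [set 0] -> (kdim [set: Q] < kdim [set: M])%N.
Proof.
move=> ps kp hU U0; have -> := kdim_quotient ps kp.
rewrite -[X in (X < _)%N]addn0 ltn_add2l lt0n; apply/eqP => e0.
exact: U0 (kdim_eq0 (gm_fd hA M) (ksub_submodule hU) e0).
Qed.

(** The step of every induction on composition series: a simple submodule X and the
    quotient by it. *)
Lemma simple_submodule M : (exists x : M, x <> 0) ->
  exists (U : set M) (X Q : gmod gr) (i : {linear X -> M}) (q : {linear M -> Q}),
    [/\ gsimple X /\ (kdim [set: Q] < kdim [set: M])%N, graded_submodule U,
        [/\ injective i, forall x, U x <-> exists y, i y = x &
            forall j y, gm_comp X j y <-> gm_comp M j (i y)],
        [/\ degree_preserving q, forall y, exists x, q x = y, forall x, q x = 0 <-> U x &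
            forall j y, gm_comp Q j y <-> exists2 x, gm_comp M j x & q x = y] &
        subquotient_iso [set 0] U X].
Proof.
move=> hM; have [U [gU U0 Umin]] := minimal_graded_submodule hM.
have [X [i [inj iU icomp]]] := gsub_exists hA gU.
have di : degree_preserving i by move=> l y /icomp.
have [Q [q [dq qs kq qcomp]]] := gquot_exists hA gU.
exists U, X, Q, i, q; split=> //.
- split; first exact: (sub_gsimple U0 Umin inj iU di).
  exact: (kdim_quotient_lt qs kq (gsubm_sub gU) U0).
- have <- : i @` setT = U; last exact: subquotient_embed.
  by apply/seteqP; split=> x; [case=> y _ <-; apply/iU; exists y | case/iU => y <-; exists y].
Qed.

(** Fitting's lemma.  The images of the iterates stabilize at some I = im f^k, and M is
    the direct sum of I and ker f^k; as M is indecomposable one of them vanishes. *)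
Lemma fitting M (f : {linear M -> M}) : gindecomposable M -> degree_preserving f ->
  (exists k, forall x, iter k f x = 0) \/
  (injective f /\ forall y, exists x, f x = y).
Proof.
move=> [_ ind] df.
have itl k : linear (fun x => iter k f x).
  by elim: k => [|k IH] a x y //=; rewrite IH linearP.
have itd k : degree_preserving (mklin (itl k)).
  by elim: k => [|k IH] i x hx //=; apply: df; exact: IH.
pose I k : set M := mklin (itl k) @` setT.
have gI k : graded_submodule (I k) by apply: gsubm_img (itd k) _; exact: gsubm_T.
have sI k : ksub (I k) by exact: ksub_submodule (gsubm_sub (gI k)).
have iterD k l x : iter (k + l) f x = iter k f (iter l f x) by rewrite iterD.
have [|_ [k0 ->] hk] := @kdim_min _ _ M (fun U => exists k, U = I k).
  by exists (I 0%N), 0%N.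
have Ikl0 l : I (k0 + l)%N = I k0.
  apply: kdim_eq => //; first exact: gm_fd.
    by move=> _ [x _ <-]; exists (iter l f x); rewrite //= iterD.
  by apply: hk; exists (k0 + l)%N.
pose k := k0.+1.
have Ikl l : I (k + l)%N = I k by rewrite /k addSnnS Ikl0 -[in RHS]addn1 Ikl0.
have lk U : klin U (mklin (itl k)) by exact: klin_lin.
have imI : mklin (itl k) @` I k = I k.
  rewrite -[RHS](Ikl k); apply/seteqP; split=> x.
    by case=> _ [y _ <-] <-; exists y; rewrite //= iterD.
  by case=> y _ <-; exists (iter k f y); rewrite //= ?iterD //; exists y.
have kerI : I k `&` [set x | mklin (itl k) x = 0] = [set 0].
  apply: kdim_eq0; [exact: gm_fd | exact: ksub_ker |].
  have E := kdim_rank (gm_fd hA M) (gm_fd hA M) (sI k) (lk (I k)).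
  by move/eqP: E; rewrite imI -[X in X == _]addn0 eqn_add2l eq_sym => /eqP.
have [||e|e] := ind (I k) [set x | mklin (itl k) x = 0] (gI k).
- exact: gsubm_ker (itd k).
- split=> // x.
  have : I k (iter k f x) by exists x.
  rewrite -imI => -[y Iy yE]; exists y, (x - y); split; [by rewrite ?imI| |by rewrite addrC subrK].
  have iterB n a b : iter n f (a - b) = iter n f a - iter n f b.
    by elim: n => //= n ->; rewrite linearB.
  change (iter k f (x - y) = 0); rewrite iterB.
  by move: yE; change (iter k f y = iter k f x -> iter k f x - iter k f y = 0) => ->; rewrite subrr.
- left; exists k => x; have : I k (iter k f x) by exists x.
  by rewrite e.
- right; have inj : injective f.
    move=> x y exy; apply/eqP; rewrite -subr_eq0; apply/eqP.
    have : [set z | mklin (itl k) z = 0] (x - y).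
      change (iter k0.+1 f (x - y) = 0); rewrite iterSr linearB exy subrr.
      exact: (linear0 (mklin (itl k0))).
    by rewrite e.
  split=> // y; have : (f @` setT) y; last by case=> x _ <-; exists x.
  suff -> : f @` setT = setT by [].
  apply: kdim_eq => //; first exact: gm_fd.
    by apply: ksub_submodule; apply: gsubm_sub (gsubm_img df (gsubm_T _)).
  rewrite kdim_inj //; [exact: gm_fd|exact: gm_fd|exact: klin_lin|].
  by move=> x _ e0; apply: inj; rewrite e0 linear0.
Qed.

End Filtrations.

(** * Induced modules *)
Definition mkadd (U V : zmodType) (f : U -> V) (hf : {morph f : x y / x - y}) :
  {additive U -> V} := HB.pack f (GRing.isZmodMorphism.Build U V f hf).

Lemma dimS_basis (K : fieldType) (V : lmodType K) n (b : 'I_n -> V) :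
  is_kbasis setT b -> dimS [set: V] = n.
Proof.
move=> hb; have [vT eT] : fd V.
  by apply: (@fd_span _ _ n b) => x; apply/hb.1.
case: _ / eT b hb => b hb.
have e : [set: vT] = vs_set {:vT} by apply/seteqP; split=> // x _; rewrite /vs_set /= memvf.
by rewrite e dimS_vs; rewrite e in hb; rewrite (is_kbasis_dim hb).
Qed.

Lemma dimS_ffun (K : fieldType) (V : lmodType K) n : fd V ->
  dimS [set: {ffun 'I_n -> V}] = (n * dimS [set: V])%N.
Proof.
case=> vT <-.
have e (wT : vectType K) : dimS [set: wT] = dim wT.
  have -> : [set: wT] = vs_set {:wT} by apply/seteqP; split=> // x _; rewrite /vs_set /= memvf.
  by rewrite dimS_vs dimvf.
by rewrite (e vT) (e {ffun 'I_n -> vT}) /dim /= card_ord.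
Qed.

Lemma kdim_indep (K : fieldType) (A B : algType K) (M : lmodType A) (N : lmodType B) n
  (f : 'I_n -> M -> N) : fd (kmod M) -> fd (kmod N) -> (forall i, klin setT (f i)) ->
  (forall x : 'I_n -> M, \sum_i f i (x i) = 0 -> forall i, x i = 0) ->
  (n * kdim [set: M] <= kdim [set: N])%N.
Proof.
move=> hM hN hf h0; rewrite /kdim -dimS_ffun //.
pose F (x : {ffun 'I_n -> kmod M}) : kmod N := \sum_i f i (x i).
have Fl : lin_on setT F.
  move=> a x y _ _; rewrite /F scaler_sumr -big_split; apply: eq_bigr => i _.
  by rewrite !ffunE /= (hf i).
rewrite -(@dim_inj_eq _ _ _ _ hN setT F) //; last 1 first.
- move=> x _ Fx; apply/ffunP => i; rewrite ffunE; exact: h0 Fx i.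
- apply: (dim_le hN) => //; first exact: submodule_img.
- exact: fd_ffun.
Qed.

Section Induced.
Variables (K : fieldType) (A : algType K) (gr : int -> set A).
Hypothesis hA : galgebra gr.
Variables (S : algType K) (grS : int -> set S) (iota : S -> A) (B : set A).

(** The situation of a subalgebra B of A with degree 0 part S: in the application B is
    A^+T inside A, or A^-T inside the opposite algebra, and S is T or its opposite. *)
Record induction_data : Prop := {
  ind_iotaB : {morph iota : s t / s - t};
  ind_iotaM : {morph iota : s t / s * t};
  ind_iotaK : forall k, iota k%:A = k%:A;
  ind_iota0 : forall s, gr 0 (iota s);
  ind_Biota : forall s, B (iota s);
  ind_BB : forall b c, B b -> B c -> B (b - c);
  ind_BM : forall b c, B b -> B c -> B (b * c);
  ind_Bgr : forall i b, B b -> B (gpr gr i b)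
}.

Notation nz := (nonzero_degree_part gr).

Lemma nzP a : nz a <-> gpr gr 0 a = 0.
Proof.
have hg := galg_grading hA; split.
  case=> s [f [hf ->]]; rewrite gpr_sum // big1 // => i _.
  have := hf i; case: eqP => [_ ->|/eqP i0 hi]; first exact: gpr0.
  by apply: (gpr_neq hg hi); rewrite eq_sym.
move=> h; have [s [us _ aE]] := gpr_supp hg a.
exists s, (fun i => if i == 0 then 0 else gpr gr i a); split=> [i|].
  by case: eqP => // _; exact: gpr_in.
by rewrite {1}aE; apply: eq_bigr => i _; case: eqP => // ->.
Qed.

Lemma nz0 : nz 0. Proof. by apply/nzP; exact: gpr0 (galg_grading hA) 0. Qed.

Lemma gprM i j a b : gr i a -> gpr gr (i + j) (a * b) = a * gpr gr j b.
Proof.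
move=> ha; rewrite addrC; have hg := galg_grading hA.
have fB : {morph (fun b => a * b) : x y / x - y} by move=> x y; rewrite mulrBr.
have := @gpr_morph _ _ _ _ hg hg (mkadd fB) i; apply=> k x hx /=.
by rewrite addrC; apply: (galg_M hA).
Qed.

Lemma gprMr i j a b : gr i a -> gpr gr (j + i) (b * a) = gpr gr j b * a.
Proof.
move=> ha; have hg := galg_grading hA.
have fB : {morph (fun b => b * a) : x y / x - y} by move=> x y; rewrite mulrBl.
have := @gpr_morph _ _ _ _ hg hg (mkadd fB) i; apply=> k x hx /=.
exact: (galg_M hA).
Qed.

Lemma nzMr a b : nz a -> gr 0 b -> nz (a * b).
Proof.
move=> /nzP ha hb; apply/nzP; have := @gprMr 0 0 b a hb.
by rewrite addr0 ha mul0r.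
Qed.

Definition is_induced_by (lam : gmod grS) (P : gmod gr) (tau : A -> lam -> P) :=
  [/\ balanced gr iota B tau,
        forall (Z : zmodType) (beta : A -> lam -> Z), balanced gr iota B beta ->
          exists h : {additive P -> Z},
            (forall a x, h (tau a x) = beta a x) /\
            (forall h' : {additive P -> Z},
               (forall a x, h' (tau a x) = beta a x) -> h' =1 h),
        forall a b x, a *: tau b x = tau (a * b) x
      & forall i j a x, gr i a -> gm_comp lam j x ->
          gm_comp P (i + j) (tau a x)].

Hypothesis hD : induction_data.

Lemma iota_0 : iota 0 = 0.
Proof. by rewrite -(subrr 0) (ind_iotaB hD) subrr. Qed.
Lemma iotaN s : iota (- s) = - iota s.
Proof. by rewrite -sub0r (ind_iotaB hD) iota_0 sub0r. Qed.
Lemma iotaD s t : iota (s + t) = iota s + iota t.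
Proof. by rewrite -[t in LHS]opprK (ind_iotaB hD) iotaN opprK. Qed.

Section Theory.
Variables (lam : gmod grS) (P : gmod gr) (tau : A -> lam -> P).
Hypothesis hP : is_induced_by tau.

Lemma ind_tauDl a b x : tau (a + b) x = tau a x + tau b x.
Proof. by case: hP => -[h _ _] _ _ _; exact: h. Qed.
Lemma ind_tauDr a x y : tau a (x + y) = tau a x + tau a y.
Proof. by case: hP => -[_ h _] _ _ _; exact: h. Qed.
Lemma ind_tau_bal a b t x : B b -> nz (b - iota t) -> tau (a * b) x = tau a (t *: x).
Proof. by case: hP => -[_ _ h] _ _ _; exact: h. Qed.
Lemma ind_tauZ a b x : a *: tau b x = tau (a * b) x.
Proof. by case: hP. Qed.
Lemma ind_tau0l x : tau 0 x = 0.
Proof. by apply: (addIr (tau 0 x)); rewrite -ind_tauDl !add0r. Qed.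
Lemma ind_tau0r a : tau a 0 = 0.
Proof. by apply: (addIr (tau a 0)); rewrite -ind_tauDr !add0r. Qed.
Lemma ind_tauBl a b x : tau (a - b) x = tau a x - tau b x.
Proof. by apply: (addIr (tau b x)); rewrite -ind_tauDl !subrK. Qed.
Lemma ind_tau_suml (I : Type) (r : seq I) (Q : pred I) (F : I -> A) x :
  tau (\sum_(i <- r | Q i) F i) x = \sum_(i <- r | Q i) tau (F i) x.
Proof.
apply: (big_morph (fun a => tau a x)); [by move=> ? ?; exact: ind_tauDl|exact: ind_tau0l].
Qed.

Lemma ind_tau_iota a t x : tau (a * iota t) x = tau a (t *: x).
Proof. by apply: ind_tau_bal; [exact: ind_Biota | rewrite subrr; exact: nz0]. Qed.
Lemma ind_tau_K k a x : k%:A *: tau a x = tau a (k%:A *: x).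
Proof.
rewrite -ind_tau_iota (ind_iotaK hD) ind_tauZ; congr tau.
by rewrite -scalerAl mul1r -scalerAr mulr1.
Qed.

(** Additive maps out of an induced module are determined on the tensors: this is the
    uniqueness half of the universal property, and it replaces bilinearity arguments
    below. *)
Lemma ind_ext (Z : zmodType) (f g : P -> Z) :
  {morph f : x y / x - y} -> {morph g : x y / x - y} ->
  (forall a x, f (tau a x) = g (tau a x)) -> f =1 g.
Proof.
move=> hf hg e.
pose beta a x := mkadd hf (tau a x).
have hb : balanced gr iota B beta.
  split=> [a a' x|a x x'|a b t x hB hn]; rewrite /beta.
  - by rewrite ind_tauDl raddfD.
  - by rewrite ind_tauDr raddfD.
  - by rewrite (ind_tau_bal _ _ hB hn).
case: hP => _ /(_ _ _ hb) [h [_ hu]] _ _.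
have e1 := hu (mkadd hf) (fun a x => erefl).
have e2 : mkadd hg =1 h by apply: hu => a x; rewrite /beta /= e.
by move=> p; rewrite -[f p]/(mkadd hf p) e1 -e2.
Qed.

Lemma ind_gen (p : P) : exists n (c : 'I_n -> A) (x : 'I_n -> lam),
  p = \sum_k tau (c k) (x k).
Proof.
pose G : set P := [set p | exists n (c : 'I_n -> A) (x : 'I_n -> lam),
  p = \sum_k tau (c k) (x k)].
have hG : submodule G.
  split; first by exists 0%N, (fun=> 0), (fun=> 0); rewrite big_ord0.
  move=> a _ _ [n [c [x ->]]] [m [d [y ->]]].
  exists (n + m)%N, (fun k => match split k with inl i => a * c i | inr j => d j end),
    (fun k => match split k with inl i => x i | inr j => y j end).
  rewrite big_split_ord /= scaler_sumr; congr (_ + _); apply: eq_bigr => i _.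
    by rewrite ind_tauZ (unsplitK (inl _ i)).
  by rewrite (unsplitK (inr _ i)).
have [Q [q [_ qG]]] := quot_exists hG.
suff : q p = 0 by move/qG.
have -> // : q =1 (fun=> 0).
apply: ind_ext => [x y|x y|a x]; [by rewrite linearB | by rewrite subrr | apply/qG].
by exists 1%N, (fun=> a), (fun=> x); rewrite big_ord1.
Qed.

(** Frobenius reciprocity: an S-linear map into a module where the nonzero degrees of B
    kill the image extends to the induced module. *)
Lemma ind_map (M : lmodType A) (g : lam -> M) :
  (forall x y, g (x + y) = g x + g y) -> (forall t x, g (t *: x) = iota t *: g x) ->
  (forall b x, B b -> nz b -> b *: g x = 0) ->
  exists h : {linear P -> M}, forall a x, h (tau a x) = a *: g x.
Proof.
move=> gD gZ gB; pose beta a x : M := a *: g x.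
have hb : balanced gr iota B beta.
  split=> [a a' x|a x x'|a b t x hB hn]; rewrite /beta ?scalerDl ?gD ?scalerDr //.
  rewrite gZ -scalerA; congr (_ *: _); apply/eqP; rewrite -subr_eq0 -scalerBl.
  by apply/eqP/gB => //; apply: (ind_BB hD) => //; exact: ind_Biota.
case: (hP) => _ /(_ _ _ hb) [h [hE _]] _ _.
have hZ a p : h (a *: p) = a *: h p.
  apply: (@ind_ext _ (fun p => h (a *: p)) (fun p => a *: h p)) => [x y|x y|b x].
  - by rewrite scalerBr raddfB.
  - by rewrite raddfB scalerBr.
  - by rewrite ind_tauZ !hE /beta scalerA.
have hl : linear h by move=> a x y; rewrite raddfD hZ.
by exists (mklin hl).
Qed.

Variable d : int.
Hypothesis lamd : has_degree lam d.

Lemma ind_tau_comp i a x : gr i a -> gm_comp P (i + d) (tau a x).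
Proof. by case: hP => _ _ _ h ha; apply: h. Qed.

Lemma ind_pr i a x : pr P (i + d) (tau a x) = tau (gpr gr i a) x.
Proof.
have fB : {morph (fun a => tau a x) : x y / x - y} by move=> u v; rewrite ind_tauBl.
have := @gpr_morph _ _ _ _ (galg_grading hA) (gm_grading P) (mkadd fB) d; apply=> k b hb /=.
exact: ind_tau_comp.
Qed.

Lemma ind_gen_hom i (p : P) : gm_comp P (i + d) p ->
  exists n (c : 'I_n -> A) (x : 'I_n -> lam),
    (forall k, gr i (c k)) /\ p = \sum_k tau (c k) (x k).
Proof.
move=> hp; have [n [c [x pE]]] := ind_gen p.
exists n, (fun k => gpr gr i (c k)), x; split=> [k|].
  exact: gpr_in (galg_grading hA) _ _.
rewrite -(pr_id hp) pE gpr_sum; last exact: gm_grading.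
by apply: eq_bigr => k _; rewrite ind_pr.
Qed.

Lemma ind_map_deg (M : gmod gr) (h : {linear P -> M}) (g : lam -> M) :
  (forall a x, h (tau a x) = a *: g x) -> (forall x, gm_comp M d (g x)) ->
  degree_preserving h.
Proof.
move=> hE hg i; rewrite -[i](subrK d) => p /ind_gen_hom[n [c [x [hc ->]]]].
rewrite linear_sum; apply: gr_sum => [|k _]; first exact: gm_grading.
by rewrite hE; apply: gm_act.
Qed.

(** A is free as a right module over S modulo the left ideal generated by the elements
    of B without component of degree 0; the q_i are the coordinates in the basis a_i.
    By [ind_dim], inducing multiplies dimensions by n. *)
Record coordinates n (a : 'I_n -> A) (q : 'I_n -> A -> S) : Prop := {
  coo_D : forall i c c', q i (c + c') = q i c + q i c';
  coo_M : forall i c s, q i (c * iota s) = q i c * s;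
  coo_B : forall i c b, B b -> nz b -> q i (c * b) = 0;
  coo_a : forall i j, q i (a j) = (i == j)%:R;
  coo_cover : forall c, exists m (u b : 'I_m -> A),
    (forall l, B (b l) /\ nz (b l)) /\
    c = \sum_i a i * iota (q i c) + \sum_l u l * b l
}.

Variables (n : nat) (a : 'I_n -> A) (q : 'I_n -> A -> S).
Hypothesis hq : coordinates a q.

Lemma ind_tau_coo c x : tau c x = \sum_i tau (a i) (q i c *: x).
Proof.
have [m [u [b [hb cE]]]] := coo_cover hq c.
rewrite {1}cE ind_tauDl !ind_tau_suml [X in _ + X]big1 ?addr0 => [|l _].
  by apply: eq_bigr => i _; rewrite ind_tau_iota.
have [hB hn] := hb l.
by rewrite (@ind_tau_bal _ _ 0) ?scale0r ?ind_tau0r // iota_0 subr0.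
Qed.

Lemma ind_coord_map : exists E : P -> {ffun 'I_n -> lam},
  [/\ {morph E : x y / x - y}, forall c x i, E (tau c x) i = q i c *: x
    & forall p, \sum_i tau (a i) (E p i) = p].
Proof.
pose beta c x : {ffun 'I_n -> lam} := [ffun i => q i c *: x].
have hb : balanced gr iota B beta.
  split=> [c c' x|c x x'|c b t x hB hn]; apply/ffunP => i; rewrite !ffunE.
  - by rewrite (coo_D hq) scalerDl.
  - by rewrite scalerDr.
  - have -> : c * b = c * iota t + c * (b - iota t) by rewrite -mulrDr addrC subrK.
    rewrite (coo_D hq) (coo_M hq) (coo_B hq) ?addr0 ?scalerA //.
    by apply: (ind_BB hD) => //; exact: ind_Biota.
case: (hP) => _ /(_ _ _ hb) [E [EE _]] _ _; exists E; split=> [x y|c x i|p].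
- by rewrite raddfB.
- by rewrite EE ffunE.
apply: (@ind_ext _ (fun p => \sum_i tau (a i) (E p i)) id) => // [x y|c x].
  rewrite -sumrB; apply: eq_bigr => i _; rewrite raddfB !ffunE.
  by rewrite -[_ - _ in LHS]/(_ + _) ind_tauDr; congr (_ + _); apply: (addIr (tau (a i) (E y i)));
    rewrite -ind_tauDr !addNr ind_tau0r.
by rewrite [RHS]ind_tau_coo; apply: eq_bigr => i _; rewrite EE ffunE.
Qed.

(** The coordinates q_i make the maps tau (a_i) independent; together with
    [ind_tau_coo] they identify the induced module with lam^n. *)
Lemma ind_tau_inj (x : 'I_n -> lam) : \sum_i tau (a i) (x i) = 0 -> forall i, x i = 0.
Proof.
have [E [EB EE _]] := ind_coord_map => h i.
have : (mkadd EB (\sum_i tau (a i) (x i))) i = 0 by rewrite h raddf0 ffunE.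
rewrite raddf_sum sum_ffunE (bigD1 i) //= EE (coo_a hq) eqxx scale1r.
rewrite big1 ?addr0 // => j ji.
by rewrite EE (coo_a hq) eq_sym (negPf ji) scale0r.
Qed.

Lemma ind_tau_klin c : klin setT (tau c).
Proof. by move=> k x y _ _; rewrite ind_tauDr -ind_tau_K. Qed.

Hypothesis hS : galgebra grS.

Lemma ind_dim : kdim [set: P] = (n * kdim [set: lam])%N.
Proof.
apply/eqP; rewrite eqn_leq; apply/andP; split.
  apply: (@kdim_cover _ _ _ lam P _ _ n (fun i => tau (a i))) => //; try exact: gm_fd.
    by move=> i; exact: ind_tau_klin.
  move=> p _; have [E [_ _ pE]] := ind_coord_map.
  by exists (E p); split=> //; rewrite pE.
apply: (@kdim_indep _ _ _ _ _ n (fun i => tau (a i))); try exact: gm_fd.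
  by move=> i; exact: ind_tau_klin.
exact: ind_tau_inj.
Qed.

End Theory.

End Induced.

Lemma additive_factor (V Q Z : zmodType) (p : {additive V -> Q}) (f : {additive V -> Z}) :
  (forall y, exists x, p x = y) -> (forall x, p x = 0 -> f x = 0) ->
  exists g : {additive Q -> Z}, forall x, g (p x) = f x.
Proof.
move=> ps pf; have [s sK] := choice ps.
have fE x y : p x = p y -> f x = f y.
  move=> e; apply/eqP; rewrite -subr_eq0 -raddfB; apply/eqP/pf.
  by rewrite raddfB e subrr.
have gB : {morph (fun q => f (s q)) : x y / x - y}.
  by move=> x y; rewrite -raddfB; apply: fE; rewrite raddfB !sK.
by exists (mkadd gB) => x /=; apply: fE.
Qed.

Section FreeModule.
Variables (K : fieldType) (A : algType K) (gr : int -> set A).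
Hypothesis hA : galgebra gr.
Variables (n : nat) (d : int).

Let V : lmodType A := {ffun 'I_n -> A^o}.
Let comp (i : int) : set V := [set f | forall k, gr (i - d) (f k)].

Lemma free_gmod : exists F : gmod gr, exists phi : {linear F -> {ffun 'I_n -> A^o}},
  bijective phi /\ forall i x, gm_comp F i x <-> forall k, gr (i - d) (phi x k).
Proof.
have hg := galg_grading hA.
have h1 : grading comp.
  split=> [i k|i x y hx hy k|x|s f us hf e].
  - by rewrite ffunE; exact: gr0.
  - by rewrite !ffunE; apply: grB.
  - have [S hS] := choice (fun k => gpr_supp hg (x k)).
    pose s := undup (flatten [seq S i | i <- enum 'I_n]).
    exists [seq j + d | j <- s], (fun i => [ffun k => gpr gr (i - d) (x k)]).
    split=> [i k|]; first by rewrite ffunE; exact: gpr_in.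
    apply/ffunP => k; rewrite big_map sum_ffunE.
    rewrite (eq_bigr (fun j => gpr gr j (x k))) => [|j _]; last by rewrite ffunE addrK.
    apply: gpr_sumE => //; first exact: undup_uniq.
    move=> j; rewrite mem_undup => js; have [_ -> //] := hS k.
    apply/negP => jk; move/negP: js; apply; apply/flattenP; exists (S k) => //.
    exact/map_f/mem_enum.
  - move=> i si; apply/ffunP => k; rewrite ffunE.
    case: hg => _ _ _ /(_ [seq j - d | j <- s] (fun j => f (j + d) k)) h.
    rewrite -[i](subrK d); apply: h.
    + by rewrite map_inj_uniq //; exact: addIr.
    + by move=> j; have := hf (j + d) k; rewrite addrK.
    + rewrite big_map; under eq_bigr do rewrite subrK.
      by rewrite -sum_ffunE e ffunE.
    + exact: map_f.
have h2 i j a x : gr i a -> comp j x -> comp (i + j) (a *: x).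
  by move=> ha hx k; rewrite ffunE -addrA; apply: (galg_M hA).
have h3 : fd (kmod V).
  apply: (@kfd_fingen _ _ _ hA V n (fun i => [ffun k => (k == i)%:R])) => x.
  exists x; apply/ffunP => k; rewrite sum_ffunE (bigD1 k) //= !ffunE eqxx.
  rewrite big1 ?addr0 => [|i ik]; first by rewrite /GRing.scale /= mulr1.
  by rewrite !ffunE eq_sym (negPf ik) scaler0.
have il : linear (@id V) by [].
exists (mkgmod h1 h2 h3), (mklin il); split=> //.
by exists id.
Qed.

End FreeModule.

Section InducedExists.
Variables (K : fieldType) (A : algType K) (gr : int -> set A).
Hypothesis hA : galgebra gr.
Variables (S : algType K) (grS : int -> set S) (iota : S -> A) (B : set A).
Hypothesis hD : induction_data gr iota B.
Variables (lam : gmod grS) (d : int).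
Hypothesis lamd : has_degree lam d.
Notation nz := (nonzero_degree_part gr).

(** The induced module is a quotient of the free module A^n on generators e_k of lam: the
    relations are the tuples in B whose degree 0 parts t_k satisfy sum t_k e_k = 0.
    The relations are stable under homogeneous components, which grades the quotient. *)
Lemma induced_exists : exists P : gmod gr, is_induced iota B lam P.
Proof.
have [n [e he]] := gm_fingen lam.
have [F [phi [[psi phiK psiK] Fc]]] := free_gmod hA n d.
have psi_lin : linear psi.
  by move=> a x y; apply: (can_inj phiK); rewrite linearP !psiK.
pose R : set F := [set f | exists t : 'I_n -> S,
  (forall k, B (phi f k) /\ nz (phi f k - iota (t k))) /\ \sum_k t k *: e k = 0].
pose U : set F := [set f | exists m (a : 'I_m -> A) (r : 'I_m -> F),
  (forall l, R (r l)) /\ f = \sum_l a l *: r l].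
have hU : submodule U.
  split; first by exists 0%N, (fun=> 0), (fun=> 0); split=> [[]//|]; rewrite big_ord0.
  move=> c _ _ [m [a [r [hr ->]]]] [m' [a' [r' [hr' ->]]]].
  exists (m + m')%N, (fun k => match split k with inl i => c * a i | inr j => a' j end),
    (fun k => match split k with inl i => r i | inr j => r' j end).
  split; first by move=> l; case: (split l).
  rewrite big_split_ord /= scaler_sumr; congr (_ + _); apply: eq_bigr => i _.
    by rewrite scalerA (unsplitK (inl _ i)).
  by rewrite (unsplitK (inr _ i)).
have RU f : R f -> U f.
  move=> hf; exists 1%N, (fun=> 1), (fun=> f); split=> //.
  by rewrite big_ord1 scale1r.
have phi_pr i f k : phi (pr F (i + d) f) k = gpr gr i (phi f k).
  have fB : {morph (fun f => phi f k) : x y / x - y}.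
    by move=> x y; rewrite linearB !ffunE.
  apply/esym; have [s [us s0 {1}->]] := gpr_supp (gm_grading F) f.
  rewrite linear_sum sum_ffunE gpr_sum; last exact: galg_grading.
  have E j : gpr gr i (phi (pr F j f) k) = if j == i + d then phi (pr F j f) k else 0.
    have /Fc/(_ k) h := pr_in (M := F) j f.
    by rewrite (gpr_hom (galg_grading hA) h) eq_sym subr_eq.
  under eq_bigr do rewrite E.
  case: (boolP (i + d \in s)) => si.
    by rewrite (bigD1_seq (i + d)) //= eqxx big1 ?addr0 // => j /negPf ->.
  rewrite s0 // linear0 ffunE big_seq big1 // => j js; case: eqP => // ej.
  by rewrite -ej js in si.
have gU : graded_submodule U.
  apply: gsubm_intro => // _ i [m [a [r [hr ->]]]].
  rewrite gpr_sum; last exact: gm_grading.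
  apply: (sub_sum hU) => l _.
  have [s [us _ aE]] := gpr_supp (galg_grading hA) (a l).
  rewrite aE scaler_suml gpr_sum; last exact: gm_grading.
  apply: (sub_sum hU) => j _.
  have -> : pr F i (gpr gr j (a l) *: r l) = gpr gr j (a l) *: pr F (i - j) (r l).
    rewrite -[i in LHS](subrK j) addrC pr_act //; exact: gpr_in (galg_grading hA) _ _.
  apply: (sub_Z hU); apply: RU; have [t [ht te]] := hr l.
  rewrite -[i - j](subrK d); case: (eqVneq (i - j - d) 0) => [->|ij].
    exists t; split=> // k; rewrite phi_pr; split; first by apply: (ind_Bgr hD); case: (ht k).
    apply/(nzP hA); rewrite gprB; last exact: galg_grading.
    have [_ /(nzP hA)] := ht k; rewrite gprB; last exact: galg_grading.
    by rewrite (gpr_id (galg_grading hA) (gpr_in (galg_grading hA) _ _)).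
  exists (fun=> 0); split; last by rewrite big1 // => k _; rewrite scale0r.
  move=> k; rewrite phi_pr; split; first by apply: (ind_Bgr hD); case: (ht k).
  apply/(nzP hA); rewrite (iota_0 hD) subr0.
  by rewrite (gpr_neq (galg_grading hA) (gpr_in (galg_grading hA) _ _)) // eq_sym.
have [P [p [dp ps kp Pc]]] := gquot_exists hA gU.
(* T x is a chosen tuple of coordinates of x; tau is additive because the relations
   contain the differences of two such tuples *)
have [T hT] := choice he.
pose v (a : A) (t : 'I_n -> S) : F := psi [ffun k => a * iota (t k)].
have vE a t k : phi (v a t) k = a * iota (t k) by rewrite /v psiK ffunE.
pose tau (a : A) (x : lam) : P := p (v a (T x)).
have vU a t : \sum_k t k *: e k = 0 -> U (v a t).
  move=> ht; exists 1%N, (fun=> a), (fun=> v 1 t); split.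
    move=> _; exists t; split=> // k; rewrite vE mul1r subrr.
    by split; [exact: (ind_Biota hD) | exact: (nz0 hA)].
  rewrite big_ord1; apply: (can_inj phiK); rewrite linearZ; apply/ffunP => k.
  by rewrite ffunE !vE mul1r.
have vB a t t' : v a t - v a t' = v a (fun k => t k - t' k).
  apply: (can_inj phiK); rewrite linearB; apply/ffunP => k.
  by rewrite !ffunE !vE (ind_iotaB hD) mulrBr.
have tauE a t : p (v a t) = tau a (\sum_k t k *: e k).
  apply/eqP; rewrite -subr_eq0 -linearB; apply/eqP/kp; rewrite vB; apply: vU.
  under eq_bigr do rewrite scalerBl.
  by rewrite sumrB -hT subrr.
have tauDl a a' x : tau (a + a') x = tau a x + tau a' x.
  rewrite -linearD; congr (p _); apply: (can_inj phiK); rewrite linearD.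
  by apply/ffunP => k; rewrite ffunE !vE mulrDl.
have tauDr a x x' : tau a (x + x') = tau a x + tau a x'.
  rewrite -linearD (_ : v a (T x) + v a (T x') = v a (fun k => T x k + T x' k)).
    rewrite tauE; congr (tau _ _); under eq_bigr do rewrite scalerDl.
    by rewrite big_split /= -!hT.
  apply: (can_inj phiK); rewrite linearD; apply/ffunP => k.
  by rewrite ffunE !vE (iotaD hD) mulrDr.
have tauZ a b x : a *: tau b x = tau (a * b) x.
  rewrite -linearZ; congr (p _); apply: (can_inj phiK); rewrite linearZ.
  by apply/ffunP => k; rewrite ffunE !vE -mulrA.
have tau_bal a b t x : B b -> nz (b - iota t) -> tau (a * b) x = tau a (t *: x).
  move=> hB hn; rewrite [in RHS](hT x) scaler_sumr.
  under [in RHS]eq_bigr do rewrite scalerA.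
  rewrite -tauE; apply/eqP; rewrite -subr_eq0 -linearB; apply/eqP/kp.
  exists 1%N, (fun=> a), (fun=> psi [ffun k => (b - iota t) * iota (T x k)]); split.
    move=> _; exists (fun=> 0); split; last by rewrite big1 // => k _; rewrite scale0r.
    move=> k; rewrite psiK ffunE (iota_0 hD) subr0; split.
      apply: (ind_BM hD); last exact: (ind_Biota hD).
      by apply: (ind_BB hD) => //; exact: (ind_Biota hD).
    by apply: nzMr => //; exact: (ind_iota0 hD).
  rewrite big_ord1; apply: (can_inj phiK); rewrite linearZ linearB; apply/ffunP => k.
  by rewrite !ffunE !vE ?psiK ?ffunE (ind_iotaM hD) /GRing.scale /= mulrBl mulrBr !mulrA.
exists P, tau; split=> //.
- move=> Z beta [bDl bDr bb].
  have b0r a : beta a 0 = 0 by apply: (addIr (beta a 0)); rewrite -bDr !add0r.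
  have b0l x : beta 0 x = 0 by apply: (addIr (beta 0 x)); rewrite -bDl !add0r.
  have bBl a a' x : beta (a - a') x = beta a x - beta a' x.
    by apply: (addIr (beta a' x)); rewrite -bDl !subrK.
  have biota a t x : beta (a * iota t) x = beta a (t *: x).
    by apply: bb; [exact: (ind_Biota hD) | rewrite subrr; exact: (nz0 hA)].
  have bsumr a (t : 'I_n -> S) : \sum_k beta a (t k *: e k) = beta a (\sum_k t k *: e k).
    by apply/esym/(big_morph (beta a)).
  pose f0 (f : F) : Z := \sum_k beta (phi f k) (e k).
  have f0B : {morph f0 : x y / x - y}.
    move=> x y; rewrite /f0 -sumrB; apply: eq_bigr => k _.
    by rewrite linearB !ffunE bBl.
  have f0U f : U f -> f0 f = 0.
    move=> [m [a [r [hr ->]]]].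
    rewrite -[f0]/(mkadd f0B : F -> Z) raddf_sum big1 // => l _ /=.
    have [t [ht te]] := hr l; rewrite /f0.
    rewrite (eq_bigr (fun k => beta (a l) (t k *: e k))) ?bsumr ?te // => k _.
    by rewrite linearZ ffunE; have [hB hn] := ht k; rewrite -(bb _ _ _ _ hB hn).
  have [h hE] := @additive_factor _ _ _ p (mkadd f0B) ps (fun x => fun px => f0U x ((kp x).1 px)).
  have hh a x : h (tau a x) = beta a x.
    rewrite /tau hE /= /f0 [in RHS](hT x) -bsumr; apply: eq_bigr => k _.
    by rewrite vE biota.
  exists h; split=> // h' hh' y; have [f <-] := ps y.
  have -> : p f = \sum_k tau (phi f k) (e k).
    have fE : f = \sum_k v (phi f k) (fun l => (l == k)%:R).
      apply: (can_inj phiK); rewrite linear_sum; apply/ffunP => l.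
      rewrite sum_ffunE (bigD1 l) //= vE eqxx -[X in iota X]scale1r (ind_iotaK hD).
      rewrite scale1r mulr1 big1 ?addr0 // => k kl.
      by rewrite vE eq_sym (negPf kl) (iota_0 hD) mulr0.
    rewrite {1}fE linear_sum; apply: eq_bigr => k _; rewrite tauE; congr tau.
    rewrite (bigD1 k) //= eqxx scale1r big1 ?addr0 // => l lk.
    by rewrite (negPf lk) scale0r.
  by rewrite !raddf_sum; apply: eq_bigr => k _; rewrite hh hh'.
- move=> i j a x ha hx; case: (eqVneq j d) => [->|jd].
    apply/Pc; exists (v a (T x)) => //; apply/Fc => k; rewrite vE addrK -[i]addr0.
    by apply: (galg_M hA) => //; exact: (ind_iota0 hD).
  have -> : x = 0 by apply: (gr_disj (gm_grading lam) (lamd x) hx); rewrite eq_sym.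
  have -> : tau a 0 = 0 by apply: (addIr (tau a 0)); rewrite -tauDr !add0r.
  exact: gr0 (gm_grading P) _.
Qed.

End InducedExists.

(** * Duals *)
Section MkLmodule.
Variables (R : nzRingType) (Z : zmodType) (sc : R -> Z -> Z).
Hypotheses (h1 : forall a b v, sc a (sc b v) = sc (a * b) v) (h2 : left_id 1 sc)
  (h3 : right_distributive sc +%R) (h4 : forall v, {morph sc^~ v : a b / a + b}).
(** The proofs of the module axioms are phantom parameters of the carrier, so that the
    module instance on it can be declared for arbitrary data. *)
Definition mklmod_carrier of phant_id h1 h1 & phant_id h2 h2 & phant_id h3 h3
  & phant_id h4 h4 : Type := Z.
Let C := mklmod_carrier id id id id.
HB.instance Definition _ := GRing.Zmodule.copy C Z.
HB.instance Definition _ := GRing.Zmodule_isLmodule.Build R C h1 h2 h3 h4.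
Definition mklmod : lmodType R := C.
End MkLmodule.

Section KLinear.
Variables (K : fieldType) (A : algType K) (V : lmodType A) (phi : V -> K).
Hypothesis h : klinear phi.
Lemma klinear_linear : linear (phi : kmod V -> K^o).
Proof. by move=> k x y; exact: h. Qed.
Lemma klinear_sum (I : Type) (r : seq I) (P : pred I) (F : I -> V) :
  phi (\sum_(i <- r | P i) F i) = \sum_(i <- r | P i) phi (F i).
Proof. exact: (linear_sum (mklin klinear_linear)). Qed.
Lemma klinear0 : phi 0 = 0.
Proof. exact: (linear0 (mklin klinear_linear)). Qed.
Lemma klinearZ k x : phi (k%:A *: x) = k * phi x.
Proof. exact: (linearZ_LR (mklin klinear_linear) k x). Qed.
Lemma klinearD x y : phi (x + y) = phi x + phi y.
Proof. exact: (linearD (mklin klinear_linear) x y). Qed.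
Lemma klinearB x y : phi (x - y) = phi x - phi y.
Proof. exact: (linearB (mklin klinear_linear) x y). Qed.
End KLinear.

Section Dual.
Variables (K : fieldType) (A1 A2 : algType K) (op : A2 -> A1).
Variables (gr1 : int -> set A1) (gr2 : int -> set A2).
Hypothesis hA1 : galgebra gr1.

Record antimorphism : Prop := {
  op_B : {morph op : x y / x - y};
  op_M : forall x y, op (x * y) = op y * op x;
  op_K : forall k, op k%:A = k%:A;
  op_gr : forall i a, gr2 i a -> gr1 (- i) (op a)
}.
Hypothesis hop : antimorphism.
Variable M : gmod gr1.

Lemma op_0 : op 0 = 0.
Proof. by rewrite -(subrr (0 : A2)) (op_B hop) subrr. Qed.
Lemma op_D x y : op (x + y) = op x + op y.
Proof.
have N z : op (- z) = - op z by rewrite -sub0r (op_B hop) op_0 sub0r.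
by rewrite -[y in LHS]opprK (op_B hop) N opprK.
Qed.

(** The dual is carried by row vectors, the values on a basis of M. *)
Lemma dual_exists : exists N : gmod gr2, is_dual op M N.
Proof.
have [n [e0 [he hi]]] := fdP (gm_fd hA1 M); pose e : 'I_n -> M := e0.
have hc0 (x : M) : exists c : 'I_n -> K, x = \sum_i (c i)%:A *: e i.
  by have [c cE] := (he x).1 I; exists c.
have [c hc] := choice hc0.
have cu (a b : 'I_n -> K) : \sum_i (a i)%:A *: e i = \sum_i (b i)%:A *: e i -> a = b.
  move=> h; apply/funext => i; apply/eqP; rewrite -subr_eq0; apply/eqP.
  apply: (hi (fun i => a i - b i)); apply/eqP; move/eqP: h; rewrite -subr_eq0 -sumrB.
  congr (_ == 0); apply: eq_bigr => j _.
  by rewrite -scalerBl -scalerBl.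
have cl k x y i : c (k%:A *: x + y) i = k * c x i + c y i.
  rewrite (cu (c (k%:A *: x + y)) (fun i => k * c x i + c y i)) // -hc.
  rewrite {1}(hc x) {1}(hc y) scaler_sumr -big_split /=; apply: eq_bigr => j _.
  by rewrite scalerA -scalerDl -scalerAl mul1r scalerA -scalerDl.
pose ev (y : 'rV[K]_n) (x : M) : K := \sum_i y 0 i * c x i.
have evl y : klinear (ev y).
  move=> k u v; rewrite /ev mulr_sumr -big_split; apply: eq_bigr => i _.
  by rewrite cl mulrDr mulrCA.
have ce i j : c (e i) j = (i == j)%:R.
  rewrite (cu (c (e i)) (fun j => (i == j)%:R)) // -hc.
  rewrite (bigD1 i) //= eqxx !scale1r big1 ?addr0 // => k ki.
  by rewrite eq_sym (negPf ki) !scale0r.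
have eve y i : ev y (e i) = y 0 i.
  rewrite /ev (bigD1 i) //= ce eqxx mulr1 big1 ?addr0 // => k ki.
  by rewrite ce eq_sym (negPf ki) mulr0.
have evs phi : klinear phi -> exists y, ev y = phi.
  move=> hphi; exists (\row_i phi (e i)); apply/funext => x.
  rewrite [in RHS](hc x) (klinear_sum hphi); apply: eq_bigr => i _.
  by rewrite mxE klinearZ // mulrC.
have evi : injective ev.
  move=> y z h; apply/rowP => i; by rewrite -!eve h.
have evD y z x : ev (y + z) x = ev y x + ev z x.
  by rewrite /ev -big_split; apply: eq_bigr => i _; rewrite mxE mulrDl.
have evB y z x : ev (y - z) x = ev y x - ev z x.
  by rewrite /ev -sumrB; apply: eq_bigr => i _; rewrite !mxE mulrBl.
have ev0 x : ev 0 x = 0 by rewrite /ev big1 // => i _; rewrite mxE mul0r.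
have ev_sum (I : Type) (r : seq I) (P : pred I) (F : I -> 'rV[K]_n) x :
  ev (\sum_(i <- r | P i) F i) x = \sum_(i <- r | P i) ev (F i) x.
  exact: (big_morph (fun y => ev y x)).
pose sc (a : A2) (y : 'rV[K]_n) : 'rV[K]_n := \row_i ev y (op a *: e i).
have scE a y x : ev (sc a y) x = ev y (op a *: x).
  rewrite [in RHS](hc x) scaler_sumr (klinear_sum (evl y)); apply: eq_bigr => i _.
  rewrite mxE mulrC -klinearZ // ; congr (ev y _).
  by rewrite !scalerA -scalerAl mul1r -scalerAr mulr1.
have scA a b y : sc a (sc b y) = sc (a * b) y.
  by apply: evi; apply/funext => x; rewrite !scE scalerA (op_M hop).
have sc1 : left_id 1 sc.
  move=> y; apply: evi; apply/funext => x; rewrite scE.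
  by have := op_K hop 1; rewrite !scale1r => ->; rewrite scale1r.
have scDr : right_distributive sc +%R.
  by move=> a y z; apply: evi; apply/funext => x; rewrite scE !evD !scE.
have scDl y : {morph sc^~ y : a b / a + b}.
  move=> a b; apply: evi; apply/funext => x.
  by rewrite evD !scE op_D scalerDl klinearD.
pose N0 : lmodType A2 := mklmod scA sc1 scDr scDl.
pose comp (i : int) : set N0 :=
  [set y | forall j x, j <> i -> gm_comp M j x -> ev y x = 0].
have [s [us s0 sE]] := gm_supp hA1 M.
have h1 : grading comp.
  split=> [i j x _ _|i y z hy hz j x ij hx|y|t f ut hf fE i it].
  - exact: ev0.
  - by rewrite evB (hy j) ?(hz j) ?subrr.
  - have hp i : exists z, ev z = (fun x => ev y (pr M i x)).
      apply: evs => k u v; rewrite gprD ?pr_K //; last exact: gm_grading.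
      exact: evl.
    have [f hf] := choice hp; exists s, f; split=> [i j x ji hx|].
      by rewrite hf (gpr_neq (gm_grading M) hx) ?klinear0 //; apply/eqP => e'; case: ji.
    apply: evi; apply/funext => x; rewrite ev_sum [in LHS](sE x) (klinear_sum (evl y)).
    by apply: eq_bigr => i _; rewrite hf.
  apply: evi; apply/funext => x; rewrite ev0 (sE x) (klinear_sum (evl _)) big1 // => j _.
  have [<-|ij] := eqVneq i j; last first.
    by apply: (hf i j) (pr_in _ _); apply/eqP; rewrite eq_sym.
  have := ev0 (pr M i x); rewrite -[X in ev X]fE ev_sum (bigD1_seq i) //= big1 ?addr0 // => k ki.
  by apply: (hf k i) (pr_in _ _); apply/eqP; rewrite eq_sym.
have h2 i j a y : gr2 i a -> comp j y -> comp (i + j) (a *: y).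
  move=> ha hy k x kij hx; rewrite [LHS]scE; apply: (hy (- i + k)).
    by move=> e'; apply: kij; rewrite -e' addrA subrr add0r.
  by apply: gm_act => //; exact: (op_gr hop).
have evK k (y : N0) : k%:A *: y = k *: (y : 'rV[K]_n).
  apply: evi; apply/funext => x; rewrite [LHS]scE (op_K hop) klinearZ //.
  by rewrite /ev mulr_sumr; apply: eq_bigr => i _; rewrite !mxE mulrA.
have h3 : fd (kmod N0).
  apply: (@fd_span _ (kmod N0) n (fun i => delta_mx 0 i : 'rV[K]_n)) => y.
  exists (fun i => (y : 'rV[K]_n) 0 i); rewrite {1}[y](row_sum_delta (y : 'rV[K]_n)).
  by apply: eq_bigr => i _; rewrite -[LHS]evK.
exists (mkgmod h1 h2 h3), ev; split=> //.
by move=> a y z x; rewrite evD; congr (_ + _); exact: scE.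
Qed.

Section DualTheory.
Variables (N : gmod gr2) (ev : N -> M -> K).
Hypothesis hev : [/\ forall n, klinear (ev n),
        forall phi : M -> K, klinear phi -> exists n, ev n = phi,
        injective ev,
        forall a n n' x, ev (a *: n + n') x = ev n (op a *: x) + ev n' x
      & forall i n, gm_comp N i n <->
          forall j x, j <> i -> gm_comp M j x -> ev n x = 0].

Lemma dual_klin n : klinear (ev n). Proof. by case: hev. Qed.
Lemma dual_inj n n' : (forall x, ev n x = ev n' x) -> n = n'.
Proof. by case: hev => _ _ h _ _ e; apply: h; apply/funext. Qed.
Lemma dual_surj (phi : M -> K) : klinear phi -> exists n, forall x, ev n x = phi x.
Proof. by case: hev => _ h _ _ _ /h[n <-]; exists n. Qed.
Lemma dual_D n n' x : ev (n + n') x = ev n x + ev n' x.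
Proof.
case: hev => _ _ _ h _; rewrite -[n]scale1r h scale1r; congr (ev n _ + _).
by have := op_K hop 1; rewrite !scale1r => ->; rewrite scale1r.
Qed.
Lemma dual_0 x : ev 0 x = 0.
Proof. by apply: (addIr (ev 0 x)); rewrite -dual_D !add0r. Qed.
Lemma dual_act a n x : ev (a *: n) x = ev n (op a *: x).
Proof. by case: hev => _ _ _ h _; rewrite -[a *: n]addr0 h dual_0 addr0. Qed.
Lemma dual_Z k n x : ev (k%:A *: n) x = k * ev n x.
Proof. by rewrite dual_act (op_K hop) klinearZ //; exact: dual_klin. Qed.

Lemma dual_sum (I : Type) (r : seq I) (P : pred I) (F : I -> N) x :
  ev (\sum_(i <- r | P i) F i) x = \sum_(i <- r | P i) ev (F i) x.
Proof.
by apply: (big_morph (fun y => ev y x)) => [? ?|]; [exact: dual_D | exact: dual_0].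
Qed.
Lemma dual_comp i n : gm_comp N i n <->
  forall j x, j <> i -> gm_comp M j x -> ev n x = 0.
Proof. by case: hev. Qed.

Lemma dual_basis : exists n (e : 'I_n -> M) (f : 'I_n -> N),
  [/\ @is_kbasis _ (kmod M) setT n e, @is_kbasis _ (kmod N) setT n f,
    forall x, x = \sum_i (ev (f i) x)%:A *: e i
    & forall y, y = \sum_i (ev y (e i))%:A *: f i].
Proof.
have [n [e0 [he hi]]] := fdP (gm_fd hA1 M); pose e : 'I_n -> M := e0.
have hc0 (x : M) : exists c : 'I_n -> K, x = \sum_i (c i)%:A *: e i.
  by have [c cE] := (he x).1 I; exists c.
have [c hc] := choice hc0.
have cu (a b : 'I_n -> K) : \sum_i (a i)%:A *: e i = \sum_i (b i)%:A *: e i -> a = b.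
  move=> h; apply/funext => i; apply/eqP; rewrite -subr_eq0; apply/eqP.
  apply: (hi (fun i => a i - b i)); apply/eqP; move/eqP: h; rewrite -subr_eq0 -sumrB.
  congr (_ == 0); apply: eq_bigr => j _.
  by rewrite -scalerBl -scalerBl.
have cl i : klinear (fun x => c x i).
  move=> k x y; rewrite (cu (c (k%:A *: x + y)) (fun i => k * c x i + c y i)) // -hc.
  rewrite {1}(hc x) {1}(hc y) scaler_sumr -big_split /=; apply: eq_bigr => j _.
  by rewrite scalerA -scalerDl -scalerAl mul1r scalerA -scalerDl.
have [f hf] := choice (fun i => dual_surj (cl i)).
have xE x : x = \sum_i (ev (f i) x)%:A *: e i.
  by rewrite {1}(hc x); apply: eq_bigr => i _; rewrite hf.
have yE y : y = \sum_i (ev y (e i))%:A *: f i.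
  apply: dual_inj => x; rewrite dual_sum {1}(xE x) (klinear_sum (dual_klin y)).
  apply: eq_bigr => i _; rewrite dual_Z klinearZ //; [by rewrite mulrC|exact: dual_klin].
exists n, e, f; split=> //; split=> [y|a ha i]; first by split=> // _; exists (fun i => ev y (e i)).
have ce i' j : c (e i') j = (i' == j)%:R.
  rewrite (cu (c (e i')) (fun j => (i' == j)%:R)) // -hc.
  rewrite (bigD1 i') //= eqxx !scale1r big1 ?addr0 // => k ki.
  by rewrite eq_sym (negPf ki) !scale0r.
have := dual_0 (e i); rewrite -[X in ev X]ha dual_sum (bigD1 i) //= big1 ?addr0 => [|j ji].
  by rewrite [X in X = _]dual_Z hf ce eqxx mulr1.
by rewrite [LHS]dual_Z hf ce eq_sym (negPf ji) mulr0.
Qed.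

Lemma dual_dim : kdim [set: N] = kdim [set: M].
Proof.
have [n [e [f [he hf _ _]]]] := dual_basis.
by rewrite /kdim (dimS_basis he) (dimS_basis hf).
Qed.

Lemma dual_reflexive (F : N -> K) : klinear F -> exists x, forall n, ev n x = F n.
Proof.
move=> hF; have [n [e [f [_ _ _ yE]]]] := dual_basis.
exists (\sum_i (F (f i))%:A *: e i) => y.
rewrite (klinear_sum (dual_klin y)) [in RHS](yE y) (klinear_sum hF).
apply: eq_bigr => i _; rewrite !klinearZ //; [by rewrite mulrC|exact: dual_klin].
Qed.

Lemma dual_separates x : (forall n, ev n x = 0) -> x = 0.
Proof.
move=> h; have [n [e [f [_ _ xE _]]]] := dual_basis.
by rewrite (xE x) big1 // => i _; rewrite h !scale0r.
Qed.

Lemma dual_degree d : has_degree M d -> has_degree N d.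
Proof.
move=> hd y; apply/dual_comp => j x jd hx.
rewrite (_ : x = 0) ?klinear0 //; first exact: dual_klin.
by apply: (gr_disj (gm_grading M) hx (hd x)); apply/eqP.
Qed.

End DualTheory.

End Dual.

(** * Freeness and cofreeness over a local subalgebra *)
Lemma subspace_proj (K : fieldType) (V : lmodType K) (U : set V) :
  fd V -> submodule U -> exists p : V -> V,
    [/\ lin_on setT p, forall x, U (p x) & forall x, U x -> p x = x].
Proof.
case=> vT e; case: _ / e U => U /submodule_vsP[W ->].
exists (projv W); split=> [k u v _ _|x|x xW].
- exact: linearP.
- exact: memv_proj.
- exact: projv_id.
Qed.

Lemma kproj (K : fieldType) (A : algType K) (M : lmodType A) (U : set M) :
  fd (kmod M) -> ksub U -> exists p : M -> M,
    [/\ klin setT p, forall x, U (p x) & forall x, U x -> p x = x].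
Proof. exact: (@subspace_proj K (kmod M) U). Qed.

Section LocalAlgebra.
Variables (K : fieldType) (A : algType K) (R N : set A) (n : nat) (a : 'I_n -> A).

(** R is a subalgebra spanned by n elements a_i and N a nilpotent set of elements of R;
    in the application R is A^- or A^+ and N its augmentation ideal. *)
Record local_subalgebra : Prop := {
  loc_R : forall r, R r <-> exists c : 'I_n -> K, r = \sum_i c i *: a i;
  loc_1 : R 1;
  loc_M : forall r s, R r -> R s -> R (r * s);
  loc_NR : forall b, N b -> R b;
  loc_nil : exists k, forall s : seq A, size s = k -> (forall b, b \in s -> N b) ->
    \prod_(b <- s) b = 0
}.
Hypothesis hL : local_subalgebra.

Lemma loc_prod s : (forall b, b \in s -> N b) -> R (\prod_(b <- s) b).
Proof.
elim: s => [_|b s IH h]; first by rewrite big_nil; exact: (loc_1 hL).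
rewrite big_cons; apply: (loc_M hL); first by apply: (loc_NR hL); apply: h; rewrite inE eqxx.
by apply: IH => c cs; apply: h; rewrite inE cs orbT.
Qed.

Section Module.
Variables (M : lmodType A) (hM : fd (kmod M)).
Implicit Types U W Z : set M.

(** N U, the subspace spanned by the products. *)
Definition Nact U : set M := [set y | exists m (b : 'I_m -> A) (x : 'I_m -> M),
  (forall l, N (b l) /\ U (x l)) /\ y = \sum_l b l *: x l].

(** The part of U killed by N, that is the socle of U over R. *)
Definition Nsoc U : set M := U `&` [set x | forall b, N b -> b *: x = 0].

(** R W, since the a_i span R. *)
Definition Ract W : set M := [set y | exists x : 'I_n -> M,
  (forall i, W (x i)) /\ y = \sum_i a i *: x i].

(** dim U = n dim (U / N U), without subtraction: U is free over R of dimension n. *)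
Definition Nfree U : Prop := (kdim U + n * kdim (Nact U) = n * kdim U)%N.
(** dim U = n dim (soc U): U is cofree over R. *)
Definition Ncofree U : Prop := (kdim U = n * kdim (Nsoc U))%N.

Lemma Nact_in U b x : N b -> U x -> Nact U (b *: x).
Proof.
move=> hb hx; exists 1%N, (fun=> b), (fun=> x); split=> //.
by rewrite big_ord1.
Qed.

Lemma scaleK_comm k (c : A) (x : M) : k%:A *: (c *: x) = c *: (k%:A *: x).
Proof. by rewrite !scalerA -scalerAl mul1r -scalerAr mulr1. Qed.

Lemma klin_act (U : set M) c : klin U (fun x : M => c *: x).
Proof.
move=> k x y _ _.
change (c *: (k%:A *: (x : M) + (y : M)) = k%:A *: (c *: (x : M)) + c *: (y : M)).
by rewrite scalerDr scaleK_comm.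
Qed.

Lemma ksub_Nact U : ksub U -> ksub (Nact U).
Proof.
move=> hU; apply: ksub_intro.
- by exists 0%N, (fun=> 0), (fun=> 0); split=> [[]//|]; rewrite big_ord0.
- move=> _ _ [m [b [x [hx ->]]]] [m' [b' [x' [hx' ->]]]].
  exists (m + m')%N, (fun k => match split k with inl i => b i | inr j => b' j end),
    (fun k => match split k with inl i => x i | inr j => x' j end).
  split; first by move=> l; case: (split l).
  rewrite big_split_ord /=; congr (_ + _); apply: eq_bigr => i _.
    by rewrite (unsplitK (inl _ i)).
  by rewrite (unsplitK (inr _ i)).
- move=> k _ [m [b [x [hx ->]]]]; exists m, b, (fun l => k%:A *: x l); split.
    by move=> l; have [? ?] := hx l; split=> //; apply: ksub_Z.
  by rewrite scaler_sumr; apply: eq_bigr => l _; rewrite scaleK_comm.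
Qed.

Lemma Nact_sub U W : submodule W -> U `<=` W -> Nact U `<=` W.
Proof.
move=> hW UW y [m [b [x [hx ->]]]]; apply: (sub_sum hW) => l _.
by apply: (sub_Z hW); apply: UW; case: (hx l).
Qed.

Lemma Nact_mono U W : U `<=` W -> Nact U `<=` Nact W.
Proof.
move=> UW y [m [b [x [hx ->]]]]; exists m, b, x; split=> // l.
by have [? ?] := hx l; split=> //; apply: UW.
Qed.

Lemma ksub_Nsoc U : ksub U -> ksub (Nsoc U).
Proof.
move=> hU; apply: ksub_intro.
- by split; [exact: ksub_0 | move=> b _; rewrite scaler0].
- move=> x y [Ux hx] [Uy hy]; split; first exact: ksub_D.
  by move=> b hb; rewrite scalerDr hx ?hy ?addr0.
- move=> k x [Ux hx]; split; first exact: ksub_Z.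
  by move=> b hb; rewrite -scaleK_comm hx ?scaler0.
Qed.

Lemma ksub_Ract W : ksub W -> ksub (Ract W).
Proof.
move=> hW; apply: ksub_intro.
- by exists (fun=> 0); split; [move=> _; exact: ksub_0 | rewrite big1 // => i _; rewrite scaler0].
- move=> _ _ [x [hx ->]] [y [hy ->]]; exists (fun i => x i + y i).
  split; first by move=> i; apply: ksub_D.
  by rewrite -big_split; apply: eq_bigr => i _; rewrite scalerDr.
- move=> k _ [x [hx ->]]; exists (fun i => k%:A *: x i).
  split; first by move=> i; apply: ksub_Z.
  by rewrite scaler_sumr; apply: eq_bigr => i _; rewrite scaleK_comm.
Qed.

Lemma Ract_in W r x : ksub W -> R r -> W x -> Ract W (r *: x).
Proof.
move=> hW /(loc_R hL)[c ->] Wx; exists (fun i => (c i)%:A *: x).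
split; first by move=> i; apply: ksub_Z.
rewrite scaler_suml; apply: eq_bigr => i _.
by rewrite scalerA -scalerAr mulr1.
Qed.

Lemma kdim_Ract W : ksub W -> (kdim (Ract W) <= n * kdim W)%N.
Proof.
move=> hW; apply: (@kdim_cover _ _ _ M M hM hM n (fun i x => a i *: x)) => //.
- exact: ksub_Ract.
- by move=> i; exact: klin_act.
Qed.

(** Nakayama's lemma: substituting x = w + y repeatedly moves the remainder into longer
    and longer products of elements of N, which eventually vanish. *)
Lemma nakayama U W : submodule U -> ksub W -> W `<=` U ->
  (forall x, U x -> exists w y, [/\ W w, Nact U y & x = w + y]) -> U `<=` Ract W.
Proof.
move=> hU hW WU hx; have [k knil] := loc_nil hL.
have : forall j s, (size s + j = k)%N -> (forall b, b \in s -> N b) ->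
    forall x, U x -> Ract W ((\prod_(b <- s) b) *: x).
  elim=> [|j IH] s sz sN x Ux.
    rewrite addn0 in sz; rewrite knil // scale0r; exact: ksub_0 (ksub_Ract hW).
  have [w [_ [Ww [m [b [y [hy ->]]]] ->]]] := hx x Ux.
  rewrite scalerDr scaler_sumr; apply: (ksub_D (ksub_Ract hW)).
    by apply: Ract_in => //; exact: loc_prod.
  apply: (ksub_sum _ (ksub_Ract hW)) => l _; rewrite scalerA.
  have [hb Uy] := hy l; have := IH (rcons s (b l)) _ _ _ Uy.
  rewrite -cats1 big_cat big_seq1 /=; apply.
    by rewrite size_cat /= addn1 addSnnS.
  by move=> c; rewrite mem_cat inE => /orP[/sN //|/eqP ->].
move=> /(_ k [::] (add0n _)) h x Ux; have := h _ x Ux.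
by rewrite big_nil scale1r; apply.
Qed.

(** A complement W of N U in U satisfies U = R W by Nakayama's lemma. *)
Lemma head_ineq U : submodule U -> (kdim U + n * kdim (Nact U) <= n * kdim U)%N.
Proof.
move=> hU; have kU := ksub_submodule hU; have kN := ksub_Nact kU.
have [W [kW W0 WT]] := kcompl hM kN.
pose H := W `&` U; have kH : ksub H by exact: ksubI.
have NU : Nact U `<=` U by exact: Nact_sub.
have hx x : U x -> exists w y, [/\ H w, Nact U y & x = w + y].
  move=> Ux; have : setadd (Nact U) W x by rewrite WT.
  case=> y [w [Ny Ww e]]; exists w, y; split=> //; last by rewrite addrC.
  split=> //; have -> : w = x - y by rewrite e [y + w]addrC addrK.
  by apply: ksub_B => //; exact: NU.
have UR := nakayama hU kH (@subIsetr _ _ _) hx.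
have dU : kdim U = (kdim H + kdim (Nact U))%N.
  have eU : setadd H (Nact U) = U.
    apply/seteqP; split=> x; last by case/hx => w [y [? ? ->]]; exists w, y.
    by case=> w [y [[_ Uw] /NU Uy ->]]; apply: ksub_D.
  have := kdim_addI hM kH kN; rewrite eU => <-.
  have -> : H `&` Nact U = [set 0].
    apply/seteqP; split=> x; last by move=> ->; split; exact: ksub_0.
    by case=> -[Wx _] Nx; rewrite -W0.
  by rewrite kdim0 // addn0.
rewrite [in (n * kdim U)%N]dU mulnDr leq_add2r.
by apply: leq_trans (kdim_Ract kH); apply: kdim_le => //; exact: ksub_Ract.
Qed.

(** Project onto the socle by p: a nonzero x has a longest nonvanishing multiple by a
    product of elements of N, which lies in the socle, so some p (a_i x) is nonzero. *)
Lemma soc_ineq U : submodule U -> (kdim U <= n * kdim (Nsoc U))%N.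
Proof.
move=> hU; have kU := ksub_submodule hU; have kS := ksub_Nsoc kU.
have [p [pl pS pid]] := kproj hM kS.
apply: (@kdim_detect _ _ _ M M hM hM n (fun i x => p (a i *: x))) => //.
  move=> i k x y hx hy; rewrite -[LHS]/(p (a i *: (k *: x + y))) (klin_act (U := U)) //.
  exact: pl.
move=> x Ux hx; apply: contrapT => x0.
have [k knil] := loc_nil hL.
pose P j := `[< exists s : seq A, [/\ size s = j, forall b, b \in s -> N b
  & (\prod_(b <- s) b) *: x <> 0] >].
have P0 : exists j, P j.
  by exists 0%N; apply/asboolP; exists [::]; split=> //; rewrite big_nil scale1r.
have Pb j : P j -> (j <= k)%N.
  move=> /asboolP[s [sj sN sx]]; rewrite leqNgt; apply/negP => kj; apply: sx.
  rewrite -(cat_take_drop k s) big_cat /= knil ?mul0r ?scale0r //.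
    by rewrite size_take sj kj.
  by move=> b bs; apply: sN; exact: mem_take bs.
have [j /asboolP[s [sj sN sx]] jmax] := ex_maxnP P0 Pb.
apply: sx; rewrite -[LHS]pid.
  have /(loc_R hL)[c ->] := loc_prod sN.
  rewrite scaler_suml (eq_bigr (fun i => (c i)%:A *: (a i *: x))); last first.
    by move=> i _; rewrite scalerA -scalerAl mul1r.
  have p1 u v : p (u + v) = p u + p v.
    by have := pl 1 u v Logic.I Logic.I; rewrite !scale1r.
  have p0 : p 0 = 0 by apply: (addIr (p 0)); rewrite -p1 !add0r.
  have ps (I : Type) (r : seq I) (F : I -> M) : p (\sum_(i <- r) F i) = \sum_(i <- r) p (F i).
    exact: (big_morph p).
  rewrite ps big1 // => i _.
  have := pl (c i) (a i *: x) 0 I I; rewrite addr0 p0 addr0 => e.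
  by rewrite [LHS]e (hx i); exact: scaler0.
split; first exact: sub_Z.
move=> b hb; apply: contrapT => bx; suff /jmax : P j.+1 by rewrite ltnn.
apply/asboolP; exists (b :: s); split; first by rewrite /= sj.
  by move=> c; rewrite inE => /orP[/eqP -> //|]; exact: sN.
by rewrite big_cons -scalerA.
Qed.

End Module.
End LocalAlgebra.

Arguments ksub_Nact {K A N M U}.
Arguments ksub_Nsoc {K A N M U}.
Arguments Nact_sub {K A N M U W}.
Arguments Nact_mono {K A N M U W}.

Section Good.
Variables (K : fieldType) (A : algType K) (R N : set A) (n : nat) (a : 'I_n -> A).
Hypothesis hL : local_subalgebra R N a.
Notation Dfree := (Nfree N n).
Notation Dcofree := (Ncofree N n).
Notation NNact := (Nact N).
Notation NNsoc := (Nsoc N).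

Lemma img_Nact (M X : lmodType A) (W : set M) (f : M -> X) : submodule W -> lin_on W f ->
  f @` NNact W = NNact (f @` W).
Proof.
move=> hW hf.
have f0 := lin_on_0 hW hf.
have fD x y : W x -> W y -> f (x + y) = f x + f y.
  by move=> hx hy; have := hf 1 x y hx hy; rewrite !scale1r.
have fZ c x : W x -> f (c *: x) = c *: f x.
  by move=> hx; have := hf c x 0 hx (sub_0 hW); rewrite f0 !addr0.
have fs (m : nat) (g : 'I_m -> M) : (forall l, W (g l)) ->
    f (\sum_l g l) = \sum_l f (g l).
  elim: m g => [|m IH] g hg; first by rewrite !big_ord0.
  by rewrite !big_ord_recl fD ?IH //; apply: (sub_sum hW).
apply/seteqP; split=> y.
  case=> _ [m [b [x [hx ->]]] <-]; exists m, b, (fun l => f (x l)); split.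
    by move=> l; have [? ?] := hx l; split=> //; exists (x l).
  rewrite fs => [|l]; last by apply: (sub_Z hW); case: (hx l).
  by apply: eq_bigr => l _; rewrite fZ //; case: (hx l).
case=> m [b [x [hx ->]]].
have hz l : exists z, W z /\ f z = x l by have [_ [z ? ?]] := hx l; exists z.
have [z hz'] := choice hz; exists (\sum_l b l *: z l).
  by exists m, b, z; split=> // l; split; [case: (hx l) | case: (hz' l)].
rewrite fs => [|l]; last by apply: (sub_Z hW); case: (hz' l).
by apply: eq_bigr => l _; have [Wz <-] := hz' l; rewrite fZ.
Qed.

Lemma Nfree_le (M : lmodType A) (U : set M) : fd (kmod M) -> submodule U ->
  (n * kdim U <= kdim U + n * kdim (NNact U))%N -> Dfree U.
Proof.
move=> hM hU h; rewrite /Nfree; apply/eqP; rewrite eqn_leq h andbT.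
exact: (head_ineq hL hM hU).
Qed.

Lemma Ncofree_le (M : lmodType A) (U : set M) : fd (kmod M) -> submodule U ->
  (n * kdim (NNsoc U) <= kdim U)%N -> Dcofree U.
Proof.
move=> hM hU h; rewrite /Ncofree; apply/eqP; rewrite eqn_leq h andbT.
exact: (soc_ineq hL hM hU).
Qed.

Section Extension.
Variables (M X : lmodType A) (hM : fd (kmod M)) (hX : fd (kmod X)).
Variables (U W : set M) (hU : submodule U) (hW : submodule W) (UW : U `<=` W).
Variables (f : M -> X) (hf : lin_on W f) (fs : forall y, exists2 u, W u & f u = y)
  (fk : forall u, W u -> (f u = 0 <-> U u)).

Let fW : f @` W = setT.
Proof. by apply/seteqP; split=> // y _; have [u Wu <-] := fs y; exists u. Qed.

Let kerW Z : Z `<=` W -> Z `&` [set x | f x = 0] = Z `&` U.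
Proof.
move=> ZW; apply/seteqP; split=> x [Zx h]; split=> //; first by apply/fk => //; exact: ZW.
by apply/fk => //; exact: UW.
Qed.

Let klf Z : Z `<=` W -> klin Z f.
Proof. by move=> ZW k x y /ZW hx /ZW hy; exact: hf. Qed.

Let dimW : kdim W = (kdim [set: X] + kdim U)%N.
Proof.
rewrite (kdim_rank hM hX (ksub_submodule hW) (klf (@subset_refl _ _))) fW.
by rewrite kerW //; congr (_ + kdim _)%N; apply/setIidPr.
Qed.

(** Here and for summands, the defect n dim (U / N U) - dim U is nonnegative; it is
    subadditive on extensions and additive on direct sums. *)
Lemma Nfree_ext : Dfree U -> Dfree [set: X] -> Dfree W.
Proof.
rewrite /Nfree => gU gX; apply: Nfree_le => //.
have NW : NNact W `<=` W by exact: Nact_sub.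
have := kdim_rank hM hX (ksub_Nact (ksub_submodule hW)) (klf NW).
rewrite img_Nact // fW kerW // => dN.
have le : (kdim (NNact U) <= kdim (NNact W `&` U))%N.
  apply: kdim_le => //; [exact: ksub_Nact (ksub_submodule hU)| |].
    by apply: ksubI; [exact: ksub_Nact (ksub_submodule hW)|exact: ksub_submodule].
  by move=> x hx; split; [exact: Nact_mono UW x hx | exact: Nact_sub hx].
rewrite dN dimW; nia.
Qed.

Lemma Ncofree_ext : Dcofree U -> Dcofree [set: X] -> Dcofree W.
Proof.
rewrite /Ncofree => gU gX; apply: Ncofree_le => //.
have kS : ksub (NNsoc W) := ksub_Nsoc (ksub_submodule hW).
have SW : NNsoc W `<=` W by move=> x [].
have dS := kdim_rank hM hX kS (klf SW).
have e1 : NNsoc W `&` [set x | f x = 0] = NNsoc U.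
  rewrite kerW //; apply/seteqP; split=> x; first by case=> -[_ ?] ?.
  by case=> Ux ?; split=> //; split=> //; exact: UW.
have le : (kdim (f @` NNsoc W) <= kdim (NNsoc [set: X]))%N.
  apply: kdim_le => //; first exact: ksub_img (klf SW).
    exact: ksub_Nsoc (ksubT _).
  move=> _ [x [Wx hx] <-]; split=> // b hb.
  have f0 := lin_on_0 hW hf.
  have := hf b Wx (sub_0 hW); rewrite f0 !addr0 => <-.
  by rewrite hx.
rewrite dS e1 dimW gU {1}gX; nia.
Qed.

End Extension.

Lemma Nfree_0 (M : lmodType A) : fd (kmod M) -> Dfree [set (0 : M)].
Proof.
move=> hM; rewrite /Nfree; have -> : NNact [set (0 : M)] = [set 0].
  apply/seteqP; split; first by apply: Nact_sub => //; exact: submodule_0.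
  by move=> x ->; exact: ksub_0 (ksub_Nact (ksub0 M)).
by rewrite kdim0.
Qed.

Lemma Ncofree_0 (M : lmodType A) : fd (kmod M) -> Dcofree [set (0 : M)].
Proof.
move=> hM; rewrite /Ncofree; have -> : NNsoc [set (0 : M)] = [set 0].
  apply/seteqP; split; first by move=> x [].
  by move=> x ->; exact: ksub_0 (ksub_Nsoc (ksub0 M)).
by rewrite kdim0 // muln0.
Qed.

Section Summand.
Variables (M : lmodType A) (hM : fd (kmod M)) (U W : set M).
Hypotheses (hU : submodule U) (hW : submodule W) (UW0 : U `&` W = [set 0])
  (UWT : setadd U W = setT).

Let dimUW (X Y : set M) : ksub X -> ksub Y -> X `<=` U -> Y `<=` W ->
  kdim (setadd X Y) = (kdim X + kdim Y)%N.
Proof.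
move=> kX kY XU YW; rewrite -(kdim_addI hM kX kY).
have -> : X `&` Y = [set 0].
  apply/seteqP; split=> x; last by move=> ->; split; exact: ksub_0.
  by case=> /XU Ux /YW Wx; rewrite -UW0.
by rewrite kdim0 // addn0.
Qed.

Lemma Nfree_summand : Dfree [set: M] -> Dfree U.
Proof.
rewrite /Nfree -UWT => g.
have kU := ksub_submodule hU; have kW := ksub_submodule hW.
have e : NNact (setadd U W) = setadd (NNact U) (NNact W).
  apply/seteqP; split=> x.
    case=> m [b [y [hy ->]]]; apply: (ksub_sum _ (ksubD (ksub_Nact kU) (ksub_Nact kW))).
    move=> l _; have [hb [u [w [Uu Ww ->]]]] := hy l.
    by exists (b l *: u), (b l *: w); rewrite scalerDr; split=> //; exact: Nact_in.
  have kT : ksub (NNact (setadd U W)) := ksub_Nact (ksubD kU kW).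
  case=> y [z [hy hz ->]]; apply: (ksub_D kT).
    apply: Nact_mono hy => u Uu; exists u, 0; rewrite addr0; split=> //; exact: ksub_0.
  apply: Nact_mono hz => u Uu; exists 0, u; rewrite add0r; split=> //; exact: ksub_0.
rewrite e !dimUW // in g; try exact: ksub_Nact; try exact: Nact_sub.
have h1 := head_ineq hL hM hU; have h2 := head_ineq hL hM hW.
nia.
Qed.

Lemma Ncofree_summand : Dcofree [set: M] -> Dcofree U.
Proof.
rewrite /Ncofree -UWT => g.
have kU := ksub_submodule hU; have kW := ksub_submodule hW.
have e : NNsoc (setadd U W) = setadd (NNsoc U) (NNsoc W).
  apply/seteqP; split=> x.
    case=> -[u [w [Uu Ww ->]]] hx; exists u, w.
    have hb b : N b -> b *: u = 0 /\ b *: w = 0.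
      move=> /hx; rewrite scalerDr => /eqP; rewrite addr_eq0 => /eqP h.
      have u0 : b *: u = 0.
        have : (U `&` W) (b *: u).
          split; first exact: sub_Z.
          by rewrite h; apply: sub_N => //; exact: sub_Z.
        by rewrite UW0.
      by split=> //; apply/eqP; rewrite -oppr_eq0 -h u0.
    by split=> //; split=> // b /hb[].
  case=> u [w [[Uu hu] [Ww hw] ->]]; split; first by exists u, w.
  by move=> b hb; rewrite scalerDr hu // hw // addr0.
rewrite e !dimUW // in g; try exact: ksub_Nsoc; try by move=> x [].
have h1 := soc_ineq hL hM hU; have h2 := soc_ineq hL hM hW.
nia.
Qed.

End Summand.

Lemma Nfree_embed (M P : lmodType A) (f : {linear P -> M}) : fd (kmod M) -> fd (kmod P) ->
  injective f -> Dfree (f @` setT) -> Dfree [set: P].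
Proof.
move=> hM hP inj; rewrite /Nfree -img_Nact //; last exact: lin_on_lin.
have f0 (U : set P) x : U x -> f x = 0 -> x = 0 by move=> _ e; apply: inj; rewrite e linear0.
rewrite !(kdim_inj hP hM) //; try exact: klin_lin; try exact: f0.
exact: ksub_Nact (ksubT _).
Qed.

Lemma Ncofree_embed (M P : lmodType A) (f : {linear P -> M}) : fd (kmod M) -> fd (kmod P) ->
  injective f -> Dcofree (f @` setT) -> Dcofree [set: P].
Proof.
move=> hM hP inj; rewrite /Ncofree.
have -> : NNsoc (f @` setT) = f @` NNsoc setT.
  apply/seteqP; split=> x.
    case=> -[y _ <-] h; exists y => //; split=> // b hb; apply: inj.
    by rewrite linearZ /= h // linear0.
  by case=> y [_ h] <-; split=> [|b hb]; [exists y | rewrite -linearZ h ?linear0].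
have f0 (U : set P) x : U x -> f x = 0 -> x = 0 by move=> _ e; apply: inj; rewrite e linear0.
rewrite !(kdim_inj hP hM) //; try exact: klin_lin; try exact: f0.
exact: ksub_Nsoc (ksubT _).
Qed.

(** Since W is independent modulo N M, passing to M / Z lowers the dimension of the head
    by at least dim W, and the dimension by at most n dim W.  As M has no defect and
    M / Z has nonnegative defect, both bounds are attained. *)
Lemma Nfree_cut (M Q : lmodType A) (p : {linear M -> Q}) (W Z : set M) :
  fd (kmod M) -> fd (kmod Q) -> (forall y, exists x, p x = y) ->
  submodule Z -> (forall x, p x = 0 <-> Z x) ->
  ksub W -> W `<=` Z -> W `&` NNact setT = [set 0] ->
  (kdim Z <= n * kdim W)%N -> Dfree [set: M] ->
  kdim Z = (n * kdim W)%N /\ Dfree [set: Q].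
Proof.
move=> hM hQ ps hZ kp kW WZ W0 dZ; rewrite /Nfree => g.
have kZ := ksub_submodule hZ.
have kN : ksub (NNact [set: M]) by exact: ksub_Nact (ksubT _).
have pT : p @` setT = [set: GRing.Lmodule.sort Q].
  by apply/seteqP; split=> // y _; have [x <-] := ps y; exists x.
have kerp : [set x | p x = 0] = Z by apply/seteqP; split=> x /=; rewrite kp.
have dM := kdim_rank hM hQ (ksubT M) (klin_lin p).
rewrite pT kerp setTI in dM.
have dN := kdim_rank hM hQ kN (klin_lin p).
rewrite kerp img_Nact // ?pT in dN; last exact: lin_on_lin.
have hq : (kdim [set: Q] + n * kdim (NNact [set: Q]) <= n * kdim [set: Q])%N.
  exact: (head_ineq hL hQ (submodule_T Q)).
have e1 := kdim_addI hM kN kZ; have e2 := kdim_addI hM kN kW.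
rewrite setIC W0 kdim0 // addn0 in e2.
have le : (kdim (setadd (NNact [set: M]) W) <= kdim (setadd (NNact [set: M]) Z))%N.
  apply: kdim_le => //; [exact: ksubD|exact: ksubD|].
  by move=> x [y [z [? ? ->]]]; exists y, z; split=> //; exact: WZ.
have le' : (n * (kdim W + kdim (NNact [set: M] `&` Z)) <= n * kdim Z)%N.
  by rewrite leq_mul2l; apply/orP; right; lia.
have dM' := congr1 (muln n) dM; have dN' := congr1 (muln n) dN.
rewrite !mulnDr in dM' dN' le'.
split; rewrite ?/Nfree; lia.
Qed.

(** Dual to [Nfree_cut]: the kernel of f has a socle smaller by dim lam, hence loses at
    least n dim lam dimensions, which leaves no room for f not to be onto. *)
Lemma Ncofree_cut (M NN : lmodType A) (B : algType K) (lam : lmodType B)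
    (f : {linear M -> NN}) (pi : M -> lam) :
  fd (kmod M) -> fd (kmod NN) -> fd (kmod lam) -> klin setT pi ->
  (forall x, NNsoc setT x -> (f x = 0 <-> pi x = 0)) ->
  pi @` (NNsoc setT) = setT ->
  kdim [set: NN] = (n * kdim [set: lam])%N -> Dcofree [set: M] ->
  (forall y, exists x, f x = y) /\ Dcofree [set x | f x = 0].
Proof.
move=> hM hN hl kpi hs pis dN; rewrite /Ncofree => g.
have kS : ksub (NNsoc [set: M]) by exact: ksub_Nsoc (ksubT _).
have hk : submodule [set x | f x = 0].
  by rewrite -[X in submodule X]setTI; apply: submodule_ker => //; exact: lin_on_lin.
have dM : kdim [set: M] = (kdim (f @` setT) + kdim [set x | f x = 0%R])%N.
  by have := kdim_rank hM hN (ksubT M) (klin_lin f); rewrite setTI.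
have kpiS : klin (NNsoc [set: M]) pi by move=> k x y _ _; exact: kpi.
have dS : kdim (NNsoc [set: M])
    = (kdim [set: lam] + kdim (NNsoc [set: M] `&` [set x | pi x = 0%R]))%N.
  by have := kdim_rank hM hl kS kpiS; rewrite pis.
have eS : NNsoc [set: M] `&` [set x | pi x = 0] = NNsoc [set x | f x = 0].
  apply/seteqP; split=> x.
    by case=> hx p0; split; [apply/hs | case: hx].
  by case=> fx hx; split=> //; apply/hs.
rewrite eS in dS.
have hq := soc_ineq hL hM hk.
have kI : ksub (f @` setT) by apply: ksub_img; [exact: ksubT | exact: klin_lin].
have le := kdim_le hN kI (ksubT _) (fun x _ => I).
have dS' := congr1 (muln n) dS; rewrite !mulnDr in dS'.
have eI : kdim (f @` setT) = kdim [set: NN] by lia.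
split; last by rewrite /Ncofree; lia.
move=> y; have : (f @` setT) y; last by case=> x _ <-; exists x.
by rewrite (kdim_eq hN kI (ksubT _) _ _) // eI.
Qed.

End Good.

(** * Degree shifts and nilpotency of the positive part *)
Section GalgebraMore.
Variables (K : fieldType) (A : algType K) (gr : int -> set A).
Hypothesis hA : galgebra gr.

Lemma fd_regular : fd (kmod (A^o : lmodType A)).
Proof.
apply: (@kfd_fingen _ _ _ hA (A^o : lmodType A) 1 (fun=> 1)) => x.
by exists (fun=> x); rewrite big_ord1 /GRing.scale /= mulr1.
Qed.

Section DegreeShift.
Variables (M : gmod gr) (s : int).
Let comp (i : int) : set (gm_module M) := gm_comp M (i - s).

Lemma gshift_grading : grading comp.
Proof.
have hg := gm_grading M; split=> [i|i x y|x|t f ut hf e i it].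
- exact: (gr0 hg).
- exact: (@grB _ _ hg).
- have [t [ut _ xE]] := gpr_supp hg x.
  exists [seq j + s | j <- t], (fun i => gpr (gm_comp M) (i - s) x); split.
    by move=> i; exact: (gpr_in hg).
  by rewrite big_map {1}xE; apply: eq_bigr => j _; rewrite addrK.
- case: hg => _ _ _ /(_ [seq j - s | j <- t] (fun j => f (j + s))) h.
  rewrite -[i](subrK s); apply: h.
  + by rewrite map_inj_uniq //; exact: addIr.
  + by move=> j; have := hf (j + s); rewrite /comp /= addrK.
  + by rewrite big_map; under eq_bigr do rewrite subrK.
  + exact: map_f.
Qed.

Lemma gshift_act i j a x : gr i a -> comp j x -> comp (i + j) (a *: x).
Proof. by rewrite /comp /= -addrA; apply: (gm_act (g := M)). Qed.

Definition gshift : gmod gr := mkgmod gshift_grading gshift_act (gm_fd hA M).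

End DegreeShift.

Definition regular : gmod gr :=
  mkgmod (V := A^o) (galg_grading hA) (galg_M hA) fd_regular.

Definition shiftA (s : int) : gmod gr := gshift regular s.

Lemma galgebra_supp : exists s : seq int, uniq s /\ forall i a, i \notin s -> gpr gr i a = 0.
Proof.
by have [s [us s0 _]] := gm_supp hA regular; exists s; split=> // i a; exact: s0.
Qed.

Definition lowdeg (k : int) (x : A) := forall i, i < k -> gpr gr i x = 0.

Lemma lowdegM k l x y : lowdeg k x -> lowdeg l y -> lowdeg (k + l) (x * y).
Proof.
have hg := galg_grading hA.
move=> hx hy i ikl; have [s [us _ xE]] := gpr_supp hg x.
rewrite xE mulr_suml gpr_sum // big1 // => j _.
rewrite -[i](subrK j) addrC gprM //; last exact: gpr_in.
case: (ltP j k) => jk; first by rewrite hx // mul0r.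
by rewrite hy ?mulr0 // ltrBlDl; apply: (lt_le_trans ikl); rewrite lerD2r.
Qed.

(** A product of k elements of positive degree lives in degrees >= k, and only finitely
    many degrees occur in A. *)
Lemma lowdeg_nil : exists k, forall s : seq A, size s = k ->
  (forall b, b \in s -> lowdeg 1 b) -> \prod_(b <- s) b = 0.
Proof.
have hg := galg_grading hA.
have [t [ut t0]] := galgebra_supp.
pose D := (\sum_(i <- t) `|i|)%N.
have tD i : i \in t -> (i <= D%:Z)%R.
  move=> it; apply: (le_trans (lez_abs i)).
  rewrite lez_nat /D (bigD1_seq i) //=; exact: leq_addr.
exists D.+2 => s ss hs; apply: (gpr_eq0 hg) => i.
have : forall s : seq A, (forall b, b \in s -> lowdeg 1 b) ->
    lowdeg (size s)%:Z (\prod_(b <- s) b).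
  elim=> [_|b r IH h].
    rewrite big_nil => j j0; apply: (gpr_neq hg (galg_1 hA)).
    by rewrite lt_eqF.
  rewrite big_cons -[size _]/(1 + size r)%N PoszD; apply: lowdegM.
    by apply: h; rewrite inE eqxx.
  by apply: IH => c cr; apply: h; rewrite inE cr orbT.
move=> /(_ s hs) h; case: (boolP (i \in t)) => [it|/t0 -> //].
apply: h; rewrite ss; apply: (le_lt_trans (tD i it)).
by rewrite ltz_nat.
Qed.

(** Reversing the sign of the degrees transfers statements about A^+ to A^-. *)
Lemma galgebra_neg : galgebra (fun i => gr (- i)).
Proof.
have hg := galg_grading hA; split.
- exact: (galg_fd hA).
- split=> [i|i x y|x|s f us hf e i si].
  + exact: (gr0 hg).
  + exact: (@grB _ _ hg).
  + have [t [ut _ xE]] := gpr_supp hg x.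
    exists [seq - j | j <- t], (fun i => gpr gr (- i) x); split.
      by move=> i; exact: (gpr_in hg).
    by rewrite big_map {1}xE; apply: eq_bigr => j _; rewrite opprK.
  + case: hg => _ _ _ /(_ [seq - j | j <- s] (fun j => f (- j))) h.
    rewrite -[i]opprK; apply: h.
    * by rewrite map_inj_uniq //; exact: oppr_inj.
    * by move=> j; have := hf (- j); rewrite opprK.
    * by rewrite big_map; under eq_bigr do rewrite opprK.
    * exact: map_f.
- by rewrite oppr0; exact: (galg_1 hA).
- by move=> i k a; apply: (galg_Z hA).
- by move=> i j a b; rewrite opprD; apply: (galg_M hA).
Qed.

Lemma gpr_neg i x : gpr (fun i => gr (- i)) i x = gpr gr (- i) x.
Proof.
have hg := galg_grading hA; have hn := galg_grading galgebra_neg.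
have [t [ut _ xE]] := gpr_supp hg x.
rewrite {1}xE gpr_sum //.
have E j : gpr (fun i => gr (- i)) i (gpr gr j x) = if j == - i then gpr gr j x else 0.
  have h : gr (- - j) (gpr gr j x) by rewrite opprK; exact: gpr_in.
  rewrite (gpr_hom hn h).
  by rewrite -(inj_eq oppr_inj) opprK eq_sym.
under eq_bigr do rewrite E.
have := congr1 (gpr gr (- i)) xE; rewrite gpr_sum // => ->.
apply: eq_bigr => j _; rewrite (gpr_hom hg (gpr_in hg j x)) eq_sym.
by case: eqP => // <-.
Qed.

Lemma galgebra_op : galgebra (op_grading gr).
Proof.
have [h1 h2 h3 h4 h5] := galgebra_neg; split=> //.
by move=> i j a b ha hb; rewrite addrC; exact: h5 hb ha.
Qed.

Lemma gprZ i k (x : A) : gpr gr i (k *: x) = k *: gpr gr i x.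
Proof.
have hg := galg_grading hA.
have fB : {morph (fun b : A => k *: b) : x y / x - y} by move=> u v; rewrite scalerBr.
have := @gpr_morph _ _ _ _ hg hg (mkadd fB) 0; rewrite -[i in LHS]addr0; apply=> j y hy /=.
by rewrite addr0; apply: (galg_Z hA).
Qed.

End GalgebraMore.

(** * The triangular decomposition *)
Section Triangular.
Variables (K : fieldType) (A : falgType K) (gr : int -> {vspace A}).
Variables (Am T Ap : {aspace A}).
Hypothesis hgr : graded_algebra gr.
Hypothesis htri : triangular_decomposition gr Am T Ap.
Notation gs := (alg_grading gr).

Lemma tri_galgebra : galgebra gs.
Proof.
case: hgr => h1 h2 h3; split=> //.
- by exists A.
- by move=> i k a; rewrite /alg_grading /vs_set /=; apply: memvZ.
Qed.
Let hA := tri_galgebra.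
Let hg := galg_grading hA.

Lemma tri_1T : 1 \in T. Proof. by case: (tri_T_graded htri). Qed.
Lemma tri_1Am : 1 \in Am. Proof. by case: (tri_Am_graded htri). Qed.
Lemma tri_1Ap : 1 \in Ap. Proof. by case: (tri_Ap_graded htri). Qed.

Lemma vsval1 : vsval (1 : subvs_of T) = 1 :> A.
Proof. by have := tri_1T; rewrite -algid_eq1 => /eqP. Qed.
Lemma tri_T0 t : t \in T -> gs 0 t.
Proof. by move=> tT; exact: (subvP (tri_T_degree htri)). Qed.

Lemma vs_gpr (B : {aspace A}) : graded_subalgebra gr B ->
  forall i b, b \in B -> gpr gs i b \in B.
Proof.
case=> _ h i b hb; have hsub := submodule_vs B.
have := (graded_subsetP hg (sub_0 hsub) (fun x y => @sub_D _ _ _ hsub x y)).1 h b i.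
exact.
Qed.

Lemma tri_Ap_gpr i z : z \in Ap -> gpr gs i z \in Ap.
Proof. exact: vs_gpr (tri_Ap_graded htri) i z. Qed.
Lemma tri_Am_gpr i z : z \in Am -> gpr gs i z \in Am.
Proof. exact: vs_gpr (tri_Am_graded htri) i z. Qed.

Lemma tri_Ap_low z : z \in Ap -> lowdeg gs 0 z.
Proof.
move=> hz i i0; apply/eqP; rewrite -memv0 -(tri_Ap_degree htri i0) memv_cap.
by rewrite tri_Ap_gpr //; exact: (gpr_in hg).
Qed.
Lemma tri_Am_high z : z \in Am -> forall i, 0 < i -> gpr gs i z = 0.
Proof.
move=> hz i i0; apply/eqP; rewrite -memv0 -(tri_Am_degree htri i0) memv_cap.
by rewrite tri_Am_gpr //; exact: (gpr_in hg).
Qed.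

(** On A^+ and A^-, whose degree 0 part is K, this is the augmentation: the coordinate on
    1 of the component of degree 0. *)
Definition eps (z : A) : K := coord [tuple (1 : A)] ord0 (gpr gs 0 z).

Lemma eps_lin : linear (eps : A -> K^o).
Proof. by move=> k x y; rewrite /eps gprD // gprZ // linearP. Qed.

Lemma epsE z : gpr gs 0 z \in 1%VS -> gpr gs 0 z = (eps z)%:A.
Proof.
move=> h; rewrite /eps {1}(@coord_span _ _ 1 [tuple (1 : A)] (gpr gs 0 z)).
  by rewrite big_ord1.
by rewrite span_seq1.
Qed.

Lemma eps_Ap z : z \in Ap -> gpr gs 0 z = (eps z)%:A.
Proof.
move=> hz; apply: epsE; rewrite -(tri_Ap0 htri) memv_cap tri_Ap_gpr //.
exact: (gpr_in hg).
Qed.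
Lemma eps_Am z : z \in Am -> gpr gs 0 z = (eps z)%:A.
Proof.
move=> hz; apply: epsE; rewrite -(tri_Am0 htri) memv_cap tri_Am_gpr //.
exact: (gpr_in hg).
Qed.

Lemma gpr_1 : gpr gs 0 1 = 1. Proof. exact: gpr_id hg _ _ (galg_1 hA). Qed.

Lemma eps1 : eps 1 = 1.
Proof.
have := eps_Ap tri_1Ap; rewrite gpr_1 -{1}[1]scale1r => /eqP.
rewrite -subr_eq0 -scalerBl scaler_eq0 oner_eq0 orbF subr_eq0.
by move/eqP.
Qed.

Lemma gpr_K k : gpr gs 0 (k%:A) = k%:A :> A.
Proof. by rewrite gprZ // gpr_1. Qed.

Definition Npos : set A := [set z | z \in Ap /\ gpr gs 0 z = 0].
Definition Nneg : set A := [set z | z \in Am /\ gpr gs 0 z = 0].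

Lemma vbasis_span (B : {vspace A}) r : r \in B <->
  exists c : 'I_(\dim B) -> K, r = \sum_i c i *: (vbasis B)`_i.
Proof. exact: (is_kbasis_vbasis B).1. Qed.

Lemma local_Ap : local_subalgebra (vs_set Ap) Npos (fun i : 'I_(\dim Ap) => (vbasis Ap)`_i).
Proof.
split.
- exact: vbasis_span.
- exact: tri_1Ap.
- by move=> r s; exact: memvM.
- by move=> b [].
- have [k hk] := lowdeg_nil hA; exists k => s ss hs; apply: hk => // b /hs [hb b0] i i1.
  have [->//|i0] : i = 0 \/ i < 0 by lia.
  exact: tri_Ap_low.
Qed.

Lemma local_Am : local_subalgebra (vs_set Am) Nneg (fun i : 'I_(\dim Am) => (vbasis Am)`_i).
Proof.
split.
- exact: vbasis_span.
- exact: tri_1Am.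
- by move=> r s; exact: memvM.
- by move=> b [].
- have [k hk] := lowdeg_nil (galgebra_neg hA); exists k => s ss hs.
  apply: hk => // b /hs [hb b0] i i1; rewrite gpr_neg //.
  have [->|i0] : i = 0 \/ i < 0 by lia.
    by rewrite oppr0.
  by apply: tri_Am_high => //; rewrite oppr_gt0.
Qed.

(** Elements of a product of subspaces are handled through their generating products. *)
Lemma prodv_ind (U V : {vspace A}) (P : A -> Prop) :
  P 0 -> (forall x y, P x -> P y -> P (x + y)) -> (forall k x, P x -> P (k *: x)) ->
  (forall u v, u \in U -> v \in V -> P (u * v)) -> forall x, x \in (U * V)%VS -> P x.
Proof.
move=> P0 PD PZ PM.
have hP : submodule (P : set A) by split=> // k u v hu hv; apply: PD => //; apply: PZ.
have [W PW] := submodule_vsP hP.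
have PWE x : P x <-> x \in W by rewrite -[x \in W : Prop]/(vs_set W x) -PW.
move=> x hx; apply/PWE; move: x hx; apply/subvP/prodvP => u v hu hv.
by apply/PWE; apply: PM.
Qed.

(** The identity and a projection onto A^- T A^+ agree on all products xyz, hence are
    equal by the uniqueness in the universal property. *)
Lemma tri_full : (Am * T * Ap)%VS = fullv.
Proof.
pose beta (x : subvs_of Am) (y : subvs_of T) (z : subvs_of Ap) : A :=
  vsval x * vsval y * vsval z.
have hb : trilinear beta.
  split=> [y z|x z|x y] k u v; rewrite /beta linearP.
  - by rewrite !mulrDl -!scalerAl.
  - by rewrite mulrDr mulrDl -scalerAr -scalerAl.
  - by rewrite mulrDr -scalerAr.
have [h [_ hu]] := tri_mult htri hb.
pose W := (Am * T * Ap)%VS.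
have idl : linear (@id A) by [].
have pl : linear (projv W) by move=> k u v; exact: linearP.
have e1 : mklin idl =1 h by apply: hu.
have e2 : mklin pl =1 h.
  by apply: hu => x y z; rewrite /= projv_id // !memv_mul ?subvsP.
apply/vspaceP => x; rewrite memvf -[x]/(mklin idl x) e1 -e2 /=.
exact: memv_proj.
Qed.

Lemma tri_ind (P : A -> Prop) :
  (forall x y, P x -> P y -> P (x + y)) -> (forall k x, P x -> P (k *: x)) ->
  (forall x y z, x \in Am -> y \in T -> z \in Ap -> P (x * y * z)) -> forall c, P c.
Proof.
move=> PD PZ PM c; have P0 : P 0.
  by rewrite -(scale0r (1 * 1 * 1)); apply: PZ; apply: PM; [exact: tri_1Am|exact: tri_1T|exact: tri_1Ap].
have : c \in (Am * T * Ap)%VS by rewrite tri_full memvf.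
apply: prodv_ind => // u z hu hz; move: u hu.
apply: prodv_ind => [|x y|k x|x y hx hy].
- by rewrite mul0r.
- by rewrite mulrDl; exact: PD.
- by rewrite -scalerAl; exact: PZ.
- exact: PM.
Qed.

Notation n := (\dim Am).
Notation m := (\dim T).
Notation p := (\dim Ap).

Lemma tri_dim : \dim {:A} = (n * m * p)%N.
Proof.
apply/eqP; rewrite eqn_leq; apply/andP; split.
  rewrite -tri_full; apply: (leq_trans (dim_prodv _ _)).
  by rewrite leq_mul2r; apply/orP; right; exact: dim_prodv.
pose I : finType := ('I_n * 'I_m * 'I_p)%type.
pose beta (x : subvs_of Am) (y : subvs_of T) (z : subvs_of Ap) : {ffun I -> K^o} :=
  [ffun i : I => coord (vbasis Am) i.1.1 (vsval x) * coord (vbasis T) i.1.2 (vsval y)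
     * coord (vbasis Ap) i.2 (vsval z)].
have hb : trilinear beta.
  split=> [y z|x z|x y] k u v; apply/ffunP => i; rewrite /beta !ffunE !linearP /=.
  - by rewrite -[RHS]/(k * _ + _) !mulrDl !mulrA.
  - by rewrite -[RHS]/(k * _ + _) mulrDr mulrDl mulrCA !mulrA.
  - by rewrite -[RHS]/(k * _ + _) mulrDr mulrCA.
have [h [hE _]] := tri_mult htri hb.
have hs : limg (linfun h) = fullv.
  apply/eqP; rewrite eqEsubv subvf /=; apply/subvP => f _.
  have -> : f = \sum_i (f i) *: [ffun j => (j == i)%:R : K^o].
    apply/ffunP => j; rewrite sum_ffunE (bigD1 j) //= !ffunE eqxx.
    rewrite [X in X + _]mulr1 big1 ?addr0 // => i ij.
    by rewrite !ffunE eq_sym (negPf ij) scaler0.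
  apply: memv_suml => i _; apply: memvZ.
  have ha (B : {vspace A}) (l : 'I_(\dim B)) : (vbasis B)`_l \in B.
    by rewrite vbasis_mem // mem_nth ?size_tuple.
  apply/memv_imgP; exists (vsval (Subvs (ha Am i.1.1)) * vsval (Subvs (ha T i.1.2))
    * vsval (Subvs (ha Ap i.2))); first exact: memvf.
  rewrite lfunE hE; apply/ffunP => j; rewrite !ffunE /=.
  rewrite !coord_free ?(basis_free (vbasisP _)) //.
  case: i j => [[i1 i2] i3] [[j1 j2] j3] /=; rewrite -!natrM !mulnb.
  by rewrite [in LHS]eq_sym.
have := limg_ker_dim (linfun h) fullv; rewrite hs => <-.
apply: leq_trans (leq_addl _ _); rewrite dimvf /dim /= /I !card_prod !card_ord.
by rewrite muln1.
Qed.

End Triangular.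

Section TriangularCoordinates.
Variables (K : fieldType) (A : falgType K) (gr : int -> {vspace A}).
Variables (Am T Ap : {aspace A}).
Hypothesis hgr : graded_algebra gr.
Hypothesis htri : triangular_decomposition gr Am T Ap.
Notation gs := (alg_grading gr).
Notation S := (subvs_of T).
Notation Bp := (vs_set (Ap * T)%VS).
Notation Bm := (vs_set (Am * T)%VS).
Notation iotaT := (fun t : S => vsval t).
Notation iotaTc := (fun t : S^c => (vsval (t : S) : A^c)).
Let hA := tri_galgebra hgr.
Let hg := galg_grading hA.
Let hAc := galgebra_op hA.

Lemma T_galgebra : galgebra (@sub_grading K A gr T).
Proof.
have h0 (t : S) : vsval t \in gr 0 by exact: (tri_T0 htri (subvsP t)).
have hne (i : int) (t : S) : i != 0 -> vsval t \in gr i -> t = 0.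
  by move=> i0 ti; apply: subvs_inj; exact: (gr_disj hg ti (h0 t)).
split.
- by exists S.
- split=> [i|i x y|x|s f us hf e i si].
  + exact: (gr0 hg).
  + exact: (@grB _ _ hg).
  + exists [:: 0], (fun i => if i == 0 then x else 0); split; last by rewrite big_seq1.
    by move=> i; case: eqP => [->|_]; [exact: h0 | exact: (gr0 hg)].
  + case: (eqVneq i 0) => [i0|/hne]; last by apply; exact: hf.
    move: e; rewrite (bigD1_seq i) //= big1 ?addr0 // => j ji.
    by apply: (hne j _ _ (hf j)); rewrite i0 in ji.
- exact: h0.
- by move=> i k a; rewrite /sub_grading /=; exact: memvZ.
- move=> i j a b; rewrite /sub_grading /=; exact: (galg_M hA).
Qed.

Lemma prodv_gpr (U V : {vspace A}) :
  (forall i u, u \in U -> gpr gs i u \in U) -> (forall v, v \in V -> gs 0 v) ->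
  forall i b, b \in (U * V)%VS -> gpr gs i b \in (U * V)%VS.
Proof.
move=> hU hV i; apply: (prodv_ind (P := fun b => gpr gs i b \in (U * V)%VS)) => [|x y hx hy|k x hx|u v hu hv].
- by rewrite gpr0 // mem0v.
- by rewrite gprD // memvD.
- by rewrite gprZ // memvZ.
- rewrite -[i]addr0 (gprMr hA) ?memv_mul //; [exact: hU | exact: hV].
Qed.

Lemma Bp_low b : b \in (Ap * T)%VS -> lowdeg gs 0 b.
Proof.
move: b; apply: (prodv_ind (P := lowdeg gs 0)) => [|x y hx hy|k x hx|u v hu hv] i i0.
- by rewrite gpr0.
- by rewrite gprD // hx ?hy ?addr0.
- by rewrite gprZ // hx ?scaler0.
- rewrite -[i]addr0 (gprMr hA) ?(tri_Ap_low hgr htri hu) ?mul0r //.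
  exact: (tri_T0 htri hv).
Qed.

Lemma Bm_high b : b \in (Am * T)%VS -> forall i, 0 < i -> gpr gs i b = 0.
Proof.
move: b; apply: (prodv_ind (P := fun b => forall i, 0 < i -> gpr gs i b = 0)) => [|x y hx hy|k x hx|u v hu hv] i i0.
- by rewrite gpr0.
- by rewrite gprD // hx ?hy ?addr0.
- by rewrite gprZ // hx ?scaler0.
- rewrite -[i]addr0 (gprMr hA) ?(tri_Am_high hgr htri hu) ?mul0r //.
  exact: (tri_T0 htri hv).
Qed.

Lemma mem_mul1r (U V : {vspace A}) x : 1 \in V -> x \in U -> x \in (U * V)%VS.
Proof. by move=> h1 hx; rewrite -[x]mulr1 memv_mul. Qed.
Lemma mem_mul1l (U V : {vspace A}) x : 1 \in U -> x \in V -> x \in (U * V)%VS.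
Proof. by move=> h1 hx; rewrite -[x]mul1r memv_mul. Qed.

Let vs1 : vsval (1 : S) = 1 :> A := vsval1 htri.

Lemma vsvalK k : vsval (k%:A : S) = k%:A :> A.
Proof. by rewrite linearZ; congr (_ *: _); exact: vs1. Qed.

Lemma Bp_mul : (Ap * T * (Ap * T))%VS = (Ap * T)%VS.
Proof.
rewrite -prodvA [(T * (Ap * T))%VS]prodvA -(tri_ApT htri).
by rewrite -prodvA prodv_id prodvA prodv_id.
Qed.
Lemma Bm_mul : (Am * T * (Am * T))%VS = (Am * T)%VS.
Proof.
rewrite -prodvA [(T * (Am * T))%VS]prodvA -(tri_AmT htri).
by rewrite -prodvA prodv_id prodvA prodv_id.
Qed.

Let vD (s t : S) : vsval (s + t) = vsval s + vsval t :> A. Proof. by []. Qed.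
Let vZ k (s : S) : vsval (k *: s) = k *: vsval s :> A. Proof. by []. Qed.
Let v0 : vsval (0 : S) = 0 :> A. Proof. by []. Qed.

Lemma ind_data_A : induction_data gs iotaT Bp.
Proof.
split.
- by move=> s t; rewrite linearB.
- by [].
- exact: vsvalK.
- by move=> s; exact: (tri_T0 htri (subvsP s)).
- by move=> s; apply: mem_mul1l (subvsP s); exact: tri_1Ap htri.
- by move=> b c; exact: memvB.
- by move=> b c hb hc; rewrite /vs_set /= -Bp_mul memv_mul.
- move=> i b; apply: prodv_gpr => [j u|v]; first exact: (tri_Ap_gpr hgr htri).
  exact: (tri_T0 htri).
Qed.

Lemma gpr_op i (x : A) : gpr (op_grading gs) i x = gpr gs (- i) x.
Proof. exact: (gpr_neg hA). Qed.

Lemma ind_data_Ac : induction_data (op_grading gs) iotaTc (Bm : set A^c).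
Proof.
split.
- by move=> s t; exact: (linearB (vsval : S -> A)).
- by [].
- exact: vsvalK.
- by move=> s; rewrite /op_grading oppr0; exact: (tri_T0 htri (subvsP _)).
- by move=> s; apply: mem_mul1l (subvsP _); exact: tri_1Am htri.
- by move=> b c; exact: memvB.
- by move=> b c hb hc; rewrite /vs_set /= -Bm_mul; exact: memv_mul hc hb.
- move=> i b hb; rewrite [gpr _ _ _]gpr_op; move: b hb.
  apply: prodv_gpr => [j u|v]; first exact: (tri_Am_gpr hgr htri).
  exact: (tri_T0 htri).
Qed.

Notation n := (\dim Am).
Notation p := (\dim Ap).

Lemma nzA a : nonzero_degree_part gs a <-> gpr gs 0 a = 0.
Proof. exact: nzP hA a. Qed.
Lemma nzAc (a : A) : nonzero_degree_part (op_grading gs) (a : A^c) <-> gpr gs 0 a = 0.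
Proof. by rewrite (nzP hAc) [gpr _ _ _]gpr_op oppr0. Qed.

Lemma nz_low1 b : b \in (Ap * T)%VS -> gpr gs 0 b = 0 -> lowdeg gs 1 b.
Proof.
move=> hb b0 i i1; have [->//|i0] : i = 0 \/ i < 0 by lia.
exact: Bp_low.
Qed.

(** The coordinates come from the decomposition: x y z is sent to the coordinate of x in a
    basis of A^-, times the augmentation of z, times y.  They kill A (B^+)_{>0} because
    B^+ = A^+ T = T A^+. *)
Lemma coordinates_A : exists q : 'I_n -> A -> S,
  coordinates gs iotaT Bp (fun i : 'I_n => (vbasis Am)`_i) q /\
  forall i x, x \in Am -> q i x = (coord (vbasis Am) i x)%:A.
Proof.
pose beta (x : subvs_of Am) (y : S) (z : subvs_of Ap) : {ffun 'I_n -> S} :=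
  [ffun i => (coord (vbasis Am) i (vsval x) * eps gr (vsval z)) *: y].
have hb : trilinear beta.
  split=> [y z|x z|x y] k u v; apply/ffunP => i; rewrite /beta !ffunE.
  - by rewrite !linearP /= mulrDl scalerDl -mulrA -scalerA.
  - by rewrite scalerDr !scalerA mulrC.
  - have e : eps gr (k *: vsval u + vsval v) = k * eps gr (vsval u) + eps gr (vsval v).
      exact: (eps_lin hgr k (vsval u) (vsval v)).
    by rewrite [vsval (k *: u + v)]linearP /= e mulrDr scalerDl mulrCA scalerA.
have [h [hE _]] := tri_mult htri hb.
pose q (i : 'I_n) (c : A) : S := h c i.
have qD i x y : q i (x + y) = q i x + q i y by rewrite /q linearD ffunE.
have qZ i k x : q i (k *: x) = k *: q i x by rewrite /q linearZ ffunE.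
have q0 i : q i 0 = 0 by rewrite /q linear0 ffunE.
have qE i x y z : x \in Am -> y \in T -> z \in Ap ->
    vsval (q i (x * y * z)) = (coord (vbasis Am) i x * eps gr z) *: y.
  move=> hx hy hz; have := hE (Subvs hx) (Subvs hy) (Subvs hz); rewrite /q /= => ->.
  by rewrite ffunE linearZ.
have qG i x y w : x \in Am -> y \in T -> w \in (T * Ap)%VS ->
    vsval (q i (x * y * w)) = coord (vbasis Am) i x *: (y * gpr gs 0 w).
  move=> hx hy; move: w; apply: (prodv_ind (P := fun w => vsval (q i (x * y * w))
    = coord (vbasis Am) i x *: (y * gpr gs 0 w))) => [|u v hu hv|k u hu|t z ht hz].
  - by rewrite mulr0 q0 gpr0 // mulr0 scaler0 v0.
  - by rewrite mulrDr qD vD hu hv gprD // mulrDr scalerDr.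
  - rewrite -scalerAr qZ vZ hu gprZ // -scalerAr.
    by rewrite !scalerA mulrC.
  - rewrite mulrA -[x * y * t]mulrA qE ?memvM // -[0 in RHS]addr0 (gprM hA) //; last first.
      exact: (tri_T0 htri ht).
    by rewrite (eps_Ap hgr htri hz) -!scalerAr mulr1 scalerA.
have TAp w : w \in (Ap * T)%VS -> w \in (T * Ap)%VS by rewrite (tri_ApT htri).
have T1 := tri_1T htri; have Am1 := tri_1Am htri; have Ap1 := tri_1Ap htri.
have qAm i x : x \in Am -> q i x = (coord (vbasis Am) i x)%:A.
  move=> hx; apply: subvs_inj; rewrite vsvalK -[x in LHS]mulr1 -[x * 1 in LHS]mulr1 qE //.
  by rewrite (eps1 hgr htri) mulr1.
exists q; split=> //; split=> //.
- move=> i c s; move: c; apply: (tri_ind htri) => [x y hx hy|k x hx|x y z hx hy hz].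
  + by rewrite mulrDl !qD hx hy mulrDl.
  + by rewrite -scalerAl !qZ hx scalerAl.
  + apply: subvs_inj; rewrite -[x * y * z * _]mulrA qG //; last first.
      by apply: TAp; apply: memv_mul => //; exact: subvsP.
    rewrite -[0]addr0 (gprMr hA); last exact: (tri_T0 htri (subvsP s)).
    rewrite -[RHS]/(vsval (q i (x * y * z)) * vsval s) qG ?mulrA -?scalerAl ?mulrA //.
    exact: mem_mul1l.
- move=> i c b hB hn; move: c; apply: (tri_ind htri) => [x y hx hy|k x hx|x y z hx hy hz].
  + by rewrite mulrDl !qD hx hy addr0.
  + by rewrite -scalerAl !qZ hx scaler0.
  + apply: subvs_inj; rewrite -[x * y * z * _]mulrA qG //; last first.
      apply: TAp; have -> : (Ap * T)%VS = (Ap * (Ap * T))%VS by rewrite prodvA prodv_id.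
      exact: memv_mul.
    rewrite (_ : gpr gs 0 (z * b) = 0) ?mulr0 ?scaler0 ?linear0 //.
    apply: (@lowdegM _ _ _ hA 0 1 z b) => //; first exact: (tri_Ap_low hgr htri hz).
    by apply: nz_low1 => //; apply/nzA.
- move=> i j; rewrite qAm ?coord_free ?(basis_free (vbasisP _)) //.
    by rewrite eq_sym; case: (i == j); rewrite ?scale1r ?scale0r.
  by rewrite vbasis_mem // mem_nth ?size_tuple.
- apply: (tri_ind htri) => [x y hx hy|k x hx|x y z hx hy hz].
  + have [m [u [b [hub xE]]]] := hx; have [m' [u' [b' [hub' yE]]]] := hy.
    exists (m + m')%N, (fun k => match split k with inl i => u i | inr j => u' j end),
      (fun k => match split k with inl i => b i | inr j => b' j end).
    split; first by move=> l; case: (split l).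
    under eq_bigr do rewrite qD vD mulrDr.
    rewrite big_split big_split_ord /= {1}xE {1}yE addrACA; congr (_ + _).
    congr (_ + _); apply: eq_bigr => l _; first by rewrite (unsplitK (inl _ l)).
    by rewrite (unsplitK (inr _ l)).
  + have [m [u [b [hub xE]]]] := hx; exists m, (fun l => k *: u l), b; split=> //.
    rewrite {1}xE scalerDr !scaler_sumr; congr (_ + _); apply: eq_bigr => l _.
      by rewrite qZ vZ -scalerAr.
    by rewrite -scalerAl.
  + exists 1%N, (fun=> x * y), (fun=> z - (eps gr z)%:A); split.
      move=> _; split; last by apply/nzA; rewrite gprB // (gpr_K hgr) (eps_Ap hgr htri) // subrr.
      by apply: mem_mul1r => //; rewrite memvB // memvZ.
    rewrite big_ord1 mulrBr addrC -[RHS]addrA -{1}[x * y * z](addr0); congr (_ + _).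
    apply/esym/eqP; rewrite addrC subr_eq0; apply/eqP.
    rewrite [X in _ = X * y * _](coord_basis (vbasisP Am) hx) !mulr_suml.
    apply: eq_bigr => i _; rewrite qE // -!scalerAr -!scalerAl ?mulr1 ?scalerA.
    by rewrite mulrC.
Qed.

Lemma nz_high1 b : b \in (Am * T)%VS -> gpr gs 0 b = 0 -> forall i, -1 < i -> gpr gs i b = 0.
Proof.
move=> hb b0 i i1; have [->//|i0] : i = 0 \/ 0 < i by lia.
exact: Bm_high.
Qed.

(** The mirror image of [coordinates_A], with A^- and A^+ exchanged: over A^op the basis
    is one of A^+. *)
Lemma coordinates_Ac : exists q : 'I_p -> A^c -> S^c,
  coordinates (op_grading gs) iotaTc (Bm : set A^c)
    (fun i : 'I_p => (vbasis Ap)`_i : A^c) q /\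
  forall i (x : A), x \in Ap -> q i x = (coord (vbasis Ap) i x)%:A.
Proof.
pose beta (x : subvs_of Am) (y : S) (z : subvs_of Ap) : {ffun 'I_p -> S} :=
  [ffun i => (coord (vbasis Ap) i (vsval z) * eps gr (vsval x)) *: y].
have hb : trilinear beta.
  split=> [y z|x z|x y] k u v; apply/ffunP => i; rewrite /beta !ffunE.
  - have e : eps gr (k *: vsval u + vsval v) = k * eps gr (vsval u) + eps gr (vsval v).
      exact: (eps_lin hgr k (vsval u) (vsval v)).
    by rewrite [vsval (k *: u + v)]linearP /= e mulrDr scalerDl mulrCA scalerA.
  - by rewrite scalerDr !scalerA mulrC.
  - by rewrite !linearP /= mulrDl scalerDl -mulrA -scalerA.
have [h [hE _]] := tri_mult htri hb.
pose q (i : 'I_p) (c : A) : S := h c i.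
have qD i x y : q i (x + y) = q i x + q i y by rewrite /q linearD ffunE.
have qZ i k x : q i (k *: x) = k *: q i x by rewrite /q linearZ ffunE.
have q0 i : q i 0 = 0 by rewrite /q linear0 ffunE.
have qE i x y z : x \in Am -> y \in T -> z \in Ap ->
    vsval (q i (x * y * z)) = (coord (vbasis Ap) i z * eps gr x) *: y.
  move=> hx hy hz; have := hE (Subvs hx) (Subvs hy) (Subvs hz); rewrite /q /= => ->.
  by rewrite ffunE linearZ.
have qG i y z w : z \in Ap -> y \in T -> w \in (Am * T)%VS ->
    vsval (q i (w * y * z)) = coord (vbasis Ap) i z *: (gpr gs 0 w * y).
  move=> hz hy; move: w; apply: (prodv_ind (P := fun w => vsval (q i (w * y * z))
    = coord (vbasis Ap) i z *: (gpr gs 0 w * y))) => [|u v hu hv|k u hu|x t hx ht].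
  - by rewrite !mul0r q0 gpr0 // mul0r scaler0 v0.
  - by rewrite !mulrDl qD vD hu hv gprD // mulrDl scalerDr.
  - rewrite -!scalerAl qZ vZ hu gprZ // -scalerAl.
    by rewrite !scalerA mulrC.
  - rewrite -[x * t * y]mulrA qE ?memvM // -[0 in RHS]addr0 (gprMr hA) //; last first.
      exact: (tri_T0 htri ht).
    by rewrite (eps_Am hgr htri hx) -!scalerAl mul1r scalerA.
have TAm w : w \in (T * Am)%VS -> w \in (Am * T)%VS by rewrite (tri_AmT htri).
have T1 := tri_1T htri; have Am1 := tri_1Am htri; have Ap1 := tri_1Ap htri.
have qAp i x : x \in Ap -> q i x = (coord (vbasis Ap) i x)%:A.
  move=> hx; apply: subvs_inj; rewrite vsvalK -[x in LHS]mul1r -[1 in LHS]mulr1 qE //.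
  by rewrite (eps1 hgr htri) mulr1.
exists q; split=> //; split=> //.
- move=> i c s.
  suff : q i (vsval (s : S) * (c : A)) = (s : S) * q i c by [].
  move: (c : A); apply: (tri_ind htri) => [x y hx hy|k x hx|x y z hx hy hz].
  + by rewrite mulrDr !qD hx hy mulrDr.
  + by rewrite -scalerAr !qZ hx scalerAr.
  + apply: subvs_inj; rewrite !mulrA qG //; last first.
      by apply: TAm; apply: memv_mul => //; exact: subvsP.
    rewrite -[0]addr0 (gprM hA); last exact: (tri_T0 htri (subvsP _)).
    rewrite -[RHS]/(vsval (s : S) * vsval (q i (x * y * z))) qG -?scalerAr ?mulrA //.
    exact: mem_mul1r.
- move=> i c b hB hn; suff : q i ((b : A) * (c : A)) = 0 by [].
  move: (c : A); apply: (tri_ind htri) => [x y hx hy|k x hx|x y z hx hy hz].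
  + by rewrite mulrDr !qD hx hy addr0.
  + by rewrite -scalerAr !qZ hx scaler0.
  + apply: subvs_inj; rewrite !mulrA qG //; last first.
      have -> : (Am * T)%VS = (Am * T * Am)%VS.
        by rewrite -prodvA -(tri_AmT htri) prodvA prodv_id.
      exact: memv_mul.
    rewrite (_ : gpr gs 0 ((b : A) * x) = 0) ?mul0r ?scaler0 ?v0 //.
    have := @lowdegM _ _ _ (galgebra_neg hA) 1 0 (b : A) x; rewrite /lowdeg.
    move=> /(_ _ _ 0); rewrite (gpr_neg hA) oppr0; apply=> //.
      move=> j j1; rewrite (gpr_neg hA); apply: nz_high1 => //; first exact/nzAc.
      by lia.
    by move=> j j0; rewrite (gpr_neg hA); apply: (tri_Am_high hgr htri hx); lia.
- move=> i j; rewrite [LHS]qAp ?coord_free ?(basis_free (vbasisP _)) //.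
    by rewrite eq_sym; case: (i == j); rewrite ?scale1r ?scale0r.
  by rewrite vbasis_mem // mem_nth ?size_tuple.
- suff H (c : A) : exists m (u b : 'I_m -> A),
    (forall l, b l \in (Am * T)%VS /\ gpr gs 0 (b l) = 0) /\
    c = \sum_i vsval (q i c) * (vbasis Ap)`_i + \sum_l b l * u l.
    move=> c; have [m [u [b [hub cE]]]] := H c; exists m, u, b; split.
      by move=> l; have [? ?] := hub l; split=> //; apply/nzAc.
    exact: cE.
  move: c; apply: (tri_ind htri) => [x y hx hy|k x hx|x y z hx hy hz].
  + have [m [u [b [hub xE]]]] := hx; have [m' [u' [b' [hub' yE]]]] := hy.
    exists (m + m')%N, (fun k => match split k with inl i => u i | inr j => u' j end),
      (fun k => match split k with inl i => b i | inr j => b' j end).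
    split; first by move=> l; case: (split l).
    under eq_bigr do rewrite qD vD mulrDl.
    rewrite big_split big_split_ord /= {1}xE {1}yE addrACA; congr (_ + _).
    congr (_ + _); apply: eq_bigr => l _; first by rewrite (unsplitK (inl _ l)).
    by rewrite (unsplitK (inr _ l)).
  + have [m [u [b [hub xE]]]] := hx; exists m, (fun l => k *: u l), b; split=> //.
    rewrite {1}xE scalerDr !scaler_sumr; congr (_ + _); apply: eq_bigr => l _.
      by rewrite qZ vZ -scalerAl.
    by rewrite -scalerAr.
  + exists 1%N, (fun=> z), (fun=> x * y - eps gr x *: y); split.
      move=> _; split.
        by rewrite memvB ?memv_mul // memvZ //; apply: mem_mul1l.
      rewrite gprB // gprZ // (gpr_id hg (tri_T0 htri hy)) -[0]addr0 (gprMr hA).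
        by rewrite (eps_Am hgr htri hx) -scalerAl mul1r subrr.
      exact: (tri_T0 htri hy).
    rewrite big_ord1 mulrBl addrC -[RHS]addrA -{1}[x * y * z](addr0); congr (_ + _).
    apply/esym/eqP; rewrite addrC subr_eq0; apply/eqP.
    rewrite [X in _ = _ * X](coord_basis (vbasisP Ap) hz) mulr_sumr.
    apply: eq_bigr => i _; rewrite qE // -!scalerAr -!scalerAl ?mulr1 ?scalerA.
    by rewrite mulrC.
Qed.

End TriangularCoordinates.

(** * The regular module is free over the negative and cofree over the positive part *)
Section RegularModule.
Variables (K : fieldType) (A : falgType K) (gr : int -> {vspace A}).
Variables (Am T Ap : {aspace A}).
Hypothesis hgr : graded_algebra gr.
Hypothesis htri : triangular_decomposition gr Am T Ap.
Notation gs := (alg_grading gr).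
Notation n := (\dim Am).
Notation m := (\dim T).
Notation p := (\dim Ap).
Notation Areg := (A^o : lmodType A).
Let hA := tri_galgebra hgr.
Let fdA : fd (kmod Areg) := fd_regular hA.
Notation NP := (Npos gr Ap).
Notation NM := (Nneg gr Am).

Lemma kmod_regular_scale k (x : A) : k *: (x : kmod Areg) = k *: x :> A.
Proof. by rewrite -[LHS]/(k%:A * x) -scalerAl mul1r. Qed.

Lemma kdim_vs (W : {vspace A}) : kdim (vs_set W : set Areg) = \dim W.
Proof.
rewrite -dimS_vs; pose f (x : kmod Areg) : A := x.
have fdV : fd (A : lmodType K) by exists A.
have fl : lin_on (vs_set W : set (kmod Areg)) f.
  by move=> k u v _ _; rewrite /f; congr (_ + _); exact: kmod_regular_scale.
rewrite /kdim -(dim_inj_eq fdA fdV _ fl) //.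
  by congr dimS; apply/seteqP; split=> x; [case=> y ? <- | move=> hx; exists x].
have [h0 h] := submodule_vs W; split=> // k u v hu hv.
by rewrite (_ : k *: u = k *: (u : A)) //; [exact: h | exact: kmod_regular_scale].
Qed.

Lemma kdim_regular : kdim [set: Areg] = (n * m * p)%N.
Proof.
rewrite -(tri_dim htri) -kdim_vs; congr kdim.
by apply/seteqP; split=> // x _; rewrite /vs_set /= memvf.
Qed.

Lemma ksub_vs (W : {vspace A}) : ksub (vs_set W : set Areg).
Proof.
apply: ksub_intro => [|x y|k x]; rewrite /vs_set /=; first exact: mem0v.
  exact: memvD.
by rewrite /GRing.scale /= -scalerAl mul1r; exact: memvZ.
Qed.

(** A = T A^+ + N^- A, so the head over A^- has dimension at most dim T dim A^+, which is
    dim A / n. *)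
Lemma Nfree_regular : Nfree NM n [set: Areg].
Proof.
apply: (Nfree_le (local_Am hgr htri) fdA) => //.
have kN : ksub (Nact NM [set: Areg]) by exact: ksub_Nact (ksubT _).
have kW := ksub_vs (T * Ap)%VS.
have e : setadd (vs_set (T * Ap)%VS : set Areg) (Nact NM [set: Areg]) = setT.
  apply/seteqP; split=> // c _; move: c.
  have kS := ksubD kW kN.
  apply: (tri_ind htri) => [x y hx hy|k x hx|x y z hx hy hz].
  - exact: ksub_D kS hx hy.
  - have := ksub_Z k kS hx; rewrite /GRing.scale /= -[_%:A * _]scalerAl mul1r.
    exact.
  exists ((eps gr x)%:A * y * z), ((x - (eps gr x)%:A) * (y * z)); split.
  - by rewrite /vs_set /= -!scalerAl mul1r memvZ // memv_mul.
  - apply: (@Nact_in _ _ _ Areg) => //; split.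
      by rewrite memvB // memvZ // (tri_1Am htri).
    by rewrite gprB ?(gpr_K hgr) ?(eps_Am hgr htri hx) ?subrr //; exact: galg_grading.
  - by rewrite mulrA -mulrDl -mulrDl addrC subrK.
have h : (kdim [set: Areg] <= \dim (T * Ap)%VS + kdim (Nact NM [set: Areg]))%N.
  by have := kdim_addI fdA kW kN; rewrite e kdim_vs => <-; exact: leq_addr.
have d1 : (\dim (T * Ap)%VS <= m * p)%N by exact: dim_prodv.
have h2 : (kdim [set: Areg] <= m * p + kdim (Nact NM [set: Areg]))%N.
  by apply: (leq_trans h); rewrite leq_add2r.
apply: (@leq_trans (n * (m * p + kdim (Nact NM [set: Areg])))%N); first by rewrite leq_mul2l h2 orbT.
by rewrite mulnDr leq_add2r mulnA kdim_regular.
Qed.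

(** The module Hom_K(A, A) with (b phi)(x) = phi (x b). *)
Definition coind_scale (b : A) (phi : 'End(A)) : 'End(A) := (phi \o amulr b)%VF.

Fact coind_scaleA a b phi : coind_scale a (coind_scale b phi) = coind_scale (a * b) phi.
Proof. by apply/lfunP => x; rewrite /coind_scale !comp_lfunE !lfunE /= mulrA. Qed.
Fact coind_scale1 : left_id 1 coind_scale.
Proof. by move=> phi; apply/lfunP => x; rewrite comp_lfunE lfunE /= mulr1. Qed.
Fact coind_scaleDr : right_distributive coind_scale +%R.
Proof. by move=> a u v; apply/lfunP => x; rewrite !(comp_lfunE, add_lfunE). Qed.
Fact coind_scaleDl phi : {morph coind_scale^~ phi : a b / a + b}.
Proof.
by move=> a b; apply/lfunP => x; rewrite !(comp_lfunE, add_lfunE) !lfunE /= mulrDr linearD.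
Qed.
Definition coind : lmodType A :=
  mklmod coind_scaleA coind_scale1 coind_scaleDr coind_scaleDl.

Lemma coindE (b : A) (phi : coind) x : (b *: phi : 'End(A)) x = (phi : 'End(A)) (x * b).
Proof. by rewrite -[b *: phi]/(coind_scale b phi) comp_lfunE lfunE. Qed.

Lemma coindK k (phi : coind) : k%:A *: phi = k *: (phi : 'End(A)).
Proof. by apply/lfunP => x; rewrite coindE scale_lfunE -scalerAr mulr1 linearZ. Qed.

Lemma coind_kdim : fd (kmod coind) /\ kdim [set: coind] = (\dim {:A} * \dim {:A})%N.
Proof.
pose f (x : 'End(A)) : kmod coind := x.
have fl : linear f by move=> k u v; rewrite /f; congr (_ + _); exact/esym/coindK.
have fdE : fd ('End(A) : lmodType K) by exists 'End(A).
have fdC : fd (kmod coind).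
  by apply: (@fd_surj _ _ _ (mklin fl)) => // y; exists y.
split=> //; rewrite /kdim.
have -> : [set: coind] = mklin fl @` [set: 'End(A)].
  by apply/seteqP; split=> // x _; exists x.
rewrite (@dim_inj_eq _ _ _ fdE fdC) //; last exact: lin_on_lin.
have -> : [set: 'End(A)] = vs_set {:'End(A)}.
  by apply/seteqP; split=> // x _; rewrite /vs_set /= memvf.
by rewrite dimS_vs !dimvf /dim.
Qed.

(** A map killed by N^+ vanishes on A N^+, hence is determined by its restriction to
    A^- T; so the socle has dimension at most dim (A^- T) dim A. *)
Lemma Ncofree_coind : Ncofree NP p [set: coind].
Proof.
have [fdC dC] := coind_kdim.
apply: (Ncofree_le (local_Ap hgr htri) fdC) => //.
have kW := ksub_vs (Am * T)%VS.
have h : (kdim (Nsoc NP [set: coind]) <= \dim (Am * T)%VS * kdim [set: Areg])%N.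
  apply: (@kdim_detect _ _ _ coind Areg fdC fdA _
      (fun (i : 'I_(\dim (Am * T)%VS)) (phi : coind) => (phi : 'End(A)) (vbasis (Am * T)%VS)`_i)) => //.
  - exact: ksub_Nsoc (ksubT _).
  - move=> i k u v _ _.
    change (((k%:A *: (u : coind) : 'End(A)) + (v : 'End(A))) (vbasis (Am * T)%VS)`_i
      = k%:A * (u : 'End(A)) (vbasis (Am * T)%VS)`_i + (v : 'End(A)) (vbasis (Am * T)%VS)`_i).
    by rewrite coindK add_lfunE scale_lfunE -scalerAl mul1r.
  move=> phi [_ hphi] h0; apply/lfunP => c; rewrite zero_lfunE; move: c.
  have phD u v : (phi : 'End(A)) (u + v) = (phi : 'End(A)) u + (phi : 'End(A)) v.
    exact: linearD.
  have phZ k u : (phi : 'End(A)) (k *: u) = k *: (phi : 'End(A)) u by exact: linearZ.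
  have h1 w : w \in (Am * T)%VS -> (phi : 'End(A)) w = 0.
    move/coord_vbasis => ->; rewrite linear_sum big1 // => i _.
    by rewrite linearZ /= h0 scaler0.
  apply: (tri_ind htri) => [x y hx hy|k x hx|x y z hx hy hz].
  - by rewrite phD hx hy addr0.
  - by rewrite phZ hx scaler0.
  have -> : x * y * z = x * y * (eps gr z)%:A + x * y * (z - (eps gr z)%:A).
    by rewrite -mulrDr addrC subrK.
  rewrite phD -scalerAr mulr1 h1 ?add0r; last by rewrite memvZ // memv_mul.
  rewrite -coindE hphi ?zero_lfunE //; split.
    by rewrite memvB // memvZ // (tri_1Ap htri).
  by rewrite gprB ?(gpr_K hgr) ?(eps_Ap hgr htri hz) ?subrr //; exact: galg_grading.
have d1 : (\dim (Am * T)%VS <= n * m)%N by exact: dim_prodv.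
rewrite dC (tri_dim htri) (leq_trans (_ : _ <= p * (n * m * (n * m * p)))%N) //.
  rewrite leq_mul2l; apply/orP; right; apply: (leq_trans h).
  by rewrite kdim_regular leq_mul2r d1 orbT.
by rewrite mulnA [(p * _)%N]mulnC.
Qed.

(** A embeds in Hom_K(A, A) by sending b to the right multiplication by b; by
    self-injectivity the image is a direct summand. *)
Lemma Ncofree_regular : self_injective A -> Ncofree NP p [set: Areg].
Proof.
move=> inj; have [fdC _] := coind_kdim.
have jl : linear ((fun b => amulr b) : Areg -> coind).
  move=> a x y; apply/lfunP => z.
  by rewrite add_lfunE coindE !lfunE /= mulrDr mulrA.
have j_inj : injective (mklin jl) by move=> x y /amulr_inj.
have idl : linear (@id Areg) by [].
have [r rK] := inj Areg coind (mklin jl) (mklin idl) j_inj.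
apply: (Ncofree_embed (f := mklin jl) fdC fdA) => //.
have kerr : submodule [set x | r x = 0].
  split; first by rewrite /= linear0.
  by move=> a u v /= hu hv; rewrite linearP hu hv scaler0 addr0.
apply: (Ncofree_summand (local_Ap hgr htri) fdC (W := [set x | r x = 0])) => //.
- by apply: submodule_img; [exact: submodule_T | exact: lin_on_lin].
- apply/seteqP; split=> x.
    by case=> -[y _ <-] /=; rewrite rK /= => ->; exact: (linear0 (mklin jl)).
  move=> ->; split; last by rewrite /= linear0.
  by exists 0 => //; exact: (linear0 (mklin jl)).
- apply/seteqP; split=> // x _; exists (mklin jl (r x)), (x - mklin jl (r x)); split.
  + by exists (r x).
  + by rewrite /= linearB (rK (r x)) subrr.
  + by rewrite addrC subrK.
- exact: Ncofree_coind.
Qed.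

End RegularModule.

(** * Standard objects *)
Section Standard.
Variables (K : fieldType) (A : falgType K) (gr : int -> {vspace A}).
Variables (Am T Ap : {aspace A}).
Hypothesis hgr : graded_algebra gr.
Hypothesis htri : triangular_decomposition gr Am T Ap.
Notation gs := (alg_grading gr).
Notation S := (subvs_of T).
Notation n := (\dim Am).
Notation p := (\dim Ap).
Notation NP := (Npos gr Ap).
Notation NM := (Nneg gr Am).
Notation iotaT := (fun t : S => vsval t).
Notation Bp := (vs_set (Ap * T)%VS).
Let hA := tri_galgebra hgr.
Let hg := galg_grading hA.
Let hS := T_galgebra hgr htri.
Let hD := ind_data_A hgr htri.
Notation std_by := (@is_induced_by K A gs S (@sub_grading K A gr T) iotaT Bp).

Lemma vsval_K k : vsval (k%:A : S) = k%:A :> A.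
Proof. exact: (vsvalK htri). Qed.

Lemma gsimple_degree (lam : GT gr T) : gsimple lam -> exists d, has_degree lam d.
Proof.
move=> [[x x0] hs].
have [i xi] : exists i, pr lam i x <> 0.
  apply: contrapT => h; apply: x0; apply: (gpr_eq0 (gm_grading lam)) => i.
  by apply: contrapT => hi; apply: h; exists i.
exists i; have [|e|e] := hs (gm_comp lam i).
- apply: gsubm_intro.
    split; first exact: (gr0 (gm_grading lam)).
    move=> a u v hu hv; apply: (grD (gm_grading lam)) => //.
    by rewrite -[i]add0r; apply: gm_act => //; exact: (tri_T0 htri (subvsP a)).
  move=> y j hy; case: (eqVneq j i) => [->|ji]; first by rewrite pr_id.
  by rewrite (gpr_neq (gm_grading lam) hy ji); exact: (gr0 (gm_grading lam)).
- by case: xi; have := pr_in (M := lam) i x; rewrite e => ->.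
- by move=> y; rewrite e.
Qed.

Lemma gsimple_T (lam : GT gr T) d (U : set lam) : gsimple lam -> has_degree lam d ->
  submodule U -> U = [set 0] \/ U = setT.
Proof.
move=> [_ hs] hd hU; apply: hs; apply: gsubm_intro => // x i Ux.
case: (eqVneq i d) => [->|id]; first by rewrite pr_id.
by rewrite (gpr_neq (gm_grading lam) (hd x) id); exact: sub_0.
Qed.

Lemma standard_exists (lam : GT gr T) d : has_degree lam d ->
  exists D : GA gr, is_standard Ap lam D.
Proof. by move=> hd; exact: (induced_exists hA hD hd). Qed.

Lemma pos_kills (M : GA gr) d b x : (forall i x, d < i -> gm_comp M i x -> x = 0) ->
  lowdeg gs 1 b -> gm_comp M d x -> b *: x = 0.
Proof.
move=> hM hb hx; have [s [us _ bE]] := gpr_supp hg b.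
rewrite bE scaler_suml big1 // => i _.
case: (ltP i 1) => i1; first by rewrite hb // scale0r.
apply: (hM (i + d)); first by lia.
by apply: gm_act => //; exact: (gpr_in hg).
Qed.

Section StandardTheory.
Variables (lam : GT gr T) (D : GA gr) (tau : A -> lam -> D) (d : int).
Hypothesis hP : std_by tau.
Hypothesis hd : has_degree lam d.

(** Splitting off the augmentations of the outer factors: the positive part of z kills
    the tensor, and the negative part of a moves it into N^- D and below degree d. *)
Lemma std_reduce c x : exists y, exists2 w, Nact NM setT w &
  tau c x = tau 1 y + w /\ forall i, d <= i -> pr D i w = 0.
Proof.
move: c x; apply: (tri_ind htri) => [c c' h h' x|k c h x|a t z ha ht hz x].
- have [y [w hw [e e0]]] := h x; have [y' [w' hw' [e' e0']]] := h' x.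
  exists (y + y'), (w + w'); first exact: ksub_D (ksub_Nact (ksubT _)) hw hw'.
  split; first by rewrite (ind_tauDl hP) e e' (ind_tauDr hP) addrACA.
  by move=> i hi; rewrite gprD ?e0 ?e0' ?addr0 //; exact: gm_grading.
- have [y [w hw [e e0]]] := h x; exists (k%:A *: y), (k%:A *: w).
    exact: ksub_Z (ksub_Nact (ksubT _)) hw.
  split.
    rewrite -[k *: c]mul1r -[1 * _]scalerAr scalerAl -(ind_tauZ hP) e scalerDr.
    by rewrite (ind_tau_K hA hD hP).
  by move=> i hi; rewrite (pr_K hA) e0 // scaler0.
set z' := z - (eps gr z)%:A; set a' := a - (eps gr a)%:A.
have hz' : z' \in Ap by rewrite memvB // memvZ // (tri_1Ap htri).
have z0 : gpr gs 0 z' = 0.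
  by rewrite gprB // (gpr_K hgr) (eps_Ap hgr htri hz) subrr.
have ha' : a' \in Am by rewrite memvB // memvZ // (tri_1Am htri).
have a0 : gpr gs 0 a' = 0.
  by rewrite gprB // (gpr_K hgr) (eps_Am hgr htri ha) subrr.
pose tt : S := Subvs ht; pose y := ((eps gr z)%:A : S) *: x.
have e1 : tau (a * t * z) x = tau a (tt *: y).
  have -> : z = z' + (eps gr z)%:A by rewrite subrK.
  rewrite mulrDr (ind_tauDl hP) (ind_tau_bal hP _ (t := 0)) ?scale0r.
  - rewrite (ind_tau0r hP) add0r -[(eps gr z)%:A]vsval_K.
    by rewrite (ind_tau_iota hA hD hP) -[t]/(vsval tt) (ind_tau_iota hA hD hP).
  - by apply: mem_mul1r => //; exact: (tri_1T htri).
  - have e0 : nonzero_degree_part gs (z' - 0) by rewrite subr0; apply/(nzA hgr).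
    exact: e0.
exists ((eps gr a)%:A *: (tt *: y)), (tau a' (tt *: y)).
  have -> : tau a' (tt *: y) = a' *: tau 1 (tt *: y) by rewrite (ind_tauZ hP) mulr1.
  by apply: Nact_in.
split.
  rewrite e1 {1}(_ : a = (eps gr a)%:A + a'); last by rewrite addrC subrK.
  rewrite (ind_tauDl hP); congr (_ + _).
  by rewrite -(ind_tau_K hA hD hP) (ind_tauZ hP) mulr1.
move=> i; rewrite -[i](subrK d) => hi; rewrite (ind_pr hA hP hd).
rewrite (_ : gpr gs (i - d) a' = 0) ?(ind_tau0l hP) //.
have [->//|i0] : i - d = 0 \/ 0 < i - d by lia.
exact: (tri_Am_high hgr htri ha').
Qed.

Lemma std_reduce_sum q : exists y, exists2 w, Nact NM setT w &
  q = tau 1 y + w /\ forall i, d <= i -> pr D i w = 0.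
Proof.
have [m [c [x ->]]] := ind_gen hP q.
elim: m c x => [|m IH] c x.
  exists 0, 0; first exact: ksub_0 (ksub_Nact (ksubT _)).
  split; first by rewrite big_ord0 (ind_tau0r hP) addr0.
  by move=> i _; exact: (gpr0 (gm_grading D)).
have [y [w hw [e e0]]] := IH (fun k => c (lift ord0 k)) (fun k => x (lift ord0 k)).
have [y' [w' hw' [e' e0']]] := std_reduce (c ord0) (x ord0).
exists (y' + y), (w' + w); first exact: ksub_D (ksub_Nact (ksubT _)) hw' hw.
split; first by rewrite big_ord_recl e e' (ind_tauDr hP) addrACA.
by move=> i hi; rewrite gprD ?e0 ?e0' ?addr0 //; exact: gm_grading.
Qed.

Lemma std_tau1_deg x : gm_comp D d (tau 1 x).
Proof. by rewrite -[d]add0r; apply: (ind_tau_comp hP hd); exact: (galg_1 hA). Qed.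

Lemma std_high i x : d < i -> gm_comp D i x -> x = 0.
Proof.
move=> di hx; have [y [w _ [e e0]]] := std_reduce_sum x.
rewrite -(pr_id hx) e gprD; last exact: gm_grading.
rewrite e0 ?addr0; last by lia.
by rewrite (gpr_neq (gm_grading D) (std_tau1_deg y)) // gt_eqF.
Qed.

Lemma std_top x : gm_comp D d x -> exists y, x = tau 1 y.
Proof.
move=> hx; have [y [w _ [e e0]]] := std_reduce_sum x; exists y.
rewrite -(pr_id hx) e gprD; last exact: gm_grading.
by rewrite e0 ?addr0 //; exact: pr_id (std_tau1_deg y).
Qed.

Lemma std_tau1_inj x : tau 1 x = 0 -> x = 0.
Proof.
have [q [hq _]] := coordinates_A hgr htri => h.
have E : 1 = \sum_i coord (vbasis Am) i 1 *: (vbasis Am)`_i :> A.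
  exact: coord_vbasis (tri_1Am htri).
have e (i : 'I_n) : tau (coord (vbasis Am) i 1 *: (vbasis Am)`_i) x =
    tau (vbasis Am)`_i ((coord (vbasis Am) i 1)%:A *: x).
  by rewrite -(ind_tau_K hA hD hP) (ind_tauZ hP) -scalerAl mul1r.
have h2 : \sum_(i < n) tau (vbasis Am)`_i ((coord (vbasis Am) i 1)%:A *: x) = 0.
  by rewrite -[RHS]h {2}E (ind_tau_suml hP); apply: eq_bigr => i _; rewrite e.
have h3 := ind_tau_inj hA hD hP hq h2.
apply: contrapT => x0; have : (1 : A) = 0; last by move/eqP; rewrite oner_eq0.
rewrite E big1 // => i _; case: (eqVneq (coord (vbasis Am) i 1) 0) => [->|ci].
  by rewrite scale0r.
case: x0; have := h3 i => /(congr1 (fun v => (coord (vbasis Am) i 1)^-1%:A *: v)).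
by rewrite scaler0 scalerA -scalerAl mul1r scalerA mulVf // !scale1r.
Qed.

Lemma std_kdim : kdim [set: D] = (n * kdim [set: lam])%N.
Proof.
have [q [hq _]] := coordinates_A hgr htri.
exact: (ind_dim hA hD hP hq hS).
Qed.

(** By [std_reduce_sum] the head over A^- is a quotient of lam. *)
Lemma std_Nfree : Nfree NM n [set: D].
Proof.
have fD := gm_fd hA D.
apply: (Nfree_le (local_Am hgr htri) fD) => //.
have kN : ksub (Nact NM [set: D]) by exact: ksub_Nact (ksubT _).
have tl : klin [set: lam] (tau 1) by exact: (ind_tau_klin hA hD hP).
have kI : ksub (tau 1 @` setT) by apply: ksub_img tl; exact: ksubT.
have e : setadd (tau 1 @` setT) (Nact NM [set: D]) = setT.
  apply/seteqP; split=> // x _; have [y [w hw [e _]]] := std_reduce_sum x.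
  by exists (tau 1 y), w; split=> //; exists y.
have h1 : (kdim (tau 1%R @` setT) <= kdim [set: lam])%N.
  by rewrite (kdim_rank (gm_fd hS lam) fD (ksubT _) tl) leq_addr.
have h : (kdim [set: D] <= kdim [set: lam] + kdim (Nact NM [set: D]))%N.
  have := kdim_addI fD kI kN; rewrite e => h.
  apply: (leq_trans (leq_trans (leq_addr _ _) (eq_leq h))).
  by rewrite leq_add2r; exact: h1.
apply: (@leq_trans (n * (kdim [set: lam] + kdim (Nact NM [set: D])))%N).
  by rewrite leq_mul2l h orbT.
by rewrite mulnDr leq_add2r std_kdim.
Qed.

(** Delta(lam) maps to every module bounded by the degree of lam, because A^+ moves the
    degree d part of such a module out of its range. *)
Lemma std_map (M : GA gr) (g : lam -> M) :
  (forall i x, d < i -> gm_comp M i x -> x = 0) ->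
  (forall x y, g (x + y) = g x + g y) -> (forall t x, g (t *: x) = vsval t *: g x) ->
  (forall x, gm_comp M d (g x)) ->
  exists h : {linear D -> M}, degree_preserving h /\ forall a x, h (tau a x) = a *: g x.
Proof.
move=> hM gD gZ gd; have [|h hE] := ind_map hD hP gD gZ.
  move=> b x hb /(nzA hgr) b0; apply: (pos_kills hM) => //.
  exact: (nz_low1 hgr htri).
by exists h; split=> //; exact: (ind_map_deg hA hP hd hE gd).
Qed.

Lemma std_gen_top (U : set D) : submodule U -> (forall x, U (tau 1 x)) -> U = setT.
Proof.
move=> hU h; apply/seteqP; split=> // x _; have [m [c [y ->]]] := ind_gen hP x.
apply: (sub_sum hU) => k _; rewrite -[c k]mulr1 -(ind_tauZ hP).
exact: sub_Z.
Qed.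

(** A submodule containing a nonzero vector of degree d contains 1 (x) lam, since lam is
    simple, and this generates Delta(lam). *)
Lemma std_local (U : set D) u : gsimple lam -> submodule U -> U u -> gm_comp D d u ->
  u <> 0 -> U = setT.
Proof.
move=> sl hU Uu hu u0; apply: std_gen_top => //.
pose V : set lam := [set x | U (tau 1 x)].
have hV : submodule V.
  split; first by rewrite /V /= (ind_tau0r hP); exact: sub_0.
  move=> t x y hx hy; rewrite /V /= (ind_tauDr hP); apply: sub_D => //.
  rewrite -(ind_tau_iota hA hD hP) mul1r -[vsval t]mulr1 -(ind_tauZ hP).
  exact: sub_Z.
have [y ue] := std_top hu.
have [e|e] := gsimple_T sl hd hV.
  have : V y by rewrite /V /= -ue.
  by rewrite e => y0; case: u0; rewrite ue y0 (ind_tau0r hP).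
by move=> x; have : V x by rewrite e.
Qed.

End StandardTheory.

End Standard.

(** * Costandard objects *)
Section Costandard.
Variables (K : fieldType) (A : falgType K) (gr : int -> {vspace A}).
Variables (Am T Ap : {aspace A}).
Hypothesis hgr : graded_algebra gr.
Hypothesis htri : triangular_decomposition gr Am T Ap.
Notation gs := (alg_grading gr).
Notation S := (subvs_of T).
Notation p := (\dim Ap).
Notation NP := (Npos gr Ap).
Notation Bm := (vs_set (Am * T)%VS).
Notation iotaTc := (fun t : S^c => (vsval (t : S) : A^c)).
Notation grS := (@sub_grading K A gr T).
Let hA := tri_galgebra hgr.
Let hg := galg_grading hA.
Let hS := T_galgebra hgr htri.
Let hAc := galgebra_op hA.
Let hSc := galgebra_op hS.
Let hD := ind_data_Ac hgr htri.

Definition op_T (t : S^c) : S := t.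
Definition op_A (a : A) : A^c := a.

Lemma op_T_anti : antimorphism op_T grS (op_grading grS).
Proof. by split. Qed.

Lemma op_A_anti : antimorphism op_A (op_grading gs) gs.
Proof. by split=> // i a; rewrite /op_grading opprK. Qed.

Lemma costandard_exists (lam : GT gr T) d : has_degree lam d ->
  exists N : GA gr, is_costandard Am lam N.
Proof.
move=> hd; have [lamd hl] := dual_exists hS op_T_anti lam.
have [ev1 h1] := hl.
have hd' : has_degree lamd d by exact: (dual_degree h1 hd).
have [P hP] := induced_exists hAc hD hd'.
have [N hN] := dual_exists hAc op_A_anti P.
by exists N, lamd, P.
Qed.

(** A T-linear map onto lam concentrated in degree d: the dual of an inclusion of lam in
    the degree d part. *)
Definition coprojection (lam : GT gr T) d (M : GA gr) (pi : M -> lam) : Prop :=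
  [/\ forall x y, pi (x + y) = pi x + pi y,
      forall t x, pi (vsval t *: x) = t *: pi x
    & forall i x, i != d -> gm_comp M i x -> pi x = 0].

Section CoprojectionTheory.
Variables (lam : GT gr T) (d : int) (M : GA gr) (pi : M -> lam).
Hypothesis hpi : coprojection d pi.

Lemma coproj0 : pi 0 = 0.
Proof. by case: hpi => h _ _; apply: (addIr (pi 0)); rewrite -h !add0r. Qed.
Lemma coprojB x y : pi (x - y) = pi x - pi y.
Proof. by case: hpi => h _ _; apply: (addIr (pi y)); rewrite -h !subrK. Qed.
Lemma coproj_sum (I : Type) (r : seq I) (Q : pred I) (F : I -> M) :
  pi (\sum_(i <- r | Q i) F i) = \sum_(i <- r | Q i) pi (F i).
Proof. by case: hpi => h _ _; apply: (big_morph pi) => //; exact: coproj0. Qed.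
Lemma coprojK k x : pi (k%:A *: x) = k%:A *: pi x.
Proof. by case: hpi => _ h _; rewrite -h (vsval_K htri). Qed.
Lemma coproj_klin (U : set M) : klin U pi.
Proof. by move=> k x y _ _; case: hpi => h _ _; rewrite h; congr (_ + _); exact: coprojK. Qed.

Lemma coproj_neg b y : (forall i x, d < i -> gm_comp M i x -> x = 0) ->
  (forall i, 0 <= i -> gpr gs i b = 0) -> pi (b *: y) = 0.
Proof.
move=> hM hb; have [s [us _ bE]] := gpr_supp hg b.
have [t [ut _ yE]] := gpr_supp (gm_grading M) y.
rewrite bE scaler_suml coproj_sum big1 // => i _.
rewrite yE scaler_sumr coproj_sum big1 // => j _.
case: (lerP 0 i) => i0; first by rewrite hb // scale0r coproj0.
case: hpi => _ _ h; case: (eqVneq (i + j) d) => ij; last first.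
  by apply: (h (i + j)) => //; apply: gm_act; [exact: gpr_in hg _ _ | exact: pr_in].
rewrite (hM j (pr M j y)) ?scaler0 ?coproj0 //; first by lia.
exact: pr_in.
Qed.

End CoprojectionTheory.

(** Everything needed about nabla(lam), extracted from its definition by duals.  Restricting
    functionals to 1 (x) lam^* gives piN : nabla(lam) -> lam, which is dual to the
    inclusion of lam^* in the induced module: nabla(lam) is cogenerated by piN, and
    every (M, pi) bounded by d maps to it, with kernel the largest submodule of M on
    which pi vanishes. *)
Lemma costandardP (lam : GT gr T) (N : GA gr) d :
  has_degree lam d -> is_costandard Am lam N ->
  exists piN : N -> lam, [/\ coprojection d piN,
    kdim [set: N] = (p * kdim [set: lam])%N, Ncofree NP p [set: N],
    (forall x, (forall a, piN (a *: x) = 0) -> x = 0) &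
    forall (M : GA gr) (pi : M -> lam),
      (forall i x, d < i -> gm_comp M i x -> x = 0) -> coprojection d pi ->
      exists F : {linear M -> N}, [/\ degree_preserving F,
        forall x, piN (F x) = pi x & forall x, F x = 0 <-> forall a, pi (a *: x) = 0]].
Proof.
move=> hd [lamd [P [[ev1 h1] [tau hP] [ev2 h2]]]].
have hd' : has_degree lamd d by exact: (dual_degree h1 hd).
have [q [hq hqA]] := coordinates_Ac hgr htri.
have pN0 (x : N) : exists y, forall phi, ev1 phi y = ev2 x (tau 1 phi).
  apply: (dual_reflexive hS op_T_anti h1) => k u v.
  rewrite (ind_tauDr hP) (klinearD (dual_klin h2 x)); congr (_ + _).
  by rewrite -(ind_tau_K hAc hD hP) (klinearZ (dual_klin h2 x)).
have [piN piNE] := choice pN0.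
(* an element of nabla(lam) is a functional on the induced module, and its values on
   tensors are those of piN on its A-multiples *)
have star x c phi : ev2 x (tau c phi) = ev1 phi (piN ((c : A) *: x)).
  by rewrite piNE (dual_act op_A_anti h2) (ind_tauZ hP) mulr1.
have sep1 y y' : (forall phi, ev1 phi y = ev1 phi y') -> y = y'.
  move=> h; apply/eqP; rewrite -subr_eq0; apply/eqP.
  apply: (dual_separates hS op_T_anti h1) => phi.
  by rewrite (klinearB (dual_klin h1 phi)) h subrr.
have ev2B x : {morph ev2 x : u v / u - v}.
  by move=> u v; rewrite (klinearB (dual_klin h2 x)).
have sep2 x y : (forall c phi, ev2 x (tau c phi) = ev2 y (tau c phi)) -> x = y.
  move=> h; apply: (dual_inj h2); apply: (ind_ext hP) => //; exact: ev2B.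
have pD x y : piN (x + y) = piN x + piN y.
  apply: sep1 => phi; rewrite (klinearD (dual_klin h1 phi)) !piNE.
  exact: (dual_D op_A_anti h2).
have pT t x : piN (vsval t *: x) = t *: piN x.
  apply: sep1 => phi; rewrite piNE (dual_act op_A_anti h2) (ind_tauZ hP).
  have -> : op_A (vsval t) * 1 = 1 * iotaTc t by rewrite mul1r mulr1.
  by rewrite (ind_tau_iota hAc hD hP) -piNE (dual_act op_T_anti h1).
have tau1_deg phi : gm_comp P d (tau 1 phi).
  by rewrite -[d]add0r; apply: (ind_tau_comp hP hd'); exact: (galg_1 hAc).
have p0 i x : i != d -> gm_comp N i x -> piN x = 0.
  move=> id hx; apply: sep1 => phi; rewrite piNE (klinear0 (dual_klin h1 phi)).
  apply: ((dual_comp h2 i x).1 hx d) => //.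
  by move=> e; rewrite e eqxx in id.
have hpiN : coprojection d piN by [].
have cogen x : (forall a, piN (a *: x) = 0) -> x = 0.
  move=> h; apply: sep2 => c phi; rewrite star h (klinear0 (dual_klin h1 phi)).
  by rewrite (dual_0 op_A_anti h2).
have dN : kdim [set: N] = (p * kdim [set: lam])%N.
  rewrite (dual_dim hAc op_A_anti h2) (ind_dim hAc hD hP hq hSc).
  by rewrite (dual_dim hS op_T_anti h1).
exists piN; split=> //.
- apply: (Ncofree_le (local_Ap hgr htri) (gm_fd hA N)) => //.
  rewrite dN leq_mul2l; apply/orP; right.
  rewrite -[X in (_ <= X)%N]mul1n.
  apply: (@kdim_detect _ _ _ N lam (gm_fd hA N) (gm_fd hS lam) 1 (fun=> piN)) => //.
    exact: ksub_Nsoc (ksubT _).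
    by move=> _; exact: (coproj_klin hpiN).
  move=> x [_ hx] h; have hx0 := h ord0.
  apply: (dual_inj h2); apply: (ind_ext hP); [exact: ev2B | exact: ev2B |] => c phi.
  rewrite (dual_0 op_A_anti h2).
  rewrite (ind_tau_coo hAc hD hP hq) (klinear_sum (dual_klin h2 x)) big1 // => i _.
  rewrite star.
  have ha : (vbasis Ap)`_i \in Ap by rewrite vbasis_mem // mem_nth ?size_tuple.
  have -> : ((vbasis Ap)`_i : A) *: x = (eps gr (vbasis Ap)`_i)%:A *: x.
    apply/eqP; rewrite -subr_eq0 -scalerBl; apply/eqP/hx; split.
      by rewrite memvB // memvZ // (tri_1Ap htri).
    by rewrite gprB // (gpr_K hgr) (eps_Ap hgr htri ha) subrr.
  by rewrite (coprojK hpiN) hx0 scaler0 (klinear0 (dual_klin h1 _)).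
move=> M pi hM hpi.
have [piD piT _] := hpi.
(* pi kills what comes from the negative degrees of A^-T, which is the balancedness
   required of beta *)
have neg b t y : b \in (Am * T)%VS -> gpr gs 0 (b - vsval t) = 0 ->
    pi (b *: y) = t *: pi y.
  move=> hb h0; apply/eqP; rewrite -subr_eq0 -piT -(coprojB hpi) -scalerBl; apply/eqP.
  apply: (coproj_neg hpi) => // i i0.
  have [->//|i1] : i = 0 \/ 0 < i by lia.
  apply: (Bm_high hgr htri) => //; rewrite memvB //.
  by apply: mem_mul1l (subvsP t); exact: tri_1Am htri.
have hx x : exists y, forall c phi, ev2 y (tau c phi) = ev1 phi (pi ((c : A) *: x)).
  pose beta (c : A^c) (phi : lamd) : K := ev1 phi (pi ((c : A) *: x)).
  have hb : balanced (op_grading gs) iotaTc (Bm : set A^c) beta.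
    split=> [c c' phi|c phi phi'|c b t phi hB hn]; rewrite /beta.
    - by rewrite scalerDl piD (klinearD (dual_klin h1 phi)).
    - exact: (dual_D op_T_anti h1).
    - rewrite (dual_act op_T_anti h1); congr (ev1 phi _).
      rewrite -[c * b]/((b : A) * (c : A)) -scalerA; apply: neg => //.
      by apply/(nzAc hgr).
  have [_ /(_ _ _ hb) [h [hE _]] _ _] := hP.
  have hk : klinear h.
    have hZ k : (fun u => h (k%:A *: u)) =1 (fun u => k * h u).
      apply: (ind_ext hP) => [u v|u v|c phi].
      - by rewrite scalerBr raddfB.
      - by rewrite raddfB mulrBr.
      - rewrite (ind_tauZ hP) !hE /beta.
        have -> : (k%:A : A^c) * c = k%:A * (c : A) :> A.
          by rewrite -[(k%:A : A^c) * c]/((c : A) * k%:A) -scalerAl -scalerAr mulr1 mul1r.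
        by rewrite -scalerA (coprojK hpi) (klinearZ (dual_klin h1 phi)).
    by move=> k u v; rewrite raddfD; congr (_ + _); exact: hZ.
  have [y yE] := dual_surj h2 hk.
  by exists y => c phi; rewrite yE hE.
have [F FE] := choice hx.
have Fl : linear F.
  move=> a x y; apply: sep2 => c phi.
  rewrite (dual_D op_A_anti h2) (dual_act op_A_anti h2) (ind_tauZ hP) !FE.
  rewrite -(klinearD (dual_klin h1 phi)) -piD; congr (ev1 phi (pi _)).
  by rewrite scalerDr scalerA.
have FZ a x : F (a *: x) = a *: F x by exact: (linearZ_LR (mklin Fl)).
have piF x : piN (F x) = pi x.
  by apply: sep1 => phi; rewrite piNE FE scale1r.
exists (mklin Fl); split=> [i x hxi|x|x] /=; last 2 first.
- exact: piF.
- split=> [e a|h]; last first.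
    by apply: cogen => a; rewrite -FZ piF; exact: h.
  by rewrite -piF FZ e scaler0; exact: (coproj0 hpiN).
apply/(dual_comp h2) => j u ji; rewrite -[j](subrK d) => hu.
have [m [c [y [hc ->]]]] := ind_gen_hom hAc hP hd' hu.
rewrite (klinear_sum (dual_klin h2 _)) big1 // => k _; rewrite FE.
case: hpi => _ _ h; rewrite (h (- (j - d) + i)) ?(klinear0 (dual_klin h1 _)) //.
  by apply/eqP => e; apply: ji; lia.
by apply: gm_act hxi; exact: hc.
Qed.

End Costandard.

(** * The top degree part as a T-module *)
Section Semisimple.
Variables (K : fieldType) (S : algType K).
Hypothesis hS : semisimple_ring S.

(** Semisimplicity of the regular module passes to every finite-dimensional module.  Take W
    maximal among the submodules meeting U trivially.  If x is not in U + W, the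
    annihilator I of x modulo U + W has a complement J in S, and W + J x is larger
    than W; so J = 0, I = S and x is in U + W, a contradiction. *)
Lemma semisimple_complement (V : lmodType S) (U : set V) : fd (kmod V) -> submodule U ->
  exists W, submodule W /\ internal_dsum U W.
Proof.
move=> hV hU.
pose P k := `[< exists W : set V, [/\ submodule W, W `&` U = [set 0] & kdim W = k] >].
have P0 : exists k, P k.
  exists 0%N; apply/asboolP; exists [set 0]; split; [exact: submodule_0| |exact: kdim0].
  by apply/seteqP; split=> x; [case | move=> ->; split=> //; exact: sub_0].
have Pb k : P k -> (k <= kdim [set: V])%N.
  move=> /asboolP[W [hW _ <-]]; apply: kdim_le => //; exact: ksub_submodule.
have [k /asboolP[W [hW W0 dW]] kmax] := ex_maxnP P0 Pb.
exists W; split=> //; split; first by rewrite setIC.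
move=> x; apply: contrapT => hx.
have hUW := submodule_add hU hW.
pose I : set (S^o : lmodType S) := [set t | setadd U W ((t : S) *: x)].
have hI : submodule I.
  split; first by rewrite /I /= scale0r; exact: sub_0.
  move=> a u v hu hv; rewrite /I /= scalerDl; apply: (sub_D hUW) => //.
  by rewrite -[a *: u]/(a * u) -scalerA; exact: sub_Z.
have [J [hJ [IJ0 IJT]]] := hS hI.
pose W' := setadd W [set y | exists2 t, J t & y = (t : S) *: x].
have hJx : submodule [set y | exists2 t, J t & y = (t : S) *: x].
  split; first by exists 0; [exact: sub_0 | rewrite scale0r].
  move=> a _ _ [t ht ->] [s hs ->]; exists (a * t + s).
    by case: hJ => _ /(_ a t s ht hs).
  by rewrite scalerDl scalerA.
have hW' : submodule W' by exact: submodule_add.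
have J0 t : J t -> setadd U W ((t : S) *: x) -> t = 0.
  by move=> ht hi; have : (I `&` J) t by []; rewrite IJ0.
have W'0 : W' `&` U = [set 0].
  apply/seteqP; split=> y; last by move=> ->; split; exact: sub_0.
  case=> -[w [_ [Ww [t ht ->] ->]]] Uy.
  have t0 : t = 0.
    apply: J0 => //; exists (w + (t : S) *: x), (- w); split=> //; first exact: sub_N.
    by rewrite addrAC subrr add0r.
  rewrite t0 scale0r addr0 in Uy *.
  by have : (W `&` U) w by []; rewrite W0.
have WW' : W `<=` W'.
  by move=> w Ww; exists w, 0; rewrite addr0; split=> //; exact: sub_0 hJx.
have : P (kdim W') by apply/asboolP; exists W'.
move/kmax; rewrite -dW => le.
have eW : W = W' by apply: (kdim_eq hV) => //; exact: ksub_submodule.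
have [i [j [Ii Jj e1]]] := IJT 1.
have j0 : j = 0.
  apply: J0 => //; have : W' ((j : S) *: x).
    by exists 0, ((j : S) *: x); rewrite add0r; split=> //; [exact: sub_0 | exists j].
  by rewrite -eW => hw; exists 0, ((j : S) *: x); rewrite add0r; split=> //; exact: sub_0.
apply: hx; have : I i by []; rewrite /I /=.
have -> : i = 1 :> S by rewrite e1 j0 addr0.
by rewrite scale1r => -[u [w [? ? ->]]]; exists u, w.
Qed.

End Semisimple.

Section TopPart.
Variables (K : fieldType) (A : falgType K) (gr : int -> {vspace A}).
Variables (Am T Ap : {aspace A}).
Hypothesis hgr : graded_algebra gr.
Hypothesis htri : triangular_decomposition gr Am T Ap.
Notation gs := (alg_grading gr).
Notation S := (subvs_of T).
Notation grS := (@sub_grading K A gr T).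
Let hA := tri_galgebra hgr.
Let hS := T_galgebra hgr htri.

Definition resT (M : lmodType A) : lmodType S :=
  @mklmod S M (fun t x => vsval t *: x)
    (fun a b v => scalerA (vsval a) (vsval b) v)
    (fun v => etrans (congr1 (fun c => c *: v) (vsval1 htri)) (scale1r v))
    (fun a => scalerDr (vsval a)) (fun v a b => scalerDl v (vsval a) (vsval b)).

Lemma resT_fd (M : lmodType A) : fd (kmod M) -> fd (kmod (resT M)).
Proof.
have fl : linear ((fun x => x) : kmod M -> kmod (resT M)).
  move=> k x y; congr (_ + _).
  by change (k%:A *: (x : M) = vsval (k%:A : S) *: (x : M)); rewrite (vsvalK htri).
by move=> hM; apply: (@fd_surj _ _ _ (mklin fl)) => // y; exists y.
Qed.

(** The T-module V put in the single degree d; T acts in degree 0. *)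
Definition conc_comp (V : lmodType S) (d i : int) : set V :=
  if i == d then setT else [set 0].

Lemma conc_grading (V : lmodType S) d : grading (@conc_comp V d).
Proof.
split=> [i|i x y|x|s f us hf e i si]; rewrite /conc_comp.
- by case: ifP.
- by case: ifP => // _ -> ->; rewrite subrr.
- exists [:: d], (fun i => if i == d then x else 0); split; last by rewrite big_seq1 eqxx.
  by move=> i; case: ifP.
- case: (eqVneq i d) => id; last by have := hf i; rewrite /conc_comp (negPf id).
  move: e; rewrite (bigD1_seq i) //= big1 ?addr0 // => j; rewrite id => ji.
  by have := hf j; rewrite /conc_comp (negPf ji).
Qed.

Lemma conc_act (V : lmodType S) d i j a (x : V) : grS i a -> @conc_comp V d j x ->
  @conc_comp V d (i + j) (a *: x).
Proof.
move=> ha; rewrite /conc_comp; case: (eqVneq j d) => [->|jd] hx; last first.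
  by rewrite hx scaler0; case: ifP.
case: (eqVneq i 0) => [->|i0]; first by rewrite add0r eqxx.
have -> : a = 0.
  apply: (gr_disj (galg_grading hS) ha (tri_T0 htri (subvsP a)) i0).
by rewrite scale0r; case: ifP.
Qed.

Definition concT (V : lmodType S) (d : int) (h : fd (kmod V)) : GT gr T :=
  mkgmod (conc_grading V d) (@conc_act V d) h.

Lemma concT_degree V d h : has_degree (@concT V d h) d.
Proof. by move=> x; rewrite /= /conc_comp eqxx. Qed.

Definition Tsub (M : lmodType A) (W : set M) : Prop :=
  [/\ W 0, forall x y, W x -> W y -> W (x + y) & forall (t : S) x, W x -> W (vsval t *: x)].

Lemma Tsub_resT (M : lmodType A) (W : set M) : Tsub W <-> submodule (W : set (resT M)).
Proof.
split=> [[h0 hD hZ]|h]; first by split=> // a u v hu hv; apply: hD => //; exact: hZ.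
by split; [exact: sub_0 h | move=> x y; exact: (sub_D h) | move=> t x; exact: (sub_Z h)].
Qed.

Lemma Tsub_ksub (M : lmodType A) (W : set M) : Tsub W -> ksub W.
Proof.
by case=> h0 hD hZ; apply: ksub_intro => // k x hx; rewrite -(vsvalK htri); exact: hZ.
Qed.

Lemma Tsub_exists (M : GA gr) (W : set M) d : Tsub W ->
  exists (lam : GT gr T) (j : lam -> M), [/\ has_degree lam d,
    forall x y, j (x + y) = j x + j y, forall t x, j (t *: x) = vsval t *: j x,
    injective j & forall x, W x <-> exists y, j y = x].
Proof.
move=> /Tsub_resT hW; have [V [i [inj iW]]] := submod_exists hW.
have hV : fd (kmod V).
  have il : linear (i : kmod V -> kmod (resT M)) by move=> k x y; exact: linearP.
  apply: (@fd_inj _ _ _ (mklin il)) => //; exact: resT_fd (gm_fd hA M).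
exists (concT d hV), i; split=> //; first exact: concT_degree.
- by move=> x y; exact: (linearD i).
- by move=> t x; exact: (linearZ_LR i).
Qed.

Lemma Tsub_comp (M : GA gr) d : Tsub (gm_comp M d).
Proof.
have h := gm_grading M; split; [exact: gr0 h d | exact: (grD h) |].
by move=> t x hx; rewrite -[d]add0r; apply: gm_act => //; exact: (tri_T0 htri (subvsP t)).
Qed.

Hypothesis hT : semisimple_ring S.

Lemma Tsub_complement (M : GA gr) (U W : set M) : Tsub U -> Tsub W -> U `<=` W ->
  exists V, [/\ Tsub V, V `<=` W, forall x, U x -> V x -> x = 0 &
    forall x, W x -> exists u v, [/\ U u, V v & x = u + v]].
Proof.
move=> hU hW UW.
have [V0 [/Tsub_resT hV [V0U VT]]] := semisimple_complement hT (resT_fd (gm_fd hA M))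
  ((Tsub_resT U).1 hU).
exists (V0 `&` W); split.
- case: hV => a b c; case: hW => a' b' c'; split=> // [x y [? ?] [? ?]|t x [? ?]].
    by split; [exact: b | exact: b'].
  by split; [exact: c | exact: c'].
- by move=> x [].
- by move=> x Ux [Vx _]; have : (U `&` V0) x by []; rewrite V0U.
- move=> x Wx; have [u [v [Uu Vv e]]] := VT x; exists u, v; split=> //; split=> //.
  have kW := Tsub_ksub hW.
  have -> : v = x - u by rewrite e [u + v]addrC addrK.
  by apply: ksub_B => //; exact: UW.
Qed.

Lemma Tsub_simple (M : GA gr) (W : set M) d : Tsub W -> (exists2 x, W x & x <> 0) ->
  exists (lam : GT gr T) (j : lam -> M), [/\ gsimple lam, has_degree lam d &
    [/\ forall x y, j (x + y) = j x + j y, forall t x, j (t *: x) = vsval t *: j x,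
    injective j & forall y, W (j y)]].
Proof.
move=> hW [x Wx x0].
have [|U [hU UW [u Uu u0]] hmin] := @kdim_min _ _ M
    (fun U : set M => [/\ Tsub U, U `<=` W & exists2 x, U x & x <> 0]).
  by exists W; split=> //; exists x.
have [lam [j [hd jD jZ inj jU]]] := Tsub_exists d hU.
have j0 : j 0 = 0 by apply: (addIr (j 0)); rewrite -jD !add0r.
exists lam, j; split=> //; last first.
  by split=> // y; apply/UW/jU; exists y.
split.
  have /jU[y ye] := Uu; exists y => e; apply: u0.
  by rewrite -ye e.
move=> V [hV _].
have [|V0] := pselect (exists2 v, V v & v <> 0); last first.
  left; apply/seteqP; split=> v; last by move=> ->; exact: sub_0.
  by move=> Vv; apply: contrapT => v0; apply: V0; exists v.
move=> [v Vv v0]; right.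
have jV : Tsub (j @` V).
  split; first by exists 0 => //; exact: sub_0.
    by move=> _ _ [a Va <-] [b Vb <-]; exists (a + b) => //; exact: sub_D.
  by move=> t _ [a Va <-]; exists (t *: a) => //; exact: sub_Z.
have jVU : j @` V `<=` U by move=> _ [a _ <-]; apply/jU; exists a.
have e : j @` V = U.
  apply: (kdim_eq (gm_fd hA M)) => //; try exact: Tsub_ksub.
  apply: hmin; split=> //; first by move=> y /jVU/UW.
  by exists (j v); [exists v | rewrite -j0 => /inj].
apply/seteqP; split=> // y _; have : U (j y) by apply/jU; exists y.
by rewrite -e => -[z Vz /inj <-].
Qed.

End TopPart.

(** * Filtrations and dimension equalities *)
Section GoodFiltrations.
Variables (K : fieldType) (A : falgType K) (gr : int -> {vspace A}).
Variables (Am T Ap : {aspace A}).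
Hypothesis hgr : graded_algebra gr.
Hypothesis htri : triangular_decomposition gr Am T Ap.
Notation gs := (alg_grading gr).
Notation S := (subvs_of T).
Notation n := (\dim Am).
Notation p := (\dim Ap).
Notation NP := (Npos gr Ap).
Notation NM := (Nneg gr Am).
Let hA := tri_galgebra hgr.
Let hg := galg_grading hA.
Let hS := T_galgebra hgr htri.

Definition bounded (M : GA gr) (d : int) := forall i x, d < i -> gm_comp M i x -> x = 0.

(** Elements of N^- have negative degree. *)
Lemma Nact_top (M : GA gr) d y : bounded M d -> Nact NM setT y -> pr M d y = 0.
Proof.
move=> hM [m [b [x [hx ->]]]]; rewrite gpr_sum; last exact: gm_grading.
rewrite big1 // => l _; have [[bA b0] _] := hx l.
have [s [us _ bE]] := gpr_supp hg (b l).
rewrite bE scaler_suml gpr_sum ?big1 // => [i _|]; last exact: gm_grading.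
case: (ltP i 0) => i0; last first.
  have [->|i1] : i = 0 \/ 0 < i by lia.
    by rewrite b0 scale0r; exact: (gpr0 (gm_grading M)).
  by rewrite (tri_Am_high hgr htri bA) // scale0r; exact: (gpr0 (gm_grading M)).
rewrite -[d](subrK i) addrC (pr_act (M := M)); last exact: (gpr_in hg).
by rewrite (hM (d - i) (pr M (d - i) (x l))) ?scaler0 //; [lia | exact: pr_in].
Qed.

(** The image Z of Delta(lam) -> M has at most n dim lam dimensions, and its generators
    j(lam), of top degree, are disjoint from N^- M; so [Nfree_cut] applies, and
    dim Z = dim Delta(lam) gives injectivity. *)
Lemma delta_embed (M D : GA gr) (lam : GT gr T) d (j : lam -> M) :
  bounded M d -> has_degree lam d -> is_standard Ap lam D ->
  (forall x y, j (x + y) = j x + j y) -> (forall t x, j (t *: x) = vsval t *: j x) ->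
  injective j -> (forall x, gm_comp M d (j x)) -> Nfree NM n [set: M] ->
  exists (tau : A -> lam -> D) (h : {linear D -> M}),
    [/\ is_induced_by (gr := gs) (grS := @sub_grading K A gr T) (fun t : S => vsval t)
          (vs_set (Ap * T)%VS) tau,
        degree_preserving h, injective h, forall a x, h (tau a x) = a *: j x &
        forall (Q : GA gr) (q : {linear M -> Q}), (forall y, exists x, q x = y) ->
          (forall x, q x = 0 <-> (h @` setT) x) -> Nfree NM n [set: Q]].
Proof.
move=> hM hd [tau hP] jD jZ inj jd gM.
have [h [dh hE]] := std_map hgr htri hP hd hM jD jZ jd.
have fM := gm_fd hA M; have fD := gm_fd hA D; have fl := gm_fd hS lam.
have jk : klin setT j.
  by move=> k x y _ _; rewrite jD jZ (vsvalK htri).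
have j0 : j 0 = 0 by apply: (addIr (j 0)); rewrite -jD !add0r.
have kW : ksub (j @` setT) by apply: ksub_img jk; exact: ksubT.
have dW : kdim (j @` setT) = kdim [set: lam].
  by apply: (kdim_inj fl fM (ksubT _) jk) => x _ e; apply: inj; rewrite e j0.
have gZ : graded_submodule (h @` setT) by apply: gsubm_img dh _; exact: gsubm_T.
have hZ := gsubm_sub gZ.
have WZ : j @` setT `<=` h @` setT.
  by move=> _ [x _ <-]; exists (tau 1 x) => //; rewrite hE scale1r.
have W0 : j @` setT `&` Nact NM setT = [set 0].
  apply/seteqP; split=> y; last first.
    by move=> ->; split; [exists 0 | exact: ksub_0 (ksub_Nact (ksubT _))].
  by case=> -[x _ <-] /(Nact_top hM); rewrite (pr_id (jd x)).
have dD : kdim [set: D] = (n * kdim [set: lam])%N by exact: (std_kdim hgr htri hP).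
have rk : kdim [set: D] = (kdim (h @` setT) + kdim [set x | h x = 0%R])%N.
  by have := kdim_rank fD fM (ksubT D) (klin_lin h); rewrite setTI.
have dZ : (kdim (h @` setT) <= n * kdim (j @` setT))%N.
  by rewrite dW -dD rk leq_addr.
have cut (Q : GA gr) (q : {linear M -> Q}) : (forall y, exists x, q x = y) ->
    (forall x, q x = 0 <-> (h @` setT) x) ->
    kdim (h @` setT) = (n * kdim (j @` setT))%N /\ Nfree NM n [set: Q].
  move=> qs kq.
  exact: (Nfree_cut (local_Am hgr htri) fM (gm_fd hA Q) qs hZ kq kW WZ W0 dZ gM).
exists tau, h; split=> //; last by move=> Q q qs kq; case: (cut Q q qs kq).
have [Q [q [_ qs kq _]]] := gquot_exists hA gZ.
have [e _] := cut Q q qs kq.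
have k0 : kdim [set x | h x = 0] = 0%N.
  by move: rk; rewrite e dW -dD => /eqP; rewrite -[X in X == _]addn0 eqn_add2l eq_sym => /eqP.
have ker0 : [set x | h x = 0] = [set 0].
  apply: (kdim_eq0 fD) => //; apply: ksub_submodule.
  by apply: gsubm_sub; exact: gsubm_ker.
move=> x y exy; apply/eqP; rewrite -subr_eq0; apply/eqP.
have : [set x | h x = 0] (x - y) by rewrite /= linearB exy subrr.
by rewrite ker0.
Qed.

(** On the socle over A^+, F vanishes exactly where pi does, since A = A^- T A^+; and pi is
    onto there because A^+ acts on the top degree through its augmentation.  So
    [Ncofree_cut] applies. *)
Lemma nabla_surj (M N : GA gr) (lam : GT gr T) d (pi : M -> lam)
    (F : {linear M -> N}) :
  bounded M d ->
  kdim [set: N] = (p * kdim [set: lam])%N ->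
  coprojection d pi -> (forall y, exists2 x, gm_comp M d x & pi x = y) ->
  (forall x, F x = 0 <-> forall a, pi (a *: x) = 0) -> Ncofree NP p [set: M] ->
  (forall y, exists x, F x = y) /\ Ncofree NP p [set x | F x = 0].
Proof.
move=> hM dN hpi pis FE gM.
have fM := gm_fd hA M; have fN := gm_fd hA N; have fl := gm_fd hS lam.
have [piD piT _] := hpi.
apply: (Ncofree_cut (f := F) (local_Ap hgr htri) fM fN fl (coproj_klin (U := setT) htri hpi)) => //.
- move=> x [_ hx]; rewrite FE; split=> [/(_ 1)|px a]; first by rewrite scale1r.
  move: a; apply: (tri_ind htri) => [a b ha hb|k a ha|a t z ha ht hz].
  + by rewrite scalerDl piD ha hb addr0.
  + rewrite -[k *: a]mul1r -[1 * _]scalerAr scalerAl -scalerA (coprojK htri hpi) ha.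
    exact: scaler0.
  have -> : (a * t * z) *: x = (eps gr z)%:A *: ((a * t) *: x).
    rewrite -scalerA (_ : z *: x = (eps gr z)%:A *: x) ?scaleK_comm //.
    apply/eqP; rewrite -subr_eq0 -scalerBl; apply/eqP/hx; split.
      by rewrite memvB // memvZ // (tri_1Ap htri).
    by rewrite gprB // (gpr_K hgr) (eps_Ap hgr htri hz) subrr.
  rewrite (coprojK htri hpi) (_ : pi _ = 0) ?scaler0 //.
  have -> : a = (a - (eps gr a)%:A) + (eps gr a)%:A by rewrite subrK.
  rewrite mulrDl scalerDl piD -!scalerA (coprojK htri hpi) -[t]/(vsval (Subvs ht)).
  rewrite piT px !scaler0 addr0; apply: (coproj_neg hgr hpi) => // i i0.
  have [->|i1] : i = 0 \/ 0 < i by lia.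
    by rewrite gprB // (gpr_K hgr) (eps_Am hgr htri ha) subrr.
  apply: (tri_Am_high hgr htri) => //.
  by rewrite memvB // memvZ // (tri_1Am htri).
- apply/seteqP; split=> // y _; have [x hx <-] := pis y; exists x => //; split=> //.
  move=> b [hb b0]; apply: (pos_kills hgr hM) => // i i1.
  have [->//|i0] : i = 0 \/ i < 0 by lia.
  exact: (tri_Ap_low hgr htri hb).
Qed.

Lemma kdim_setT_eq0 (M : GA gr) : kdim [set: M] = 0%N -> forall x : M, x = 0.
Proof.
move=> e x; have : [set: M] x by [].
by rewrite (kdim_eq0 (gm_fd hA M) (ksubT M) e).
Qed.

Notation std_filtered := (filtered_by (fun X : GA gr => exists2 mu : GT gr T,
  gsimple mu & is_standard Ap mu X)).
Notation costd_filtered := (filtered_by (fun X : GA gr => exists2 mu : GT gr T,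
  gsimple mu & is_costandard Am mu X)).

Lemma std_filtered_Nfree (M : GA gr) : std_filtered M -> Nfree NM n [set: M].
Proof.
move=> hM; apply: (filtration_ind (R := fun U => Nfree NM n U) _ _ hM);
  first exact: (Nfree_0 _ _ (gm_fd hA M)).
move=> U W X gU gW UW [f [f1 _ f3 f4]] [mu smu [tau hP]] gd.
have [d hd] := gsimple_degree htri smu.
have gX := std_Nfree hgr htri hP hd.
exact: (Nfree_ext (local_Am hgr htri) (gm_fd hA M) (gm_fd hA X) (gsubm_sub gU)
  (gsubm_sub gW) UW f1 f3 f4 gd gX).
Qed.

Lemma costd_filtered_Ncofree (M : GA gr) : costd_filtered M -> Ncofree NP p [set: M].
Proof.
move=> hM; apply: (filtration_ind (R := fun U => Ncofree NP p U) _ _ hM);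
  first exact: (Ncofree_0 _ _ (gm_fd hA M)).
move=> U W X gU gW UW [f [f1 _ f3 f4]] [mu smu hX] gd.
have [d hd] := gsimple_degree htri smu.
have [pX [_ _ gX _ _]] := costandardP hgr htri hd hX.
exact: (Ncofree_ext (local_Ap hgr htri) (gm_fd hA M) (gm_fd hA X)
  (gsubm_sub gW) UW f1 f3 f4 gd gX).
Qed.

(** By induction on the dimension: split off Delta(lam) as a submodule, for a simple lam in
    the top degree. *)
Lemma Nfree_std_filtered (M : GA gr) : Nfree NM n [set: M] -> std_filtered M.
Proof.
move: {2}(kdim [set: M]) (leqnn (kdim [set: M])) => k.
elim: k M => [|k IH] M hk gM.
  apply: filtered_nil; apply: kdim_setT_eq0; apply/eqP; by rewrite -leqn0.
have [hM|/contrapT hM] := pselect (~ exists x : M, x <> 0).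
  by apply: filtered_nil => x; apply: contrapT => x0; apply: hM; exists x.
have [d [dx dM]] := top_degree_ex hA hM.
have [lam [j [slam hd [jD jZ inj jd]]]] := Tsub_simple hgr htri d (Tsub_comp htri M d) dx.
have [D hD] := standard_exists hgr htri hd.
have [tau [h [hP dh injh hE cut]]] := delta_embed dM hd hD jD jZ inj jd gM.
have gZ : graded_submodule (h @` setT) by apply: gsubm_img dh _; exact: gsubm_T.
have [Q [q [dq qs kq _]]] := gquot_exists hA gZ.
apply: (filtered_cons dq qs kq (subquotient_embed dh injh)); first by exists lam.
apply: IH; last exact: cut.
have h0 : h @` setT <> [set 0].
  have [[y y0] _] := slam => e; apply: y0; apply: inj.
  have : (h @` setT) (j y) by exists (tau 1 y) => //; rewrite hE scale1r.
  by rewrite e => ->; apply: (addIr (j 0)); rewrite -jD !add0r.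
rewrite -ltnS; apply: leq_trans hk.
exact: (kdim_quotient_lt hA qs kq (gsubm_sub gZ) h0).
Qed.

Hypothesis hT : semisimple_ring S.

(** A T-complement of the image of j in M_d provides the retraction. *)
Lemma coprojection_exists (M : GA gr) d (lam : GT gr T) (j : lam -> M) :
  has_degree lam d -> (forall x y, j (x + y) = j x + j y) ->
  (forall t x, j (t *: x) = vsval t *: j x) -> injective j ->
  (forall x, gm_comp M d (j x)) ->
  exists pi : M -> lam, coprojection d pi /\ forall x, pi (j x) = x.
Proof.
move=> hd jD jZ inj jd.
have j0 : j 0 = 0 by apply: (addIr (j 0)); rewrite -jD !add0r.
have tU : Tsub T (j @` setT : set M).
  split; first by exists 0.
    by move=> _ _ [a _ <-] [b _ <-]; exists (a + b).
  by move=> t _ [a _ <-]; exists (t *: a).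
have Ud : j @` setT `<=` gm_comp M d by move=> _ [x _ <-].
have [V [tV VM V0 VT]] := Tsub_complement hgr htri hT tU (Tsub_comp htri M d) Ud.
have hx (x : M) : exists y, exists2 v, V v & pr M d x = j y + v.
  have [_ [v [[y _ <-] Vv e]]] := VT _ (pr_in (M := M) d x).
  by exists y, v.
have [pi hpi] := choice hx.
have VB x y : V x -> V y -> V (x - y) by apply: ksub_B; exact: (Tsub_ksub htri tV).
have jB x y : j (x - y) = j x - j y by apply: (addIr (j y)); rewrite -jD !subrK.
have piE x y v : V v -> pr M d x = j y + v -> pi x = y.
  move=> Vv e; have [v' Vv' e'] := hpi x.
  have h : j (pi x - y) = v - v'.
    by rewrite jB; apply/eqP; rewrite subr_eq addrAC eq_sym subr_eq -e' e addrC.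
  apply/eqP; rewrite -subr_eq0; apply/eqP; apply: inj; rewrite j0.
  by apply: V0; [exists (pi x - y) | rewrite h; exact: VB].
have [_ VD VZ] := tV.
exists pi; split; first split.
- move=> x y; have [v Vv e] := hpi x; have [v' Vv' e'] := hpi y.
  apply: (piE _ _ (v + v')); first exact: VD.
  by rewrite (gprD (gm_grading M)) e e' jD addrACA.
- move=> t x; have [v Vv e] := hpi x.
  apply: (piE _ _ (vsval t *: v)); first exact: VZ.
  rewrite -[d]add0r (pr_act (M := M)); last exact: (tri_T0 htri (subvsP t)).
  by rewrite e scalerDr jZ.
- move=> i x id hi; apply: (piE _ _ 0); first by case: tV.
  by rewrite (gpr_neq (gm_grading M) hi) 1?eq_sym // j0 addr0.
- move=> x; apply: (piE _ _ 0); first by case: tV.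
  by rewrite addr0 (pr_id (jd x)).
Qed.

(** By induction on the dimension: split off nabla(lam) as a quotient, for a simple lam in
    the top degree. *)
Lemma Ncofree_costd_filtered (M : GA gr) : Ncofree NP p [set: M] -> costd_filtered M.
Proof.
move: {2}(kdim [set: M]) (leqnn (kdim [set: M])) => k.
elim: k M => [|k IH] M hk gM.
  apply: filtered_nil; apply: kdim_setT_eq0; apply/eqP; by rewrite -leqn0.
have [hM|/contrapT hM] := pselect (~ exists x : M, x <> 0).
  by apply: filtered_nil => x; apply: contrapT => x0; apply: hM; exists x.
have [d [dx dM]] := top_degree_ex hA hM.
have [lam [j [slam hd [jD jZ inj jd]]]] := Tsub_simple hgr htri d (Tsub_comp htri M d) dx.
have [pi [hpi pij]] := coprojection_exists hd jD jZ inj jd.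
have [N hN] := costandard_exists hgr htri hd.
have [piN [_ dN _ _ univ]] := costandardP hgr htri hd hN.
have [F [dF piF FE]] := univ M pi dM hpi.
have pis y : exists2 x, gm_comp M d x & pi x = y by exists (j y).
have [Fs gU] := nabla_surj dM dN hpi pis FE gM.
have gK : graded_submodule [set x | F x = 0] by exact: gsubm_ker.
have [X [i [iinj iU icomp]]] := gsub_exists hA gK.
apply: (filtered_rcons iinj iU icomp dF Fs (fun x => iff_refl _)); first by exists lam.
have fM := gm_fd hA M; have fN := gm_fd hA N; have fX := gm_fd hA X.
have eI : i @` setT = [set x | F x = 0].
  by apply/seteqP; split=> x; [case=> y _ <-; apply/iU; exists y | case/iU => y <-; exists y].
apply: IH; last first.
  by apply: (Ncofree_embed (f := i) fM fX iinj); rewrite eI.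
have dX : kdim [set: X] = kdim [set x | F x = 0].
  rewrite -eI; apply/esym/(kdim_inj fX fM (ksubT _) (klin_lin i)).
  by move=> x _ e; apply: iinj; rewrite e linear0.
have rk : kdim [set: M] = (kdim (F @` setT) + kdim [set x | F x = 0%R])%N.
  by have := kdim_rank fM fN (ksubT M) (klin_lin F); rewrite setTI.
have hZ : (0 < kdim (F @` setT))%N.
  rewrite lt0n; apply/eqP => e0.
  have gI : graded_submodule (F @` setT) by apply: gsubm_img dF _; exact: gsubm_T.
  have e1 := kdim_eq0 fN (ksub_submodule (gsubm_sub gI)) e0.
  have [[y y0] _] := slam.
  have : (F @` setT) (F (j y)) by exists (j y).
  rewrite e1 => Fy; apply: y0; rewrite -(pij y).
  by have := (FE (j y)).1 Fy 1; rewrite scale1r.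
rewrite dX; move: hk; rewrite rk => hk; rewrite -ltnS; apply: leq_trans hk.
by rewrite -add1n leq_add2r.
Qed.

End GoodFiltrations.

(** * Projective-injective objects *)
Section ProjectiveInjective.
Variables (K : fieldType) (A : falgType K) (gr : int -> {vspace A}).
Variables (Am T Ap : {aspace A}).
Hypothesis hgr : graded_algebra gr.
Hypothesis htri : triangular_decomposition gr Am T Ap.
Notation gs := (alg_grading gr).
Notation S := (subvs_of T).
Notation n := (\dim Am).
Notation p := (\dim Ap).
Notation NP := (Npos gr Ap).
Notation NM := (Nneg gr Am).
Let hA := tri_galgebra hgr.

Definition ginjective (P : GA gr) : Prop :=
  forall (X Y : GA gr) (i : {linear X -> Y}) (g : {linear X -> P}),
    degree_preserving i -> degree_preserving g -> injective i ->
    exists h : {linear Y -> P}, degree_preserving h /\ forall x, h (i x) = g x.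

Definition gprojective (P : GA gr) : Prop :=
  forall (M N : GA gr) (f : {linear M -> N}) (g : {linear P -> N}),
    degree_preserving f -> degree_preserving g -> (forall y, exists x, f x = y) ->
    exists h : {linear P -> M}, degree_preserving h /\ forall x, f (h x) = g x.

(** The properties of the direct summands of the shifts of A that are used. *)
Definition projinj (P : GA gr) : Prop :=
  [/\ Nfree NM n [set: P], Ncofree NP p [set: P], ginjective P & gprojective P].

(** Maps out of the shift by s are the elements of degree s. *)
Lemma shift_projinj s : self_injective A -> projinj (shiftA hA s).
Proof.
move=> sA; split; first exact: (Nfree_regular hgr htri).
- exact: (Ncofree_regular hgr htri sA).
- move=> X Y i g di dg inj; have [h hE] := sA X Y i g inj.
  have [h0 [d0 h0E]] := graded_part hA (M := Y) (N := shiftA hA s) h.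
  exists h0; split=> // x; have [t [_ _ tE]] := gm_supp hA X.
  rewrite [x]tE !linear_sum; apply: eq_bigr => k _.
  have xk : gm_comp X k (pr X k x) by exact: pr_in.
  by rewrite (h0E k) ?hE //; [exact: di | exact: dg].
- move=> M N f g df dg fs.
  have [m0 m0E] := fs (g (1 : A)).
  have g1 : gm_comp N s (g (1 : A)).
    by apply: dg; rewrite /= subrr; case: hgr.
  pose m := pr M s m0.
  have mE : f m = g (1 : A) by rewrite /m -(pr_map df) m0E (pr_id g1).
  have hl : linear (fun a : shiftA hA s => (a : A) *: m).
    by move=> a u v; rewrite scalerDl -[a *: u]/(a * u : A) scalerA.
  exists (mklin hl); split=> [i x|x] /=.
    move=> xi; rewrite -[i](subrK s); apply: gm_act => //; exact: pr_in.
  by rewrite linearZ mE -linearZ /= /GRing.scale /= mulr1.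
Qed.

Lemma retract_projinj (P Q : GA gr) (i : {linear P -> Q}) (r : {linear Q -> P}) :
  degree_preserving i -> degree_preserving r -> (forall x, r (i x) = x) ->
  projinj Q -> projinj P.
Proof.
move=> di dr ri [gd gc jQ pQ].
have fP := gm_fd hA P; have fQ := gm_fd hA Q.
have hU : submodule (i @` setT) by apply: gsubm_sub (gsubm_img di _); exact: gsubm_T.
have hW : submodule [set x | r x = 0] by apply: gsubm_sub (gsubm_ker dr).
have U0 : i @` setT `&` [set x | r x = 0] = [set 0].
  apply/seteqP; split=> [_ [[y _ <-]] /=|_ ->]; first by rewrite ri => ->; rewrite linear0.
  by split; [exists 0; rewrite ?linear0 | rewrite /= linear0].
have UT : setadd (i @` setT) [set x | r x = 0] = setT.
  apply/seteqP; split=> // x _; exists (i (r x)), (x - i (r x)); split.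
  - by exists (r x).
  - by rewrite /= linearB ri subrr.
  - by rewrite addrC subrK.
have inj : injective i by move=> x y e; rewrite -(ri x) e ri.
split.
- apply: (Nfree_embed fQ fP inj).
  exact: (Nfree_summand (local_Am hgr htri) fQ hU hW U0 UT gd).
- apply: (Ncofree_embed fQ fP inj).
  exact: (Ncofree_summand (local_Ap hgr htri) fQ hU hW U0 UT gc).
- move=> X Y k g dk dg kinj.
  have dig : degree_preserving (mklin (comp_linear i g)) by move=> j x xj; apply/di/dg.
  have [h [dh hE]] := jQ X Y k _ dk dig kinj.
  exists (mklin (comp_linear r h)); split=> [j x xj|x] /=; first exact/dr/dh.
  by rewrite hE /= ri.
- move=> M N f g df dg fs.
  have dgr : degree_preserving (mklin (comp_linear g r)) by move=> j x xj; apply/dg/dr.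
  have [h [dh hE]] := pQ M N f _ df dgr fs.
  exists (mklin (comp_linear h i)); split=> [j x xj|x] /=; first exact/dh/di.
  by rewrite hE /= ri.
Qed.

Lemma summand_retract (M : GA gr) (U W : set M) :
  graded_submodule U -> graded_submodule W -> internal_dsum U W ->
  exists (P : GA gr) (i : {linear P -> M}) (r : {linear M -> P}),
    [/\ degree_preserving i /\ degree_preserving r, forall x, r (i x) = x,
        forall x, U x <-> exists y, i y = x & forall x, W x -> r x = 0].
Proof.
move=> gU gW [UW0 UWT]; have hU := gsubm_sub gU; have hW := gsubm_sub gW.
have [P [i [inj iU icomp]]] := gsub_exists hA gU.
have hr x : exists y, W (x - i y).
  have [u [w [Uu Ww ->]]] := UWT x; have [y <-] := (iU u).1 Uu.
  by exists y; rewrite addrC addKr.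
have [r rW] := choice hr.
have ru x y : W (x - i y) -> r x = y.
  move=> h; apply: inj; apply/eqP; rewrite -subr_eq0; apply/eqP.
  suff : (U `&` W) (i (r x) - i y) by rewrite UW0.
  split; first by apply: (sub_B hU); apply/iU; eexists.
  have -> : i (r x) - i y = (x - i y) - (x - i (r x)) by rewrite opprB [RHS]addrC addrA subrK.
  exact: (sub_B hW).
have rl : linear r.
  move=> a x y; apply: ru; rewrite linearP opprD addrACA -scalerBr.
  by case: hW => _; apply.
have di : degree_preserving i by move=> k x /icomp.
exists P, i, (mklin rl); split=> //=.
- split=> // k x xk; apply/icomp; have gm := gm_grading M.
  have -> : i (r x) = pr M k (i (r x)); last exact: pr_in.
  rewrite (pr_map di); congr (i _); apply: ru.
  by rewrite -(pr_map di) -{1}(pr_id xk) -gprB //; apply: gsubm_pr.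
- by move=> x; apply: ru; rewrite subrr; case: hW.
- by move=> x Wx; apply: ru; rewrite linear0 subr0.
Qed.

(** Delta(M_d) embeds in M as M is free over A^-, and maps to P by g; injectivity of P
    extends this to M. *)
Lemma extend_top (M P : GA gr) d (g : M -> P) :
  bounded M d -> bounded P d -> Nfree NM n [set: M] -> ginjective P ->
  (forall x y, gm_comp M d x -> gm_comp M d y -> g (x + y) = g x + g y) ->
  (forall (t : S) x, gm_comp M d x -> g (vsval t *: x) = vsval t *: g x) ->
  (forall x, gm_comp M d x -> gm_comp P d (g x)) ->
  exists h : {linear M -> P}, degree_preserving h /\ forall x, gm_comp M d x -> h x = g x.
Proof.
move=> bM bP gM jP gD gZ gd.
have [lam [j [hd jD jZ inj jW]]] := Tsub_exists hgr htri d (Tsub_comp htri M d).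
have jd x : gm_comp M d (j x) by apply/jW; exists x.
have [D hD] := standard_exists hgr htri hd.
have [tau [k [hP dk injk kE _]]] := delta_embed hgr htri bM hd hD jD jZ inj jd gM.
have gjD x y : g (j (x + y)) = g (j x) + g (j y) by rewrite jD gD.
have gjZ t x : g (j (t *: x)) = vsval t *: g (j x) by rewrite jZ gZ.
have [f [df fE]] := std_map hgr htri hP hd bP gjD gjZ (fun x => gd _ (jd x)).
have [h [dh hE]] := jP D M k f dk df injk.
exists h; split=> // x /jW [y <-].
by have := hE (tau 1 y); rewrite kE fE !scale1r.
Qed.

(** Both modules map to nabla(lam), M onto since it is cofree over A^+; projectivity of P
    lifts its map to M. *)
Lemma lift_top (M P : GA gr) (lam : GT gr T) d (piM : M -> lam) (piP : P -> lam) :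
  bounded M d -> bounded P d -> has_degree lam d -> Ncofree NP p [set: M] -> gprojective P ->
  coprojection d piM -> (forall y, exists2 x, gm_comp M d x & piM x = y) ->
  coprojection d piP ->
  exists h : {linear P -> M}, degree_preserving h /\ forall x, piM (h x) = piP x.
Proof.
move=> bM bP hd gM pP cM sM cP.
have [N hN] := costandard_exists hgr htri hd.
have [piN [_ dN _ _ univ]] := costandardP hgr htri hd hN.
have [F [dF piF FE]] := univ M piM bM cM.
have [G [dG piG _]] := univ P piP bP cP.
have [Fs _] := nabla_surj hgr htri bM dN cM sM FE gM.
have [h [dh hE]] := pP M N F G dF dG Fs.
by exists h; split=> // x; rewrite -piF hE piG.
Qed.

End ProjectiveInjective.

(** * Modules with a given top degree part *)
Section Tops.
Variables (K : fieldType) (A : falgType K) (gr : int -> {vspace A}).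
Variables (Am T Ap : {aspace A}).
Hypothesis hgr : graded_algebra gr.
Hypothesis htri : triangular_decomposition gr Am T Ap.
Notation gs := (alg_grading gr).
Notation S := (subvs_of T).
Let hA := tri_galgebra hgr.
Let hg := galg_grading hA.

(** j identifies lam with the degree d part of M, and M vanishes above d. *)
Record is_top (M : GA gr) (d : int) (lam : GT gr T) (j : lam -> M) : Prop := IsTop {
  top_bounded : bounded M d;
  top_hasdeg : has_degree lam d;
  topD : forall x y, j (x + y) = j x + j y;
  topZ : forall t x, j (t *: x) = vsval t *: j x;
  top_inj : injective j;
  top_in : forall x, gm_comp M d (j x);
  top_onto : forall x, gm_comp M d x -> exists y, j y = x }.

Lemma gsimple_sub (lam : GT gr T) d (U : set lam) : gsimple lam -> has_degree lam d ->
  U 0 -> (forall x y, U x -> U y -> U (x + y)) -> (forall (t : S) x, U x -> U (t *: x)) ->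
  (exists2 x, U x & x <> 0) -> U = setT.
Proof.
move=> sl hd U0 UD UZ [x Ux x0].
have hU : submodule U by split=> // a u v hu hv; apply: UD => //; exact: UZ.
by case: (gsimple_T sl hd hU) => // e; move: Ux; rewrite e => /x0.
Qed.

Lemma schur_T (lam mu : GT gr T) d (g : lam -> mu) :
  gsimple lam -> gsimple mu -> has_degree lam d -> has_degree mu d ->
  (forall x y, g (x + y) = g x + g y) -> (forall t x, g (t *: x) = t *: g x) ->
  (exists x, g x <> 0) -> giso lam mu.
Proof.
move=> sl sm hl hm gD gZ [x gx].
have g0 : g 0 = 0 by apply: (addIr (g 0)); rewrite -gD !add0r.
have glin : linear g by move=> a u v; rewrite gD gZ.
apply: (giso_bij (f := mklin glin)) => [i y yi|y z /= e|y] /=.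
- case: (eqVneq i d) => [->|id]; first exact: hm.
  by rewrite (gr_disj (gm_grading lam) yi (hl y) id) g0; exact: (gr0 (gm_grading mu)).
- apply: contrapT => yz; have : [set u | g u = 0] = setT.
    apply: (gsimple_sub sl hl) => //=.
    + by move=> u v hu hv; rewrite gD hu hv addr0.
    + by move=> t u hu; rewrite gZ hu scaler0.
    + exists (y - z); last by move/eqP; rewrite subr_eq0 => /eqP.
      by apply: (addIr (g z)); rewrite -gD subrK add0r.
  by move/seteqP => [_ /(_ x Logic.I)].
- have : g @` setT = setT.
    apply: (gsimple_sub sm hm) => //=.
    + by exists 0.
    + by move=> _ _ [u _ <-] [v _ <-]; exists (u + v).
    + by move=> t _ [u _ <-]; exists (t *: u).
    + by exists (g x) => //; exists x.
  by move/seteqP => [_ /(_ y Logic.I) [u _ e]]; exists u.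
Qed.

Lemma top_degree_nz (M : GA gr) d (lam : GT gr T) (j : lam -> M) : gsimple lam -> is_top d j ->
  exists2 x, gm_comp M d x & x <> 0.
Proof.
move=> [[y y0] _] h; exists (j y); first exact: (top_in h).
move=> e; apply: y0; apply: (top_inj h); rewrite e; apply: (addIr (j 0)).
by rewrite -(topD h) !add0r.
Qed.

Lemma top_weight (M : GA gr) d e (lam mu : GT gr T) (j : lam -> M) (k : mu -> M) :
  gsimple lam -> gsimple mu -> is_top d j -> is_top e k -> giso lam mu.
Proof.
move=> sl sm hj hk.
have [x xd x0] := top_degree_nz sl hj; have [y ye y0] := top_degree_nz sm hk.
have de : d = e.
  case: (ltgtP d e) => // h; first by case: y0; exact: (top_bounded hj) ye.
  by case: x0; exact: (top_bounded hk) xd.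
case: _ / de hk ye => hk yd.
have [g gE] := choice (fun u => top_onto hk (top_in hj u)).
apply: (schur_T (d := d) (g := g) sl sm (top_hasdeg hj) (top_hasdeg hk)).
- by move=> u v; apply: (top_inj hk); rewrite (topD hk) !gE (topD hj).
- by move=> t u; apply: (top_inj hk); rewrite (topZ hk) !gE (topZ hj).
- have [u uE] := top_onto hj xd; exists u => gu; apply: x0.
  rewrite -uE -gE gu; apply: (addIr (k 0)); by rewrite -(topD hk) !add0r.
Qed.

Lemma top_giso (M N : GA gr) d (lam : GT gr T) (j : lam -> M) : is_top d j -> giso M N ->
  exists k : lam -> N, is_top d k.
Proof.
move=> h [f [g [df dg fK gK]]]; exists (fun x => f (j x)); split=> //.
- by move=> i x di xi; rewrite -(gK x) (top_bounded h di (dg _ _ xi)) linear0.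
- exact: (top_hasdeg h).
- by move=> x y; rewrite (topD h) linearD.
- by move=> t x; rewrite (topZ h) linearZ.
- by move=> x y e; apply: (top_inj h); rewrite -(fK (j x)) e fK.
- by move=> x; apply/df/(top_in h).
- by move=> x /dg xd; have [y yE] := top_onto h xd; exists y; rewrite yE gK.
Qed.

Lemma top_weight_giso (M : GA gr) d (lam mu : GT gr T) (j : lam -> M) :
  is_top d j -> has_degree mu d ->
  giso lam mu -> exists k : mu -> M, is_top d k.
Proof.
move=> h hm [f [g [df dg fK gK]]]; exists (fun x => j (g x)); split=> //.
- exact: (top_bounded h).
- by move=> x y; rewrite linearD (topD h).
- by move=> t x; rewrite linearZ (topZ h).
- by move=> x y /(top_inj h) e; rewrite -(gK x) e gK.
- by move=> x; exact: (top_in h).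
- by move=> x /(top_onto h) [y <-]; exists (f y); rewrite fK.
Qed.

(** The largest submodule without component of degree d. *)
Definition core (M : GA gr) (d : int) : set M := [set x | forall a, pr M d (a *: x) = 0].
Arguments core : clear implicits.

Lemma core_graded M d : graded_submodule (core M d).
Proof.
have gM := gm_grading M.
apply: gsubm_intro; first split.
- by move=> a; rewrite scaler0; exact: (gpr0 gM).
- by move=> a u v hu hv b; rewrite scalerDr scalerA (gprD gM) hu hv addr0.
- move=> x i hx a; have [s [us _ aE]] := gpr_supp hg a.
  rewrite aE scaler_suml gpr_sum // big1 // => k _.
  have ak : gs k (gpr gs k a) by exact: gpr_in.
  case: (eqVneq d (k + i)) => [dE|dki]; last first.
    by apply: (gpr_neq gM _ dki); apply: gm_act => //; exact: pr_in.
  rewrite pr_id; last by rewrite dE; apply: gm_act => //; exact: pr_in.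
  by rewrite -(pr_act (M := M) i x ak) -dE hx.
Qed.

Section Standard.
Variables (lam : GT gr T) (D : GA gr) (tau : A -> lam -> D) (d : int).
Hypothesis hP : is_induced_by (gr := gs) (grS := @sub_grading K A gr T) (fun t : S => vsval t)
  (vs_set (Ap * T)%VS) tau.
Hypothesis hd : has_degree lam d.
Hypothesis sl : gsimple lam.

Lemma std_is_top : is_top d (tau 1 : lam -> D).
Proof.
have h := ind_data_A hgr htri.
split=> //.
- by move=> i x; exact: (std_high hgr htri hP hd).
- by move=> x y; exact: (ind_tauDr hP).
- by move=> t x; rewrite (ind_tauZ hP) mulr1 -(ind_tau_iota hA h hP) mul1r.
- move=> x y e; apply/eqP; rewrite -subr_eq0; apply/eqP.
  apply: (std_tau1_inj hgr htri hP).
  by apply: (addIr (tau 1 y)); rewrite -(ind_tauDr hP) subrK e add0r.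
- exact: (std_tau1_deg hgr hP hd).
- by move=> x xd; have [y ->] := std_top hgr htri hP hd xd; exists y.
Qed.

Lemma core_proper : core D d <> setT.
Proof.
have [x xd x0] := top_degree_nz sl std_is_top.
move/seteqP => [_ /(_ x Logic.I) /(_ 1)]; rewrite scale1r (pr_id xd); exact: x0.
Qed.

Lemma sub_core U : graded_submodule U -> U <> setT -> U `<=` core D d.
Proof.
move=> gU UT x Ux a; apply: contrapT => x0; apply: UT.
apply: (std_local hgr htri hP hd sl (gsubm_sub gU) _ _ x0); last exact: pr_in.
by apply: gsubm_pr => //; exact: (sub_Z (gsubm_sub gU) a Ux).
Qed.

(** By [std_local] a proper submodule has no component of degree d, so the core is the only
    maximal graded submodule. *)
Lemma gradical_std : gradical (M := D) = core D d.
Proof.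
have cm : maximal_graded_submodule (core D d).
  split; [exact: core_graded | exact: core_proper |].
  move=> W gW cW; have [->|WT] := pselect (W = setT); first by right.
  by left; apply/seteqP; split=> //; exact: sub_core.
apply/seteqP; split=> x hx; first exact: hx.
move=> U [gU UT hU]; case: (hU _ (core_graded D d) (sub_core gU UT)) => [<- //|e].
by case: core_proper.
Qed.

(** A simple module with top lam is Delta(lam) modulo its core. *)
Lemma top_cover (X : GA gr) (j : lam -> X) : gsimple X -> is_top d j ->
  exists f : {linear D -> X}, [/\ degree_preserving f, forall y, exists x, f x = y &
    forall x, f x = 0 <-> core D d x].
Proof.
move=> sX hj; have [f [df fE]] := std_map hgr htri hP hd (top_bounded hj) (topD hj) (topZ hj)
  (top_in hj).
have [y yd y0] := top_degree_nz sl hj; have [z zE] := top_onto hj yd.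
have fz : f (tau 1 z) = y by rewrite fE scale1r.
have kT : [set x | f x = 0] <> setT by move/seteqP => [_ /(_ (tau 1 z) Logic.I)] /=; rewrite fz.
exists f; split=> // [|x].
- have gI : graded_submodule (f @` setT) by apply: gsubm_img df _; exact: gsubm_T.
  case: (sX.2 _ gI) => e u.
    by case: y0; have : (f @` setT) y by [exists (tau 1 z)]; rewrite e.
  by have : (f @` setT) u by [rewrite e]; case=> v _ <-; exists v.
- split; first by apply: sub_core kT _; exact: gsubm_ker.
  move=> hx; case: (sX.2 _ (core_graded X d)) => e.
    suff : core X d (f x) by rewrite e.
    by move=> a; rewrite -linearZ (pr_map df) hx linear0.
  have : core X d y by rewrite e.
  by move=> /(_ 1); rewrite scale1r (pr_id yd) => /y0.
Qed.

Lemma head_top (L : GA gr) : is_head D L -> gsimple L /\ exists j : lam -> L, is_top d j.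
Proof.
case=> f [df fs fk].
have {}fk x : f x = 0 <-> core D d x by rewrite fk gradical_std.
have ht := std_is_top.
have [z zd z0] := top_degree_nz sl ht.
have top0 x : gm_comp D d x -> f x = 0 -> x = 0.
  by move=> xd /fk /(_ 1); rewrite scale1r (pr_id xd).
split; first split.
- by exists (f z) => /(top0 _ zd).
- move=> U gU; have gV := gsubm_preim df gU.
  have [VT|VT] := pselect (f @^-1` U = setT).
    right; apply/seteqP; split=> // y _; have [x <-] := fs y.
    by have : (f @^-1` U) x by rewrite VT.
  left; apply/seteqP; split=> [y Uy|_ ->]; last exact: sub_0 (gsubm_sub gU).
  by have [x xE] := fs y; rewrite /= -xE; apply/fk/(sub_core gV VT); rewrite /= xE.
exists (fun y => f (tau 1 y)); split=> //.
- move=> i x di xi; have [w wE] := fs x.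
  by rewrite -(pr_id xi) -wE (pr_map df) (top_bounded ht di (pr_in (M := D) i w)) linear0.
- by move=> x y; rewrite (topD ht) linearD.
- by move=> t x; rewrite (topZ ht) linearZ.
- move=> x y e; apply: (top_inj ht); apply/eqP; rewrite -subr_eq0; apply/eqP/top0.
    by apply: grB; [exact: gm_grading | exact: (top_in ht) | exact: (top_in ht)].
  by rewrite linearB e subrr.
- by move=> x; apply/df/(top_in ht).
- move=> x xd; have [w wE] := fs x; have [y yE] := top_onto ht (pr_in (M := D) d w).
  by exists y; rewrite yE -(pr_map df) wE (pr_id xd).
Qed.

End Standard.

Lemma simple_of_top (lam : GT gr T) d (L : GA gr) : gsimple lam -> has_degree lam d ->
  is_simple_of Ap lam L -> gsimple L /\ exists j : lam -> L, is_top d j.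
Proof. by move=> sl hd [D [tau hP] hL]; exact: (head_top hP hd sl hL). Qed.

Lemma top_unique (lam : GT gr T) d (X Y : GA gr) (j : lam -> X) (k : lam -> Y) :
  gsimple lam -> gsimple X -> gsimple Y -> is_top d j -> is_top d k -> giso X Y.
Proof.
move=> sl sX sY hj hk; have hd := top_hasdeg hj.
have [D [tau hP]] := standard_exists hgr htri hd.
have [f [df fs fk]] := top_cover hP hd sl sX hj.
have [g [dg gs' gk]] := top_cover hP hd sl sY hk.
have [h hE] := factor_linear (f := g) fs (fun x fx => (gk x).2 ((fk x).1 fx)).
apply: (giso_bij (f := h)) => [i x xi|x y|y].
- have [w wE] := fs x; rewrite -(pr_id xi) -wE (pr_map df) hE; apply: dg; exact: pr_in.
- have [w <-] := fs x; have [w' <-] := fs y; rewrite !hE => e.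
  apply/eqP; rewrite -subr_eq0 -linearB; apply/eqP/fk/gk.
  by rewrite linearB e subrr.
- by have [w <-] := gs' y; exists (f w); rewrite hE.
Qed.

End Tops.

(** * Highest weights *)
Section HighestWeight.
Variables (K : fieldType) (A : falgType K) (gr : int -> {vspace A}).
Variables (Am T Ap : {aspace A}).
Hypothesis hgr : graded_algebra gr.
Hypothesis htri : triangular_decomposition gr Am T Ap.
Notation gs := (alg_grading gr).
Notation S := (subvs_of T).
Let hA := tri_galgebra hgr.

Lemma subquotient_pr (M X : GA gr) (W : set M) (f : M -> X) : graded_submodule W ->
  (forall a u v, W u -> W v -> f (a *: u + v) = a *: f u + f v) ->
  (forall i u, W u -> gm_comp M i u -> gm_comp X i (f u)) ->
  forall i u, W u -> f (pr M i u) = pr X i (f u).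
Proof.
move=> gW fl fd i u Wu; have hW := gsubm_sub gW.
have f0 : f 0 = 0 by exact: (lin_on_0 hW fl).
have fD x y : W x -> W y -> f (x + y) = f x + f y.
  by move=> hx hy; rewrite -[x in LHS]scale1r fl // scale1r.
have fS (s : seq int) : f (\sum_(k <- s) pr M k u) = \sum_(k <- s) f (pr M k u).
  elim: s => [|k s IH]; first by rewrite !big_nil.
  rewrite !big_cons fD ?IH //; first exact: gsubm_pr.
  by apply: (sub_sum hW) => l _; exact: gsubm_pr.
have gX := gm_grading X; have gM := gm_grading M.
have [s [us s0 sE]] := gm_supp hA M.
have fk k : gm_comp X k (f (pr M k u)) by apply: fd; [exact: gsubm_pr | exact: pr_in].
rewrite [in RHS](sE u) fS gpr_sum //.
have [si|si] := boolP (i \in s).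
  rewrite (bigD1_seq i) //= big1 ?addr0 => [|k ki]; first by rewrite (pr_id (fk i)).
  by apply: (gpr_neq gX (fk k)); rewrite eq_sym.
rewrite (s0 i u si) f0 big1_seq // => k /andP[_ ks].
by apply: (gpr_neq gX (fk k)); apply: contraNneq si => ->.
Qed.

(** In a composition series of a module bounded by d, a factor isomorphic to L uses up the
    degree d part.  The two statements are proved together, as removing a simple
    submodule leads from the second situation to either of them. *)
Lemma multiplicity_top (lam : GT gr T) d (L : GA gr) (jL : lam -> L) k (M : GA gr) :
  gsimple lam -> gsimple L -> is_top d jL -> (kdim [set: M] <= k)%N -> bounded M d ->
  ((forall x, gm_comp M d x -> x = 0) -> composition_multiplicity M L 0) /\
  (forall j : lam -> M, is_top d j -> composition_multiplicity M L 1).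
Proof.
move=> sl sL hL; elim: k M => [|k IH] M hk bM.
  have M0 (x : M) : x = 0 by apply: (kdim_setT_eq0 hgr); apply/eqP; rewrite -leqn0.
  split=> [_|j hj].
    by exists [::]; split=> //; exact: filtration_nil.
  by have [x _ []] := top_degree_nz sl hj; exact: M0.
have [hM|/contrapT hM] := pselect (~ exists x : M, x <> 0).
  have M0 (x : M) : x = 0 by apply: contrapT => x0; apply: hM; exists x.
  split=> [_|j hj].
    by exists [::]; split=> //; exact: filtration_nil.
  by have [x _ []] := top_degree_nz sl hj; exact: M0.
have [U [X [Q [i [q [[sX ltQ] gU [inj iU icomp] [dq qs kq qcomp] sub]]]]]] :=
  simple_submodule hA hM.
have di : degree_preserving i by move=> l y /icomp.
have hQ : (kdim [set: Q] <= k)%N by rewrite -ltnS; exact: leq_trans ltQ hk.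
have bQ : bounded Q d by move=> l y dl /qcomp [x xl <-]; rewrite (bM _ _ dl xl) linear0.
have [IH0 IH1] := IH Q hQ bQ.
have notL : (forall x, gm_comp M d x -> U x -> x = 0) -> ~ giso X L.
  move=> h [f [g [df dg fK gK]]]; have [x xd x0] := top_degree_nz sl hL.
  apply: x0; rewrite -(gK x).
  have : i (g x) = 0 by apply: h; [apply/icomp/dg | apply/iU; exists (g x)].
  by rewrite -(linear0 i) => /inj ->; rewrite linear0.
split=> [Md|j hj].
  have := composition_cons dq qs kq sub sX (L := L) (n := 0%N).
  rewrite (asboolF (notL _)); last by move=> x xd _; exact: Md.
  by apply; apply: IH0 => y /qcomp [x /Md -> <-]; rewrite linear0.
have j0 : j 0 = 0 by apply: (addIr (j 0)); rewrite -(topD hj) !add0r.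
have jB x y : j (x - y) = j x - j y by apply: (addIr (j y)); rewrite -(topD hj) !subrK.
have hU := gsubm_sub gU.
have [h|/existsNP[u /not_implyP[ud /not_implyP[Uu u0]]]] :=
    pselect (forall x, gm_comp M d x -> U x -> x = 0).
  have := composition_cons dq qs kq sub sX (L := L) (n := 1%N).
  rewrite (asboolF (notL h)); apply; apply: (IH1 (fun y => q (j y))); split=> //.
  - exact: (top_hasdeg hj).
  - by move=> x y; rewrite (topD hj) linearD.
  - by move=> t x; rewrite (topZ hj) linearZ.
  - move=> x y e; apply/eqP; rewrite -subr_eq0; apply/eqP/(top_inj hj).
    rewrite j0; apply: h; first exact: (top_in hj).
    by apply/kq; rewrite jB linearB e subrr.
  - by move=> x; apply/dq/(top_in hj).
  - by move=> z /qcomp [x /(top_onto hj) [y <-] <-]; exists y.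
have [y yE] := top_onto hj ud.
have jU x : U (j x).
  have /seteqP[_ e] : [set x | U (j x)] = setT.
    apply: (gsimple_sub sl (top_hasdeg hj)) => /=.
    - by rewrite j0; exact: sub_0 hU.
    - by move=> a b ha hb; rewrite (topD hj); exact: sub_D.
    - by move=> t a ha; rewrite (topZ hj); exact: sub_Z.
    - by exists y; rewrite ?yE // => e; apply: u0; rewrite -yE e j0.
  exact: e.
have [j' j'E] := choice (fun x => (iU (j x)).1 (jU x)).
have hX : is_top d j'.
  split=> //.
  - by move=> l x dl xl; apply: inj; rewrite linear0; apply: (bM l) => //; exact: di.
  - exact: (top_hasdeg hj).
  - by move=> a b; apply: inj; rewrite linearD !j'E (topD hj).
  - by move=> t a; apply: inj; rewrite linearZ !j'E (topZ hj).
  - by move=> a b e; apply: (top_inj hj); rewrite -!j'E e.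
  - by move=> a; apply/icomp; rewrite j'E; exact: (top_in hj).
  - by move=> a /icomp /(top_onto hj) [b bE]; exists b; apply: inj; rewrite j'E.
have := composition_cons dq qs kq sub sX (L := L) (n := 0%N).
rewrite (asboolT (top_unique hgr htri sl sX sL hX hL)); apply.
by apply: IH0 => z /qcomp [x /(top_onto hj) [b <-] <-]; apply/kq.
Qed.

Lemma simple_of_exists (lam : GT gr T) d : has_degree lam d -> gsimple lam ->
  exists L, is_simple_of Ap lam L.
Proof.
move=> hd sl; have [D [tau hP]] := standard_exists hgr htri hd.
have [Q [q [dq qs kq qcomp]]] := gquot_exists hA (core_graded hgr D d).
exists Q, D; first by exists tau.
by exists q; split=> // x; rewrite kq (gradical_std hgr htri hP hd sl).
Qed.

(** A composition factor L(mu) has a nonzero vector in the degree e of mu, which lifts to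
    M_e, so e <= d.  If e = d this vector comes from lam, and gives a nonzero T-map
    from lam to mu. *)
Lemma highest_weight_top (lam : GT gr T) d (M : GA gr) (j : lam -> M) :
  gsimple lam -> is_top d j -> highest_weight Ap M lam.
Proof.
move=> sl hj; have hd := top_hasdeg hj; split.
  have [L hL] := simple_of_exists hd sl; exists L => //.
  have [sL [jL tL]] := simple_of_top hgr htri sl hd hL.
  by have [_ h] := multiplicity_top sl sL tL (leqnn _) (top_bounded hj); exact: (h _ hj).
move=> mu L n sm hL [s [[F [_ _ gF Fs]] ss sn]] n0.
have [e he] := gsimple_degree htri sm.
have [sL [jL tL]] := simple_of_top hgr htri sm he hL.
have /(has_nthP M) [i si /asboolP [th [ph [dth dph thK phK]]]] :
    has (fun X => `[< giso X L >]) s by rewrite has_count sn lt0n; apply/eqP.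
have [_ [f [fl fd fs fk]]] := Fs i si.
have gW := gF i.+1 si; have hW := gsubm_sub gW.
have fpr := subquotient_pr gW fl fd.
have [l le l0] := top_degree_nz sm tL.
have [u0 Wu0 u0E] := fs (ph l).
pose u := pr M e u0.
have Wu : F i.+1 u by exact: gsubm_pr.
have ue : gm_comp M e u by exact: pr_in.
have fu : f u = ph l by rewrite /u fpr // u0E pr_id //; exact: dph.
have f0 : f 0 = 0 by exact: (lin_on_0 hW fl).
have un0 : u <> 0.
  by move=> u_0; apply: l0; rewrite -(phK l) -fu u_0 f0 linear0.
case: (ltgtP e d) => [ed|de|ed]; first by right; exists e, d.
  by case: un0; exact: (top_bounded hj) ue.
left; apply: giso_sym; rewrite {e}ed in he tL u ue Wu fu un0 le l0 *.
have j0 : j 0 = 0 by apply: (addIr (j 0)); rewrite -(topD hj) !add0r.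
have [y yE] := top_onto hj ue.
have jW x : F i.+1 (j x).
  have /seteqP[_ e] : [set x | F i.+1 (j x)] = setT.
    apply: (gsimple_sub sl hd) => /=.
    - by rewrite j0; exact: sub_0 hW.
    - by move=> a b ha hb; rewrite (topD hj); exact: sub_D.
    - by move=> t a ha; rewrite (topZ hj); exact: sub_Z.
    - by exists y; rewrite ?yE // => e; apply: un0; rewrite -yE e j0.
  exact: e.
have [g gE] := choice (fun x => top_onto tL (dth _ _ (fd _ _ (jW x) (top_in hj x)))).
apply: (schur_T (d := d) (g := g)) => //.
- move=> a b; apply: (top_inj tL); rewrite (topD tL) !gE (topD hj) -linearD.
  by rewrite -[j a in LHS]scale1r fl // scale1r.
- move=> t a; apply: (top_inj tL); rewrite (topZ tL) !gE (topZ hj) -linearZ.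
  by rewrite -[_ *: j a]addr0 fl ?f0 ?addr0 //; exact: sub_0.
- exists y => gy; have := gE y; rewrite gy yE fu phK => e; apply: l0.
  by rewrite -e; apply: (addIr (jL 0)); rewrite -(topD tL) !add0r.
Qed.

End HighestWeight.

(** * Shifts and simple quotients *)
Section Shift.
Variables (K : fieldType) (A : algType K) (gr : int -> set A).
Hypothesis hA : galgebra gr.

Lemma gshift_submodule (M : gmod gr) s (U : set M) :
  graded_submodule (U : set (gshift hA M s)) <-> graded_submodule U.
Proof.
split=> hU.
  apply: gsubm_intro; first exact: (gsubm_sub hU).
  move=> x i Ux; have [t [ut _ tE]] := gpr_supp (gm_grading (gshift hA M s)) x.
  have hUx k : U (pr (gshift hA M s) k x) by exact: gsubm_pr.
  rewrite tE gpr_sum; last exact: gm_grading.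
  apply: (sub_sum (gsubm_sub hU)) => k _.
  have hk : gm_comp M (k - s) (pr (gshift hA M s) k x) by exact: (pr_in (M := gshift hA M s)).
  rewrite (gpr_hom (gm_grading M) hk); case: eqP => _ //; exact: sub_0 (gsubm_sub hU).
apply: gsubm_intro; first exact: (gsubm_sub hU).
move=> x i Ux; have [t [ut _ tE]] := gpr_supp (gm_grading M) x.
have hUx k : U (pr M k x) by exact: gsubm_pr.
rewrite tE gpr_sum; last exact: gm_grading.
apply: (sub_sum (gsubm_sub hU)) => k _.
have hk : gm_comp (gshift hA M s) (k + s) (pr M k x).
  by rewrite /= addrK; exact: (pr_in (M := M)).
rewrite (gpr_hom (gm_grading (gshift hA M s)) hk); case: eqP => _ //; exact: sub_0 (gsubm_sub hU).
Qed.

Lemma gshift_gsimple (M : gmod gr) s : gsimple M -> gsimple (gshift hA M s).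
Proof. by move=> [h hs]; split=> // U /gshift_submodule; exact: hs. Qed.

Lemma gshift_gindec (M : gmod gr) s : gindecomposable M -> gindecomposable (gshift hA M s).
Proof.
by move=> [h hs]; split=> // U W /gshift_submodule gU /gshift_submodule gW; exact: hs.
Qed.

Lemma graded_schur (L L' : gmod gr) (f : {linear L -> L'}) : gsimple L -> gsimple L' ->
  degree_preserving f -> (exists x, f x <> 0) -> giso L L'.
Proof.
move=> [_ sL] [_ sL'] df [x fx]; apply: (giso_bij df).
- case: (sL _ (gsubm_ker df)) => e; last first.
    by have : [set y | f y = 0] x by [rewrite e].
  move=> y z yz; apply/eqP; rewrite -subr_eq0; apply/eqP.
  suff : [set y | f y = 0] (y - z) by rewrite e.
  by rewrite /= linearB yz subrr.
- have gI : graded_submodule (f @` setT) by apply: gsubm_img df _; exact: gsubm_T.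
  case: (sL' _ gI) => e y.
    by case: fx; have : (f @` setT) (f x) by [exists x]; rewrite e.
  by have : (f @` setT) y by [rewrite e]; case=> z _ <-; exists z.
Qed.

(** A nonzero map from M to a simple L is nonzero on a simple submodule of M, which is then
    isomorphic to L, or factors through the quotient by it. *)
Lemma simple_quotients_finite (M : gmod gr) : exists s : seq (gmod gr),
  forall (L : gmod gr) (f : {linear M -> L}), gsimple L -> degree_preserving f ->
    (exists x, f x <> 0) -> exists2 i, (i < size s)%N & giso (nth M s i) L.
Proof.
move: {2}(kdim [set: M]) (leqnn (kdim [set: M])) => k.
elim: k M => [|k IH] M hk.
  exists [::] => L f _ _ [x []].
  have : [set: M] x by [].
  rewrite (kdim_eq0 (gm_fd hA M) (ksubT M)); first by move=> ->; rewrite linear0.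
  by apply/eqP; rewrite -leqn0.
have [hM|/contrapT hM] := pselect (~ exists x : M, x <> 0).
  exists [::] => L f _ _ [x []]; suff -> : x = 0 by rewrite linear0.
  by apply: contrapT => x0; apply: hM; exists x.
have [U [X [Q [i [q [[sX ltQ] gU [inj iU icomp] [dq qs kq qcomp] _]]]]]] :=
  simple_submodule hA hM.
have di : degree_preserving i by move=> l y /icomp.
have hQ : (kdim [set: Q] <= k)%N by rewrite -ltnS; exact: leq_trans ltQ hk.
have [s hs] := IH Q hQ.
exists (X :: s) => L f sL df [x fx].
have [[y fy]|h] := pselect (exists y, f (i y) <> 0).
  exists 0%N => //=; apply: (graded_schur (f := mklin (comp_linear f i)) sX sL); last by exists y.
  by move=> l z zl; apply/df/di.
have h0 z : q z = 0 -> f z = 0.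
  by move=> /kq/iU [y <-]; apply: contrapT => fy; apply: h; exists y.
have [g gE] := factor_linear (f := f) qs h0.
have dg : degree_preserving g by move=> l _ /qcomp [z zl <-]; rewrite gE; exact: df.
have [|l ls hl] := hs L g sL dg; first by exists (q x); rewrite gE.
by exists l.+1 => //=; rewrite (set_nth_default Q).
Qed.

Lemma giso_has_degree (M N : gmod gr) d : has_degree M d -> giso M N -> has_degree N d.
Proof. by move=> h [f [g [df dg fK gK]]] x; rewrite -(gK x); apply: df. Qed.

Lemma has_degree_uniq (M : gmod gr) d e : (exists x : M, x <> 0) ->
  has_degree M d -> has_degree M e -> d = e.
Proof.
move=> [x x0] hd he; apply: contrapT => /eqP de.
exact: x0 (gr_disj (gm_grading M) (hd x) (he x) de).
Qed.

Lemma deg_pres_has_degree (M N : gmod gr) d (f : {linear M -> N}) :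
  has_degree M d -> has_degree N d -> degree_preserving f.
Proof.
move=> hM hN i x xi; case: (eqVneq i d) => [->|id]; first exact: hN.
by rewrite (gr_disj (gm_grading M) xi (hM x) id) linear0; exact: (gr0 (gm_grading N)).
Qed.

End Shift.

(** * Projective covers and the classification of tilting objects *)
Section Covers.
Variables (K : fieldType) (A : falgType K) (gr : int -> {vspace A}).
Variables (Am T Ap : {aspace A}).
Hypothesis hgr : graded_algebra gr.
Hypothesis htri : triangular_decomposition gr Am T Ap.
Hypothesis hT : semisimple_ring (subvs_of T).
Hypothesis sA : self_injective A.
Notation gs := (alg_grading gr).
Notation S := (subvs_of T).
Notation n := (\dim Am).
Notation p := (\dim Ap).
Notation NP := (Npos gr Ap).
Notation NM := (Nneg gr Am).
Let hA := tri_galgebra hgr.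
Let hS := T_galgebra hgr htri.
Notation proji := (projinj Am Ap).

Lemma gshift_projinj (P : GA gr) s : proji P -> proji (gshift hA P s).
Proof.
move=> [gd gc jP pP]; split=> //.
- move=> X Y i g di dg inj.
  have [|||h [dh hE]] := jP (gshift hA X (- s)) (gshift hA Y (- s)) i g.
  + by move=> l x; apply: di.
  + by move=> l x /dg; rewrite /= opprK addrK.
  + exact: inj.
  exists h; split=> // l x xl; apply: (dh (l - s)); by rewrite /= opprK subrK.
- move=> M N f g df dg fs.
  have [|||h [dh hE]] := pP (gshift hA M (- s)) (gshift hA N (- s)) f g.
  + by move=> l x; apply: df.
  + by move=> l x xl; rewrite /= opprK; apply: dg; rewrite /= addrK.
  + exact: fs.
  exists h; split=> // l x /dh; by rewrite /= opprK subrK.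
Qed.

(** A shift does not change carriers, so j itself serves, between shifted modules. *)
Lemma gshift_top (M : GA gr) d (lam : GT gr T) (j : lam -> M) s : is_top d j ->
  is_top (d + s) (j : gshift hS lam s -> gshift hA M s).
Proof.
move=> h; split.
- move=> i x ds xi; apply: (top_bounded h _ xi); by rewrite ltrBrDr.
- by move=> x; rewrite /= addrK; exact: (top_hasdeg h).
- exact: (topD h).
- exact: (topZ h).
- exact: (top_inj h).
- by move=> x; rewrite /= addrK; exact: (top_in h).
- by move=> x; rewrite /= addrK; exact: (top_onto h).
Qed.

(** If q2 does not vanish on the kernel of q1, it maps that kernel onto L2, and lifting q2
    through it gives an endomorphism e of P with q2 e = q2 and q1 e = 0.  The first
    equality forbids nilpotency and the second surjectivity, against Fitting's lemma. *)
Lemma unique_simple_quotient (P L1 L2 : GA gr) (q1 : {linear P -> L1}) (q2 : {linear P -> L2}) :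
  gindecomposable P -> gprojective P -> gsimple L1 -> gsimple L2 ->
  degree_preserving q1 -> degree_preserving q2 ->
  (forall y, exists x, q1 x = y) -> (forall y, exists x, q2 x = y) -> giso L1 L2.
Proof.
move=> iP pP s1 s2 d1 d2 f1 f2.
have gK := gsubm_ker d1.
have [[x x1] x2] : exists x1x2 : L1 * L2, x1x2.1 <> 0 /\ x1x2.2 <> 0.
  by case: s1 => -[a a0] _; case: s2 => -[b b0] _; exists (a, b).
case: x2 => /= a0 b0.
case: (s2.2 _ (gsubm_img d2 gK)) => e.
  have h z : q1 z = 0 -> q2 z = 0.
    by move=> hz; have : (q2 @` [set x | q1 x = 0]) (q2 z) by [exists z]; rewrite e.
  have [g gE] := factor_linear (f := q2) f1 h.
  have dg : degree_preserving g.
    move=> i y yi; have [z zE] := f1 y.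
    by rewrite -(pr_id yi) -zE (pr_map d1) gE; apply: d2; exact: pr_in.
  apply: (graded_schur (f := g)) => //; have [z zE] := f2 x1.
  by exists (q1 z); rewrite gE zE.
have [X [i [inj iU icomp]]] := gsub_exists hA gK.
have di : degree_preserving i by move=> l y /icomp.
have dqi : degree_preserving (mklin (comp_linear q2 i)) by move=> l y yl; apply/d2/di.
have sqi y : exists u, mklin (comp_linear q2 i) u = y.
  have : (q2 @` [set x | q1 x = 0]) y by rewrite e.
  by case=> z /iU [u <-] <-; exists u.
have [h [dh hE]] := pP X L2 _ q2 dqi d2 sqi.
have dih : degree_preserving (mklin (comp_linear i h)) by move=> l y yl; apply/di/dh.
have [[k hk]|[_ hs]] := fitting hA iP dih.
  have [z zE] := f2 x1; case: b0; rewrite -zE.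
  have : q2 (iter k (mklin (comp_linear i h)) z) = q2 z.
    elim: k {hk} => //= k <-; exact: hE.
  by rewrite hk linear0.
have [z zE] := f1 x; have [w wE] := hs z; case: a0.
by rewrite -zE -wE; apply/iU; exists (h w).
Qed.

(** A projective-injective module of least dimension that maps onto L is indecomposable: in
    a decomposition one summand already maps onto L. *)
Lemma cover_exists (L : GA gr) : gsimple L -> exists (P : GA gr) (f : {linear P -> L}),
  [/\ proji P, gindecomposable P, degree_preserving f & forall y, exists x, f x = y].
Proof.
move=> sL.
have onto (P : GA gr) (f : {linear P -> L}) : degree_preserving f -> (exists x, f x <> 0) ->
    forall y, exists x, f x = y.
  move=> df [x fx] y.
  have gI : graded_submodule (f @` setT) by apply: gsubm_img df _; exact: gsubm_T.
  case: (sL.2 _ gI) => e.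
    by case: fx; have : (f @` setT) (f x) by [exists x]; rewrite e.
  by have : (f @` setT) y by [rewrite e]; case=> z _ <-; exists z.
pose Q k := `[< exists (P : GA gr) (f : {linear P -> L}),
  [/\ proji P, degree_preserving f, exists x, f x <> 0 & kdim [set: P] = k] >].
have Q0 : exists k, Q k.
  have [d [[x xd x0] _]] := top_degree_ex hA sL.1.
  have hl : linear (fun a : shiftA hA d => (a : A) *: x).
    by move=> a u v; rewrite scalerDl -[a *: u]/(a * u : A) scalerA.
  exists (kdim [set: shiftA hA d]); apply/asboolP; exists (shiftA hA d), (mklin hl); split=> //.
  - exact: (shift_projinj hgr htri d sA).
  - by move=> i a ai /=; rewrite -[i](subrK d); apply: gm_act.
  - by exists (1 : A); rewrite /= scale1r.
have [k /asboolP[P [f [pP df fx kP]]] kmin] := ex_minnP Q0.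
exists P, f; split=> //; last exact: onto.
have ret (U W : set P) : graded_submodule U -> graded_submodule W -> internal_dsum U W ->
    (exists2 u, U u & f u <> 0) -> W = [set 0].
  move=> gU gW UW [u Uu fu].
  have [R [i [r [[di dr] ri iU rW]]]] := summand_retract hgr gU gW UW.
  have pR := retract_projinj hgr htri di dr ri pP.
  have inj : injective i by move=> x y e; rewrite -(ri x) e ri.
  have fR := gm_fd hA R; have fP := gm_fd hA P.
  have iUT : i @` setT = U.
    by apply/seteqP; split=> x; [case=> y _ <-; apply/iU; exists y | case/iU => y <-; exists y].
  have dR : kdim [set: R] = kdim U.
    rewrite -iUT; apply/esym/(kdim_inj fR fP (ksubT _) (klin_lin i)).
    by move=> x _ e; apply: inj; rewrite e linear0.
  have le : (k <= kdim [set: R])%N.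
    apply: kmin; apply/asboolP; exists R, (mklin (comp_linear f i)); split=> //.
    + by move=> l x xl; apply/df/di.
    + by have [y yE] := (iU u).1 Uu; exists y; rewrite /= yE.
  have UT : U = setT.
    apply: (kdim_eq fP (ksub_submodule (gsubm_sub gU)) (ksubT P)) => //.
    by rewrite kP -dR.
  by case: UW => UW _; rewrite -UW UT setTI.
have [x0 fx0] := fx.
split; first by exists x0 => e; case: fx0; rewrite e linear0.
move=> U W gU gW UW.
have [u [w [Uu Ww xE]]] := UW.2 x0.
have [fu|fu] := pselect (f u = 0); last by right; apply: (ret U W) => //; exists u.
left; apply: (ret W U) => //.
  case: UW => UW0 UWT; split; first by rewrite setIC.
  by move=> y; have [a [b [Ua Wb ->]]] := UWT y; exists b, a; rewrite addrC.
by exists w => // fw; case: fx0; rewrite xE linearD fu fw addr0.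
Qed.

(** Let lam be a simple submodule of P_d, with retraction pi.  The endomorphism of P
    extending the projection of P_d onto lam is the identity on lam, so it is not
    nilpotent; by Fitting's lemma it is injective, hence P_d = lam. *)
Lemma indec_projinj_top (P : GA gr) : proji P -> gindecomposable P ->
  exists (lam : GT gr T) d (j : lam -> P), gsimple lam /\ is_top d j.
Proof.
move=> [gd gc jP pP] iP.
have [d [dx bP]] := top_degree_ex hA iP.1.
have [lam [j [slam hd [jD jZ inj jd]]]] := Tsub_simple hgr htri d (Tsub_comp htri P d) dx.
have [pi [[piD piZ pi0] pij]] := coprojection_exists hgr htri hT hd jD jZ inj jd.
have [h [dh hE]] := extend_top hgr htri (g := fun x => j (pi x)) bP bP gd jP
  (fun x y _ _ => etrans (congr1 j (piD x y)) (jD _ _))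
  (fun t x _ => etrans (congr1 j (piZ t x)) (jZ _ _)) (fun x _ => jd _).
have hj y : h (j y) = j y by rewrite hE // pij.
exists lam, d, j; split=> //; split=> // x xd.
have [[k hk]|[hinj _]] := fitting hA iP dh.
  have [[y y0] _] := slam; case: y0; apply: inj.
  have : iter k h (j y) = j y by elim: k {hk} => //= k ->.
  by rewrite hk => <-; apply: (addIr (j 0)); rewrite -jD !add0r.
by exists (pi x); apply: hinj; rewrite hj hE.
Qed.

(** The composite P -> M -> P of the maps given by [lift_top] and [extend_top] is the
    identity on the top of P, hence bijective by Fitting's lemma; so P is a direct
    summand of the indecomposable M. *)
Lemma tilting_unique (M P : GA gr) (lam : GT gr T) d (j : lam -> M) (jP : lam -> P) :
  gindecomposable M -> Nfree NM n [set: M] -> Ncofree NP p [set: M] ->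
  gindecomposable P -> proji P -> bounded M d -> is_top d jP ->
  gsimple lam ->
  (forall x y, j (x + y) = j x + j y) -> (forall t x, j (t *: x) = vsval t *: j x) ->
  injective j -> (forall x, gm_comp M d (j x)) -> giso M P.
Proof.
move=> iM gM cM iP [_ _ injP pP] bM hP slam jD jZ inj jd.
have hd := top_hasdeg hP.
have [piM [hM piMj]] := coprojection_exists hgr htri hT hd jD jZ inj jd.
have [piP [hpP piPj]] := coprojection_exists hgr htri hT hd (topD hP) (topZ hP)
  (top_inj hP) (top_in hP).
have sM y : exists2 x, gm_comp M d x & piM x = y by exists (j y).
have [f [df fE]] := lift_top hgr htri bM (top_bounded hP) hd cM pP hM sM hpP.
have [piD piZ _] := hM.
have [h [dh hE]] := extend_top hgr htri (g := fun x => jP (piM x)) bM (top_bounded hP) gM injP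
  (fun x y _ _ => etrans (congr1 jP (piD x y)) (topD hP _ _))
  (fun t x _ => etrans (congr1 jP (piZ t x)) (topZ hP _ _)) (fun x _ => top_in hP _).
have hf y : h (f (jP y)) = jP y by rewrite hE ?fE ?piPj //; apply/df/(top_in hP).
have dhf : degree_preserving (mklin (comp_linear h f)) by move=> i x xi; apply/dh/df.
have [y0 yn0] := slam.1.
have jP0 : jP y0 <> 0.
  move=> e; apply: yn0; apply: (top_inj hP); rewrite e; apply: (addIr (jP 0)).
  by rewrite -(topD hP) !add0r.
have [[k hk]|[hinj hs]] := fitting hA iP dhf.
  case: jP0; rewrite -(hk (jP y0)); elim: k {hk} => //= k <-; exact: esym (hf _).
have gI : graded_submodule (f @` setT) by apply: gsubm_img df _; exact: gsubm_T.
have gK := gsubm_ker dh.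
case: (iM.2 _ _ gI gK) => [|e|e].
- split.
    apply/seteqP; split=> [_ [[y _ <-]] /= e|_ ->]; last first.
      by split; [exists 0; rewrite ?linear0 | rewrite /= linear0].
    by rewrite (hinj y 0) ?linear0 //= e !linear0.
  move=> x; have [z zE] := hs (h x); exists (f z), (x - f z); split.
  + by exists z.
  + by rewrite /= linearB -zE subrr.
  + by rewrite addrC subrK.
- case: jP0; rewrite -hf; have : (f @` setT) (f (jP y0)) by [exists (jP y0)].
  by rewrite e => ->; rewrite linear0.
- apply: (giso_bij (f := h) dh) => [x y xy|y].
    apply/eqP; rewrite -subr_eq0; apply/eqP.
    suff : [set x | h x = 0] (x - y) by rewrite e.
    by rewrite /= linearB xy subrr.
  by have [x <-] := hs y; exists (f x).
Qed.

End Covers.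

(** * Every simple T-module is the top of an indecomposable projective *)
Section Existence.
Variables (K : fieldType) (A : falgType K) (gr : int -> {vspace A}).
Variables (Am T Ap : {aspace A}).
Hypothesis hgr : graded_algebra gr.
Hypothesis htri : triangular_decomposition gr Am T Ap.
Hypothesis hT : semisimple_ring (subvs_of T).
Hypothesis sA : self_injective A.
Notation gs := (alg_grading gr).
Notation S := (subvs_of T).
Let hA := tri_galgebra hgr.
Let hS := T_galgebra hgr htri.
Notation proji := (projinj Am Ap).

Lemma giso_same_degree (lam mu : GT gr T) d (f : {linear lam -> mu}) (g : {linear mu -> lam}) :
  has_degree lam d -> has_degree mu d -> cancel f g -> cancel g f -> giso lam mu.
Proof.
by move=> hl hm fK gK; exists f, g; split=> //; exact: deg_pres_has_degree.
Qed.

(** For lam in degree 0, mu is the top of an indecomposable projective P that maps onto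
    L(lam), moved to degree 0; a is the degree of the top of P. *)
Definition cover_top (lam mu : GT gr T) : Prop :=
  exists (P L : GA gr) (q : {linear P -> L}) (a : int)
    (jL : lam -> L) (jP : gshift hS mu a -> P),
  [/\ proji P /\ gindecomposable P, degree_preserving q /\ (forall y, exists x, q x = y),
      gsimple L, is_top 0 jL & is_top a jP].

Lemma cover_top_exists (lam : GT gr T) : gsimple lam -> has_degree lam 0 ->
  exists mu, [/\ gsimple mu, has_degree mu 0 & cover_top lam mu].
Proof.
move=> sl hd; have [L hL] := simple_of_exists hgr htri hd sl.
have [sL [jL tL]] := simple_of_top hgr htri sl hd hL.
have [P [q [pP iP dq sq]]] := cover_exists hgr htri sA sL.
have [mu [a [j [sm hj]]]] := indec_projinj_top hgr htri hT pP iP.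
exists (gshift hS mu (- a)); split.
- exact: gshift_gsimple.
- by move=> x; rewrite /= sub0r opprK; exact: (top_hasdeg hj).
exists P, L, q, a, jL, j; split=> //; split.
- exact: (top_bounded hj).
- by move=> x; rewrite /= subrr sub0r opprK; exact: (top_hasdeg hj).
- exact: (topD hj).
- exact: (topZ hj).
- exact: (top_inj hj).
- exact: (top_in hj).
- exact: (top_onto hj).
Qed.

(** Shifting the second cover puts both tops in the same degree.  Then the covers are
    isomorphic by [tilting_unique], so the simple quotients agree up to the shift, and
    the tops of these are lam and mu. *)
Lemma cover_top_inj (lam mu lam' mu' : GT gr T) : gsimple lam -> gsimple mu -> gsimple lam' ->
  cover_top lam lam' -> cover_top mu mu' -> giso lam' mu' -> giso lam mu.
Proof.
move=> sl sm sl' [P [L [q [a [jL [jP [[pP iP] [dq sq] sL tL tP]]]]]]].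
move=> [Q [L' [q' [b [jL' [jQ [[pQ iQ] [dq' sq'] sL' tL' tQ]]]]]]].
move=> [f [g [df dg fK gK]]].
pose s := a - b.
have bs : b + s = a by rewrite /s addrC subrK.
have tQs := gshift_top hgr htri s tQ; rewrite bs in tQs.
have iso : giso (gshift hS (gshift hS mu' b) s) (gshift hS lam' a).
  exact: (giso_same_degree (f := (g : {linear gshift hS (gshift hS mu' b) s -> gshift hS lam' a}))
    (g := f) (top_hasdeg tQs) (top_hasdeg tP)).
have [k hk] := top_weight_giso tQs (top_hasdeg tP) iso.
have [gdQ gcQ _ _] := pQ.
have [th [ph [dth dph thK phK]]] : giso (gshift hA Q s) P.
  apply: (tilting_unique hgr htri hT _ _ _ iP pP (top_bounded hk) tP _ (topD hk) (topZ hk)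
    (top_inj hk) (top_in hk)) => //; first exact: gshift_gindec.
  exact: gshift_gsimple.
have dq's : degree_preserving (q' : {linear gshift hA Q s -> gshift hA L' s}).
  by move=> i x; apply: dq'.
have LL : giso L (gshift hA L' s).
  have [_ _ _ jpP] := pP.
  apply: (unique_simple_quotient hgr (q1 := q)
    (q2 := mklin (comp_linear (q' : {linear gshift hA Q s -> gshift hA L' s}) ph))
    iP jpP sL _ dq _ sq) => //; first exact: gshift_gsimple.
  - by move=> i x xi; apply/dq's/dph.
  - by move=> y; have [x xE] := sq' y; exists (th x); rewrite /= thK.
have [k1 hk1] := top_giso tL LL.
have hk2 := gshift_top hgr htri s tL'.
have [f1 [g1 [df1 dg1 fK1 gK1]]] := top_weight sl (gshift_gsimple hS s sm) hk1 hk2.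
exact: (giso_same_degree (f := (f1 : {linear lam -> mu})) (g := g1)
  (top_hasdeg tL) (top_hasdeg tL')).
Qed.

(** A simple T-module in degree 0 is a quotient of the regular module. *)
Lemma degree0_finite : exists s : seq (GT gr T), forall lam : GT gr T,
  gsimple lam -> has_degree lam 0 -> exists2 i, (i < size s)%N & giso (nth (shiftA hS 0) s i) lam.
Proof.
have [s hs] := simple_quotients_finite hS (shiftA hS 0); exists s => lam sl hd.
have [x x0] := sl.1.
have hl : linear (fun t : shiftA hS 0 => (t : S) *: x).
  by move=> a u v; rewrite scalerDl -[a *: u]/(a * u : S) scalerA.
apply: (hs lam (mklin hl)) => //.
- move=> i t ti /=; rewrite -[i]addr0; apply: gm_act; last exact: hd.
  by move: ti; rewrite /= subr0.
- by exists (1 : S); rewrite /= scale1r.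
Qed.

(** Iterate a choice F of tops starting from lam.  By finiteness two iterates are isomorphic,
    and injectivity descends to an isomorphism of lam with a later iterate. *)
Lemma cover_top_surj (lam : GT gr T) : gsimple lam -> has_degree lam 0 ->
  exists mu nu, [/\ gsimple nu, has_degree nu 0, cover_top mu nu & giso nu lam].
Proof.
move=> sl hd.
have /choice[F FE] x : exists y, gsimple x /\ has_degree x 0 ->
    [/\ gsimple y, has_degree y 0 & cover_top x y].
  have [[sx hx]|h] := pselect (gsimple x /\ has_degree x 0).
    by have [mu hmu] := cover_top_exists sx hx; exists mu.
  by exists x => /h.
have It i : gsimple (iter i F lam) /\ has_degree (iter i F lam) 0.
  by elim: i => //= i /FE [].
have step i : cover_top (iter i F lam) (iter i.+1 F lam) by have [] := FE _ (It i).
have [s hs] := degree0_finite.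
have /choice[c cE] i : exists k : 'I_(size s), giso (nth (shiftA hS 0) s k) (iter i F lam).
  by have [k ks hk] := hs _ (It i).1 (It i).2; exists (Ordinal ks).
have : ~ injective (fun i : 'I_(size s).+1 => c i).
  by move/leq_card; rewrite !card_ord ltnn.
move/existsNP => [i /existsNP [j /not_implyP [cij ij]]].
have key a b : (a < b)%N -> giso (iter a F lam) (iter b F lam) ->
    exists m, giso (iter m.+1 F lam) lam.
  elim: a b => [|a IH] [|b] //= ab h; first by exists b; exact: giso_sym.
  apply: (IH b) => //.
  exact: (cover_top_inj (It a).1 (It b).1 (It a.+1).1 (step a) (step b) h).
have [m hm] : exists m, giso (iter m.+1 F lam) lam.
  have h a b : c a = c b -> giso (iter a F lam) (iter b F lam).
    by move=> e; apply: giso_trans (giso_sym (cE a)) _; rewrite e.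
  case: (ltngtP i j) => [lij|lji|e].
  - by apply: key lij _; exact: h.
  - by apply: key lji _; apply: h.
  - by case: ij; exact: val_inj.
exists (iter m F lam), (iter m.+1 F lam); split=> //.
- exact: (It m.+1).1.
- exact: (It m.+1).2.
Qed.

Lemma indec_projinj_exists (lam : GT gr T) : gsimple lam ->
  exists (P : GA gr) d (j : lam -> P), [/\ proji P, gindecomposable P & is_top d j].
Proof.
move=> sl; have [d hd] := gsimple_degree htri sl.
have hd0 : has_degree (gshift hS lam (- d)) 0.
  by move=> x; rewrite /= sub0r opprK; exact: hd.
have [mu [nu [sn hn]]] := cover_top_surj (gshift_gsimple hS (- d) sl) hd0.
move=> [P [L [q [a [jL [jP [[pP iP] _ _ _ tP]]]]]]] [f [g [df dg fK gK]]].
have tPs := gshift_top hgr htri (d - a) tP.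
rewrite (_ : a + (d - a) = d) in tPs; last by rewrite addrC subrK.
have iso : giso (gshift hS (gshift hS nu a) (d - a)) lam.
  exact: (giso_same_degree (f := (f : {linear gshift hS (gshift hS nu a) (d - a) -> lam}))
    (g := g) (top_hasdeg tPs) hd).
have [k hk] := top_weight_giso tPs hd iso.
exists (gshift hA P (d - a)), d, k; split=> //; last exact: gshift_gindec.
exact: gshift_projinj.
Qed.

(** The projective whose top is a simple submodule of M_d is isomorphic to M. *)
Lemma indec_tilting_top (M : GA gr) : indecomposable_tilting Am T Ap M ->
  exists (lam : GT gr T) d (j : lam -> M), gsimple lam /\ is_top d j.
Proof.
move=> [iM [/(std_filtered_Nfree hgr htri) gd /(costd_filtered_Ncofree hgr htri) gc]].
have [d [dx bM]] := top_degree_ex hA iM.1.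
have [lam [j [sl hd [jD jZ inj jd]]]] := Tsub_simple hgr htri d (Tsub_comp htri M d) dx.
have [P [e [k [pP iP tP]]]] := indec_projinj_exists sl.
have de := has_degree_uniq sl.1 hd (top_hasdeg tP).
case: _ / de tP => tP.
have iso := tilting_unique hgr htri hT iM gd gc iP pP bM tP sl jD jZ inj jd.
have [j' hj'] := top_giso tP (giso_sym iso).
by exists lam, d, j'.
Qed.

Lemma indec_tilting_iso (M P : GA gr) (lam : GT gr T) d e (j : lam -> M) (k : lam -> P) :
  indecomposable_tilting Am T Ap M -> gindecomposable P -> proji P -> gsimple lam ->
  is_top d j -> is_top e k -> giso M P.
Proof.
move=> [iM [/(std_filtered_Nfree hgr htri) gd /(costd_filtered_Ncofree hgr htri) gc]] iP pP sl hj hk.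
have de := has_degree_uniq sl.1 (top_hasdeg hj) (top_hasdeg hk).
case: _ / de hk => hk.
exact: (tilting_unique hgr htri hT iM gd gc iP pP (top_bounded hj) hk sl (topD hj) (topZ hj)
  (top_inj hj) (top_in hj)).
Qed.

Lemma projinj_tilting (P : GA gr) : proji P -> gindecomposable P ->
  indecomposable_tilting Am T Ap P.
Proof.
move=> [gd gc _ _] iP; split=> //; split.
  exact: (Nfree_std_filtered hgr htri gd).
exact: (Ncofree_costd_filtered hgr htri hT gc).
Qed.

Lemma projinj_tilting_weight (P : GA gr) (lam : GT gr T) d (j : lam -> P) :
  proji P -> gindecomposable P -> gsimple lam -> is_top d j ->
  tilting_of_weight Am Ap lam P.
Proof.
move=> pP iP sl hj; have hd := top_hasdeg hj; have [gd gc _ _] := pP.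
split.
- exact: projinj_tilting.
- exact: (highest_weight_top hgr htri sl hj).
- have [D hD] := standard_exists hgr htri hd; exists D => //.
  have [tau [h [_ dh inj _ _]]] := delta_embed hgr htri (top_bounded hj) hd hD (topD hj) (topZ hj)
    (top_inj hj) (top_in hj) gd.
  by exists h.
- have [N hN] := costandard_exists hgr htri hd; exists N => //.
  have [pi [hpi pij]] := coprojection_exists hgr htri hT hd (topD hj) (topZ hj) (top_inj hj)
    (top_in hj).
  have [piN [_ dN _ _ univ]] := costandardP hgr htri hd hN.
  have [F [dF piF FE]] := univ P pi (top_bounded hj) hpi.
  have [Fs _] := nabla_surj hgr htri (top_bounded hj) dN hpi
    (fun y => ex_intro2 _ _ (j y) (top_in hj y) (pij y)) FE gc.
  by exists F.
Qed.

Lemma weight_le_anti (lam mu : GT gr T) : gsimple lam -> gsimple mu ->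
  weight_le lam mu -> weight_le mu lam -> giso lam mu.
Proof.
move=> sl sm [//|[d [e [hl hm de]]]] [/giso_sym //|[d' [e' [hm' hl' de']]]].
have E1 := has_degree_uniq sl.1 hl hl'; have E2 := has_degree_uniq sm.1 hm hm'.
by move: de'; rewrite -E1 -E2 ltNge (ltW de).
Qed.

(** The highest weight of M is unique, and it is the top degree part of M. *)
Lemma tilting_weight_top (M : GA gr) (lam : GT gr T) : gsimple lam ->
  tilting_of_weight Am Ap lam M -> exists d (j : lam -> M), is_top d j.
Proof.
move=> sl [tM [[L hL mL] hw] _ _].
have [mu [d [k [sm hk]]]] := indec_tilting_top tM.
have [[L' hL' mL'] hw'] := highest_weight_top hgr htri sm hk.
have iso : giso lam mu.
  apply: weight_le_anti => //; first exact: (hw' _ _ _ sl hL mL).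
  exact: (hw _ _ _ sm hL' mL').
have hd := giso_has_degree (top_hasdeg hk) (giso_sym iso).
by have [j hj] := top_weight_giso hk hd (giso_sym iso); exists d, j.
Qed.

End Existence.

Theorem theorem1p2 (K : fieldType) (A : falgType K) (gr : int -> {vspace A})
    (Am T Ap : {aspace A})
    (hgr : graded_algebra gr)
    (htri : triangular_decomposition gr Am T Ap)
    (hT : semisimple_ring (subvs_of T))
    (hA : self_injective A) :
  exists Tilt : GT gr T -> GA gr,
    [/\ forall lam, gsimple lam ->
          tilting_of_weight Am Ap lam (Tilt lam) /\
          (forall M : GA gr, tilting_of_weight Am Ap lam M ->
             giso M (Tilt lam)),
        forall lam mu, gsimple lam -> gsimple mu ->
          (giso (Tilt lam) (Tilt mu) <-> giso lam mu)
      & forall M : GA gr, indecomposable_tilting Am T Ap M ->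
          exists2 lam, gsimple lam & giso (Tilt lam) M].
Proof.
have /choice[Tilt TE] (lam : GT gr T) : exists P : GA gr, gsimple lam ->
    exists d (j : lam -> P), [/\ projinj Am Ap P, gindecomposable P & is_top d j].
  have [sl|nsl] := pselect (gsimple lam); last by exists (shiftA (tri_galgebra hgr) 0) => /nsl.
  have [P [d [j h]]] := indec_projinj_exists hgr htri hT hA sl.
  by exists P => _; exists d, j.
exists Tilt; split=> [lam sl|lam mu sl sm|M tM].
- have [d [j [pP iP hj]]] := TE lam sl; split.
    exact: (projinj_tilting_weight hgr htri hT pP iP sl hj).
  move=> M hM; have [e [k hk]] := tilting_weight_top hgr htri hT hA sl hM.
  by case: hM => tM _ _ _; exact: (indec_tilting_iso hgr htri hT tM iP pP sl hk hj).
- have [d [j [pP iP hj]]] := TE lam sl; have [e [k [pQ iQ hk]]] := TE mu sm.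
  split=> [iso|iso].
    have [k' hk'] := top_giso hj iso; exact: (top_weight sl sm hk' hk).
  have hd := giso_has_degree (top_hasdeg hk) (giso_sym iso).
  have [k' hk'] := top_weight_giso hk hd (giso_sym iso).
  exact: (indec_tilting_iso hgr htri hT (projinj_tilting hgr htri hT pP iP) iQ pQ sl hj hk').
- have [lam [d [j [sl hj]]]] := indec_tilting_top hgr htri hT hA tM.
  exists lam => //; have [e [k [pP iP hk]]] := TE lam sl.
  exact: giso_sym (indec_tilting_iso hgr htri hT tM iP pP sl hj hk).
Qed.
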